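(* Let $(M^7,\eta,\Phi,\Upsilon)$ be a contact Calabi--Yau $7$-manifold such that $\omega=d\eta$ is transverse Ricci-flat and $|\Upsilon|_\omega=1$. Let $\epsilon>0$, $A\in\mathbb{R}$, and let $a_t,b_t>0$ be smooth functions of $t$ only (constant on $M$). Then the family of $\mathrm{G}_2$-structures $$\varphi_t=b_t^3\,\mathrm{Re}\,\Upsilon+a_tb_t^2\,\eta\wedge\omega$$ solves the modified Laplacian coflow with constant $A$ and initial condition $\varphi_0=\mathrm{Re}\,\Upsilon+\epsilon\,\eta\wedge\omega$ if, and only if, $a_t$ and $b_t$ satisfy $$a_t=\epsilon\,b_t^{-3},\qquad \frac{d}{dt}b_t=\frac12\,\epsilon\,b_t^{-9}\left(A\,b_t^5-\epsilon\right),$$ with $a_0=\epsilon$ and $b_0=1$.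
   Context: A Sasakian structure $(\xi,\eta,\Phi,g)$ on $M^7$: $\xi$ (Reeb field) is a vector field, $\eta$ (contact form) a $1$-form, $\Phi$ a $(1,1)$-tensor with $\eta(\xi)=1$, $\Phi^2=-\mathrm{Id}+\eta\otimes\xi$, $\eta\wedge(d\eta)^3\neq0$, $g$ a metric with $g(\Phi X,\Phi Y)=g(X,Y)-\eta(X)\eta(Y)$, $g=d\eta\circ(1\otimes\Phi)+\eta\otimes\eta$, such that the cone $(\mathbb{R}_{>0}\times M,dr^2+r^2g)$ is Kähler. A form $\alpha$ is basic if $\xi\lrcorner\alpha=0$ and $\mathcal{L}_\xi\alpha=0$. $\Phi$ induces an (integrable) transverse complex structure on $\mathcal{D}=\ker\eta$, giving types $(p,q)$ on basic forms. A contact Calabi--Yau $7$-manifold $(M^7,\eta,\Phi,\Upsilon)$ is a $7$-dimensional Sasakian manifold with vanishing first basic Chern class $c_1^B(M)=0$ and a nowhere-vanishing closed transverse (basic) form $\Upsilon$ of type $(3,0)$ on $\mathcal{D}$; with $\omega=d\eta$, $|\Upsilon|_\omega>0$ is defined by $\frac{\omega^3}{3!}=\frac{i}{8}\frac{1}{|\Upsilon|^2_\omega}\Upsilon\wedge\overline{\Upsilon}$ (it is constant when $\omega$ is transverse Ricci-flat). A $\mathrm{G}_2$-structure $\varphi\in\Omega^3(M^7)$ determines a metric $g_\varphi$ and volume form by $(X\lrcorner\varphi)\wedge(Y\lrcorner\varphi)\wedge\varphi=6g_\varphi(X,Y)\mathrm{vol}_\varphi$, a Hodge star $\ast_\varphi$,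 the dual $4$-form $\psi=\ast_\varphi\varphi$, and the scalar torsion $\tau_0=\frac17\ast_\varphi(\varphi\wedge d\varphi)$. A family $\varphi_t$ solves the modified Laplacian coflow with constant $A$ if $\psi_t=\ast_t\varphi_t$ satisfies $$\frac{\partial}{\partial t}\psi_t=\Delta_t\psi_t+d\Big(\big(A-\tfrac72(\tau_0)_t\big)\varphi_t\Big),$$ where $\Delta_t=dd^{\ast_t}+d^{\ast_t}d$ is the Hodge Laplacian of $g_{\varphi_t}$. *)

(* Defs.v *)
From mathcomp Require Import all_boot all_order all_algebra all_fingroup.
From mathcomp Require Import all_classical all_reals all_analysis.
From mathcomp Require Import complex.

Set Implicit Arguments.
Unset Strict Implicit.
Unset Printing Implicit Defensive.

Import Order.TTheory GRing.Theory Num.Theory.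
Import numFieldNormedType.Exports.

Local Open Scope classical_set_scope.
Local Open Scope ring_scope.

(* Meant for open O; the values of f outside O are irrelevant. *)
Fixpoint Ck (R : realType) (V W : normedModType R) (k : nat) (O : set V)
    (f : V -> W) : Prop :=
  match k with
  | 0%N => forall x, O x -> {for x, continuous f}
  | k'.+1 => (forall x, O x -> differentiable f x) /\
             (forall v, Ck k' O (fun x => 'D_v f x))
  end.

Definition smooth_on (R : realType) (V W : normedModType R) (O : set V)
    (f : V -> W) : Prop := forall k, Ck k O f.

(* An atlas is indexed by the points of M, so that each point p comes with a
   preferred chart [chart S p], defined on [chart_dom S p].  No maximality is
   required: the atlas generates the smooth structure. *)
Record atlas (R : realType) (n : nat) (M : Type) := Atlas {
  chart_dom : M -> set M;
  chart : M -> M -> 'rV[R]_n;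
  chart_inv : M -> 'rV[R]_n -> M
}.

Record smooth_manifold (R : realType) (n : nat) (M : topologicalType)
    (S : atlas R n M) : Prop := {
  sm_hausdorff : hausdorff_space M;
  sm_countable : @second_countable M;
  sm_center : forall p, chart_dom S p p;
  sm_open_dom : forall p, open (chart_dom S p);
  sm_open_img : forall p, open (chart S p @` chart_dom S p);
  sm_toK : forall p q, chart_dom S p q -> chart_inv S p (chart S p q) = q;
  sm_to_cont : forall p q, chart_dom S p q -> {for q, continuous (chart S p)};
  sm_inv_cont : forall p x,
    (chart S p @` chart_dom S p) x -> {for x, continuous (chart_inv S p)};
  sm_transition : forall p q,
    smooth_on (chart S p @` (chart_dom S p `&` chart_dom S q))
              (chart S q \o chart_inv S p)
}.

(* The tangent space T_pM is 'rV[R]_n, a tangent vector at p being given by its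
   coordinates in the preferred chart at p.  Vectors are row vectors, and
   k-tuples of vectors are the rows of a k x n matrix. *)

Section Tensors.
Variables (R : realType) (n : nat) (M : Type).

Definition vfield := M -> 'rV[R]_n.

(* Endomorphism fields act on the right: v |-> v *m Phi p. *)
Definition endo := M -> 'M[R]_n.

(* Gram matrices of a bilinear form in the preferred charts. *)
Definition metric := M -> 'M[R]_n.

Definition inner (g : metric) (p : M) (u v : 'rV[R]_n) : R :=
  (u *m g p *m v^T) 0 0.

(* K = R for real forms and K = R[i] for complex forms. *)
Definition dform (K : Type) (k : nat) := M -> 'M[R]_(k, n) -> K.

Definition multilinear k (f : 'M[R]_(k, n) -> R) : Prop :=
  forall (A B C : 'M[R]_(k, n)) (i : 'I_k) (b c : R),
    row i A = b *: row i B + c *: row i C ->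
    row' i B = row' i A -> row' i C = row' i A ->
    f A = b * f B + c * f C.

Definition multialternating k (f : 'M[R]_(k, n) -> R) : Prop :=
  multilinear f /\
  forall (A : 'M[R]_(k, n)) (i j : 'I_k),
    i != j -> row i A = row j A -> f A = 0.

(* Normalised so that (a /\ b)(u, v) = a(u) b(v) - a(v) b(u) on 1-forms. *)
Definition mwedge (K : fieldType) (k l : nat)
    (f : 'M[R]_(k, n) -> K) (h : 'M[R]_(l, n) -> K)
    (A : 'M[R]_(k + l, n)) : K :=
  (k`!%:R * l`!%:R)^-1 *
  \sum_(s : 'S_(k + l))
     (-1) ^+ s * f (usubmx (row_perm s A)) * h (dsubmx (row_perm s A)).

Definition wedge (K : fieldType) (k l : nat) (a : dform K k) (b : dform K l) :
  dform K (k + l) := fun p => mwedge (a p) (b p).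

Definition minsert (K : Type) (k : nat) (u : 'rV[R]_n)
    (f : 'M[R]_(k.+1, n) -> K) : 'M[R]_(k, n) -> K :=
  fun A => f (col_mx u A).

Definition interior_product (K : Type) (k : nat) (X : vfield)
    (a : dform K k.+1) : dform K k := fun p => minsert (X p) (a p).

Definition fscale (K : fieldType) (k : nat) (h : M -> K) (a : dform K k) :
  dform K k := fun p A => h p * a p A.

Definition fadd (K : fieldType) (k : nat) (a b : dform K k) : dform K k :=
  fun p A => a p A + b p A.

(* In components, (star b)_J = 1/k! b^I vol_{IJ}, i.e. a /\ star b = <a, b> vol.
   At the uses below k + l is the dimension n. *)
Definition star (k l : nat) (g : metric) (vol : dform R (k + l))
    (b : dform R k) : dform R l := fun p A =>
  (k`!%:R)^-1 *
  \sum_(I : {ffun 'I_k -> 'I_n})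
     b p (rowsub I (invmx (g p))) * vol p (col_mx (rowsub I 1%:M) A).

End Tensors.

Section Calculus.
Variables (R : realType) (n : nat) (M : Type) (S : atlas R n M).
Implicit Types (p : M) (x : 'rV[R]_n) (X Y Z : vfield R n M) (U : set M).

(* With q = chart_inv S p x: Jacobian matrices of the changes of coordinates
   between the chart at p and the preferred chart at q, taken at the point q. *)
Definition jac_from p x : 'M[R]_n :=
  jacobian (chart S (chart_inv S p x) \o chart_inv S p) x.
Definition jac_to p x : 'M[R]_n :=
  let q := chart_inv S p x in
  jacobian (chart S p \o chart_inv S q) (chart S q q).

Definition vcoord p X x : 'rV[R]_n := X (chart_inv S p x) *m jac_to p x.
Definition ecoord p (Phi : endo R n M) x : 'M[R]_n :=
  jac_from p x *m Phi (chart_inv S p x) *m jac_to p x.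
Definition gcoord p (g : metric R n M) x : 'M[R]_n :=
  jac_from p x *m g (chart_inv S p x) *m (jac_from p x)^T.
Definition fcoord k p (a : dform R n M R k) x (A : 'M[R]_(k, n)) : R :=
  a (chart_inv S p x) (A *m jac_from p x).

Definition smooth_vfield U X : Prop :=
  forall p, smooth_on (chart S p @` (chart_dom S p `&` U)) (vcoord p X).

Definition smooth_endo U (Phi : endo R n M) : Prop :=
  forall p, smooth_on (chart S p @` (chart_dom S p `&` U)) (ecoord p Phi).

Definition riemannian U (g : metric R n M) : Prop :=
  [/\ forall p, smooth_on (chart S p @` (chart_dom S p `&` U)) (gcoord p g),
      forall p, U p -> (g p)^T = g p
    & forall p u, U p -> u != 0 -> 0 < inner g p u u].

Definition smooth_form k (a : dform R n M R k) : Prop :=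
  (forall p, multialternating (a p)) /\
  (forall p A,
    smooth_on (chart S p @` chart_dom S p) (fun x => fcoord p a x A)).

Definition dext k (a : dform R n M R k) : dform R n M R k.+1 := fun p A =>
  \sum_(i < k.+1)
     (-1) ^+ i * 'D_(row i A) (fun x => fcoord p a x (row' i A)) (chart S p p).

Definition bracket X Y : vfield R n M := fun p =>
  'D_(X p) (vcoord p Y) (chart S p p) - 'D_(Y p) (vcoord p X) (chart S p p).

(* (L_X a)(v_1..v_k) = X(a(v_1..v_k)) - \sum_i a(v_1..[X, v_i]..v_k) for the
   v_i constant in the chart at p, for which [X, v_i] = - D_(v_i) X. *)
Definition lie k X (a : dform R n M R k) : dform R n M R k := fun p A =>
  'D_(X p) (fun x => fcoord p a x A) (chart S p p) +
  \sum_(i < k)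
     a p (\matrix_j (if j == i then 'D_(row i A) (vcoord p X) (chart S p p)
                     else row j A)).

(* The vector field with constant components v in the chart at p
   (meaningful on chart_dom S p only). *)
Definition vconst p (v : 'rV[R]_n) : vfield R n M := fun q =>
  v *m jac_from p (chart S p q).

(* 2 g(Gamma(u, v), e_k) = u g(v, e_k) + v g(u, e_k) - e_k g(u, v) in the chart
   at p. *)
Definition christoffel (g : metric R n M) p (u v : 'rV[R]_n) : 'rV[R]_n :=
  let G (a b : 'rV[R]_n) x := (a *m gcoord p g x *m b^T) 0 0 in
  (\row_k (2^-1 * ('D_u (G v (delta_mx 0 k)) (chart S p p)
                 + 'D_v (G u (delta_mx 0 k)) (chart S p p)
                 - 'D_(delta_mx 0 k) (G u v) (chart S p p)))) *m invmx (g p).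

Definition nabla (g : metric R n M) X Y : vfield R n M := fun p =>
  'D_(X p) (vcoord p Y) (chart S p p) + christoffel g p (X p) (Y p).

Definition apply_endo (Phi : endo R n M) X : vfield R n M :=
  fun p => X p *m Phi p.

Definition nijenhuis (J : endo R n M) X Y : vfield R n M := fun p =>
  let JX := apply_endo J X in let JY := apply_endo J Y in
  bracket JX JY p - apply_endo J (bracket JX Y) p
  - apply_endo J (bracket X JY) p - bracket X Y p.

Definition fundamental_form (g : metric R n M) (J : endo R n M) :
  dform R n M R 2 := fun p A => inner g p (row ord0 A *m J p) (row ord_max A).

Definition kaehler U (g : metric R n M) (J : endo R n M) : Prop :=
  [/\ riemannian U g /\ smooth_endo U J,
      forall p, U p -> J p *m J p = - 1%:M,
      forall p u v, U p -> inner g p (u *m J p) (v *m J p) = inner g p u v,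
      forall X Y, smooth_vfield U X -> smooth_vfield U Y ->
        forall p, U p -> nijenhuis J X Y p = 0
    & forall p A, U p -> dext (fundamental_form g J) p A = 0].

End Calculus.

Section Cone.
Variables (R : realType) (n : nat) (M : Type) (S : atlas R n M).

(* R x M; the cone is its open subset r > 0.  A tangent vector at (r, p) is
   row_mx s u, standing for s d/dr + u. *)
Definition cone_atlas : atlas R (1 + n) (R * M)%type := {|
  chart_dom := fun z => [set w | chart_dom S z.2 w.2];
  chart := fun z w => row_mx w.1%:M (chart S z.2 w.2);
  chart_inv := fun z x => (lsubmx x 0 0, chart_inv S z.2 (rsubmx x)) |}.

Definition cone_set : set (R * M) := [set z | 0 < z.1].

Definition cone_metric (g : metric R n M) : metric R (1 + n) (R * M) :=
  fun z => block_mx 1%:M 0 0 (z.1 ^+ 2 *: g z.2).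

(* J(r d/dr) = xi  and  J u = Phi u - eta(u) r d/dr. *)
Definition cone_J (xi : vfield R n M) (eta : dform R n M R 1)
    (Phi : endo R n M) : endo R (1 + n) (R * M) :=
  fun z => block_mx 0 (z.1^-1 *: xi z.2)
    (\col_i (- z.1 * eta z.2 (delta_mx 0 i))) (Phi z.2).

End Cone.

Section Sasaki.
Variables (R : realType) (M : Type) (S : atlas R 7 M).
Variables (xi : vfield R 7 M) (eta : dform R 7 M R 1).
Variables (Phi : endo R 7 M) (g : metric R 7 M).

Let om : dform R 7 M R 2 := dext S eta.

(* In g = d eta o (1 (x) Phi) + eta (x) eta the 2-form d eta is evaluated with
   the convention d eta(X,Y) = 1/2 (X eta(Y) - Y eta(X) - eta([X,Y])) of
   Sasakian geometry, i.e. as one half of [dext]; with a factor 1 instead,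
   the Kaehler form of dr^2 + r^2 g would never be closed. *)
Record sasakian : Prop := {
  sas_xi : smooth_vfield S setT xi;
  sas_eta : smooth_form S eta;
  sas_Phi : smooth_endo S setT Phi;
  sas_g : riemannian S setT g;
  sas_reeb : forall p, eta p (xi p) = 1;
  sas_Phi2 : forall p v, v *m Phi p *m Phi p = - v + eta p v *: xi p;
  sas_contact : forall p, exists A, wedge eta (wedge om (wedge om om)) p A != 0;
  sas_compat : forall p u v,
    inner g p (u *m Phi p) (v *m Phi p) = inner g p u v - eta p u * eta p v;
  sas_metric : forall p u v,
    inner g p u v = 2^-1 * om p (col_mx u (v *m Phi p)) + eta p u * eta p v;
  sas_cone : kaehler (cone_atlas S) (@cone_set R M)
               (cone_metric g) (cone_J xi eta Phi)
}.

Definition basic k (a : dform R 7 M R k.+1) : Prop :=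
  forall p, (forall A, interior_product xi a p A = 0) /\
            (forall A, lie S xi a p A = 0).

Definition projD (X : vfield R 7 M) : vfield R 7 M :=
  fun p => X p - eta p (X p) *: xi p.

(* Transverse Levi-Civita connection on D:
   nabla^T_X Y = (nabla_X Y)^D for X in D, and nabla^T_xi Y = [xi, Y]^D. *)
Definition nablaT (X Y : vfield R 7 M) : vfield R 7 M := fun p =>
  projD (nabla S g (projD X) Y) p + eta p (X p) *: projD (bracket S xi Y) p.

Definition curvT (X Y Z : vfield R 7 M) : vfield R 7 M := fun p =>
  nablaT X (nablaT Y Z) p - nablaT Y (nablaT X Z) p
  - nablaT (bracket S X Y) Z p.

(* Ric^T(y, z) = tr (x |-> R^T(x, y) z) over D_p; inserting projD allows the
   trace to be taken over T_pM. *)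
Definition ricT (p : M) (y z : 'rV[R]_7) : R :=
  \sum_(i < 7)
    curvT (projD (vconst S p (delta_mx 0 i))) (projD (vconst S p y))
          (projD (vconst S p z)) p 0 i.

Definition transverse_ricci_flat : Prop := forall p y z, ricT p y z = 0.

Definition ricci_form : dform R 7 M R 2 :=
  fun p A => ricT p (row ord0 A *m Phi p) (row ord_max A).

(* c_1^B(M) is the class of the closed basic form (2 pi)^-1 rho^T in basic
   cohomology. *)
Definition c1B_vanishes : Prop :=
  exists b : dform R 7 M R 1, [/\ smooth_form S b, basic b
    & forall p A, (2 * pi)^-1 * ricci_form p A = dext S b p A].

Local Open Scope complex_scope.

Definition Re_form k (a : dform R 7 M R[i] k) : dform R 7 M R k :=
  fun p A => complex.Re (a p A).
Definition Im_form k (a : dform R 7 M R[i] k) : dform R 7 M R k :=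
  fun p A => complex.Im (a p A).
Definition conj_form k (a : dform R 7 M R[i] k) : dform R 7 M R[i] k :=
  fun p A => (a p A)^*.
Definition cplx_form k (a : dform R 7 M R k) : dform R 7 M R[i] k :=
  fun p A => (a p A)%:C.

(* A transverse form has type (3,0) if it vanishes on the vectors u + i Phi u
   (u in D), which span D^{0,1}. *)
Definition type30 (a : dform R 7 M R[i] 3) : Prop :=
  forall p u A, eta p u = 0 ->
    minsert u (a p) A + 'i%C * minsert (u *m Phi p) (a p) A = 0.

Record contact_calabi_yau (Ups : dform R 7 M R[i] 3) : Prop := {
  ccy_sasakian : sasakian;
  ccy_c1B : c1B_vanishes;
  ccy_smooth : smooth_form S (Re_form Ups) /\ smooth_form S (Im_form Ups);
  ccy_basic : basic (Re_form Ups) /\ basic (Im_form Ups);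
  ccy_type : type30 Ups;
  ccy_nonzero : forall p, exists A, Ups p A != 0;
  ccy_closed : forall p A,
    dext S (Re_form Ups) p A = 0 /\ dext S (Im_form Ups) p A = 0
}.

(* N = |Ups|_omega, for omega = d eta. *)
Definition is_Ups_norm (Ups : dform R 7 M R[i] 3) (N : M -> R) : Prop :=
  forall p, 0 < N p /\
    forall A : 'M[R]_(6, 7),
      (3`!%:R)^-1 * cplx_form (wedge om (wedge om om)) p A =
      'i%C / 8%:R * ((N p ^+ 2)^-1)%:C * wedge Ups (conj_form Ups) p A.

End Sasaki.

Section Flow.
Variables (R : realType) (M : Type) (S : atlas R 7 M).
Implicit Types (g : metric R 7 M) (vol : dform R 7 M R 7).

(* phi is a G_2-structure with metric g and volume form vol; the defining
   identity determines the pair (g, vol). *)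
Definition g2_structure (phi : dform R 7 M R 3) g vol : Prop :=
  smooth_form S phi /\
  forall p,
  [/\ (g p)^T = g p /\ (forall u, u != 0 -> 0 < inner g p u u),
      multialternating (vol p)
      /\ (forall E : 'M[R]_7, E *m g p *m E^T = 1%:M -> `|vol p E| = 1)
    & forall (u v : 'rV[R]_7) (A : 'M[R]_7),
        mwedge (mwedge (minsert u (phi p)) (minsert v (phi p))) (phi p) A =
        6 * inner g p u v * vol p A].

Definition psi_of g vol (phi : dform R 7 M R 3) : dform R 7 M R 4 :=
  @star R 7 M 3 4 g vol phi.

Definition tau0 g vol (phi : dform R 7 M R 3) : M -> R := fun p =>
  7^-1 * @star R 7 M 7 0 g vol (wedge phi (dext S phi)) p 0.

(* In dimension 7, d^* = (-1)^k * d * on k-forms. *)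
Definition codiff4 g vol (b : dform R 7 M R 4) : dform R 7 M R 3 :=
  @star R 7 M 4 3 g vol (dext S (@star R 7 M 4 3 g vol b)).
Definition codiff5 g vol (b : dform R 7 M R 5) : dform R 7 M R 4 :=
  fscale (fun=> -1) (@star R 7 M 3 4 g vol (dext S (@star R 7 M 5 2 g vol b))).

Definition laplacian4 g vol (b : dform R 7 M R 4) : dform R 7 M R 4 :=
  fadd (dext S (codiff4 g vol b)) (codiff5 g vol (dext S b)).

(* Derivative relative to I, hence one-sided at an endpoint belonging to I. *)
Definition is_derive_in (I : set R) (f : R -> R) (t l : R) : Prop :=
  (f s - f t) / (s - t) @[s --> within I (t^')] --> l.

Definition smooth_in (I : set R) (f : R -> R) : Prop :=
  exists F : nat -> R -> R, (forall t, I t -> F 0%N t = f t) /\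
    forall k t, I t -> is_derive_in I (F k) t (F k.+1 t).

Definition time_interval (I : set R) : Prop :=
  [/\ is_interval I, I 0 & exists2 t, I t & t != 0].

Definition solves_modified_coflow (A : R) (I : set R)
    (phi : R -> dform R 7 M R 3) : Prop :=
  exists (g : R -> metric R 7 M) (vol : R -> dform R 7 M R 7),
  let psi t := psi_of (g t) (vol t) (phi t) in
  forall t, I t ->
    g2_structure (phi t) (g t) (vol t) /\
    forall p B,
      is_derive_in I (fun s => psi s p B) t
        (fadd (laplacian4 (g t) (vol t) (psi t))
           (dext S (fscale (fun q => A - 7 / 2 * tau0 (g t) (vol t) (phi t) q)
                           (phi t))) p B).

End Flow.

(* Main.v *)
(* At each point there is a frame in which [eta], [omega = d eta] and [Upsilon] take
   the standard form [e0], [e12 + e34 + e56], [(e1 + i e2)(e3 + i e4)(e5 + i e6)]: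
   a unitary triple for the transverse Hermitian structure always gives the first
   two, the type (3, 0) of [Upsilon] makes it a multiple of the third, and
   [|Upsilon| = 1] makes the multiple a phase, removed by a rotation.  Dividing [e0]
   by [a] and the other vectors by [b] turns [phi] into the standard G2 form, whose
   metric and volume form are determined by the defining identity; hence
     psi = b^4/2 omega^2 - a b^3 eta /\ Im Upsilon,   tau_0 = 6 a / (7 b^2).
   Since [d omega = 0] and [d Upsilon = 0], [psi] is closed, [d phi = a b^2 omega^2]
   and [d* psi = 2 a^2 eta /\ omega], so the right-hand side of the coflow equals
     (A a b^2 - a^2) omega^2.
   As [omega^2] and [eta /\ Im Upsilon] are pointwise independent, the coflow says
   [(a b^3)' = 0] and [(b^4 / 2)' = A a b^2 - a^2], which with the initial data is
   the system in the statement. *)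
Require Import Defs.
From mathcomp Require Import all_boot all_order all_algebra all_fingroup.
From mathcomp Require Import all_classical all_reals all_analysis.
From mathcomp Require Import complex.
From mathcomp Require Import ring lra zify.

Set Implicit Arguments.
Unset Strict Implicit.
Unset Printing Implicit Defensive.

Import Order.TTheory GRing.Theory Num.Theory.
Import numFieldNormedType.Exports.

Local Open Scope classical_set_scope.
Local Open Scope ring_scope.

(** * Alternating forms on a vector space *)

(** Exterior derivatives and Hodge stars are kept apart. The former are only taken of $\eta$,
    $\omega$, $\Upsilon$ and their products, with coefficients constant on $M$; the latter are only
    computed at one point, in an adapted frame. Hence no frame has to vary smoothly, and the metric
    and volume form of the flow enter only through their values at a point, where the forms involved
    have integer components up to a factor. Closedness of $\psi$ rests, besides $d\omega=0$ and
    $d\Upsilon=0$, on $\omega\wedge\mathrm{Im}\,\Upsilon=0$, a matter of type, because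
    $d(\eta\wedge\mathrm{Im}\,\Upsilon)=\omega\wedge\mathrm{Im}\,\Upsilon$. In every product to be
    differentiated the second factor is closed, so the Leibniz rule is proved in the form $d(a\wedge
    b)=da\wedge b$. The factor $\frac12$ relating $g$ to $d\eta$ makes the unit of length of the
    adapted frames $1/\sqrt2$ for the Sasakian metric. The flow comes with some metric and volume
    form: one direction needs that the defining identity determines them, the other that they
    exist. *)

Lemma row'_eqP (R : realType) n k (A B : 'M[R]_(k, n)) (i : 'I_k) :
  row' i A = row' i B <-> (forall j, j != i -> row j A = row j B).
Proof.
split=> [eAB j | eAB]; last first.
  by apply/row_matrixP=> j; rewrite !row_rowsub eAB // eq_sym neq_lift.
rewrite eq_sym => /unlift_some[j' -> _].
by move/row_matrixP: eAB => /(_ j'); rewrite !row_rowsub.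
Qed.

Section MultilinearAlgebra.
Variables (R : realType) (n : nat).

Lemma multilinearP k (f : 'M[R]_(k, n) -> R) :
  multilinear f <->
  (forall A B C i b c, row i A = b *: row i B + c *: row i C ->
     (forall j, j != i -> row j B = row j A) ->
     (forall j, j != i -> row j C = row j A) -> f A = b * f B + c * f C).
Proof.
by split=> fL A B C i b c rA rB rC; apply: (fL _ _ _ i) => //;
  [exact/row'_eqP | exact/row'_eqP | exact/(row'_eqP B A) | exact/(row'_eqP C A)].
Qed.

Lemma row_col_mx0 k (u : 'rV[R]_n) (A : 'M[R]_(k, n)) :
  row (ord0 : 'I_k.+1) (col_mx u A) = u.
Proof.
have -> : (ord0 : 'I_k.+1) = lshift k (ord0 : 'I_1) by apply: val_inj.
exact: etrans (rowKu _ u A) (row_id _ _).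
Qed.

Lemma row_col_mx_lift k (u : 'rV[R]_n) (A : 'M[R]_(k, n)) (i : 'I_k) :
  row (lift ord0 i : 'I_k.+1) (col_mx u A) = row i A.
Proof.
have -> : (lift ord0 i : 'I_k.+1) = rshift 1 i by apply: val_inj.
exact: (rowKd i u A).
Qed.

Lemma col_mx_row k (A : 'M[R]_(k.+1, n)) :
  A = col_mx (row ord0 A) (row' ord0 A) :> 'M[R]_(1 + k, n).
Proof.
apply/row_matrixP => i; case: (unliftP ord0 i) => [j|] ->.
  by rewrite row_col_mx_lift row_rowsub.
by rewrite row_col_mx0.
Qed.

Lemma multilinear_insert k (f : 'M[R]_(k.+1, n) -> R) u :
  multilinear f -> multilinear (minsert u f).
Proof.
move=> /multilinearP fL; apply/multilinearP => A B C i b c rA rB rC.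
apply: (fL _ _ _ (lift ord0 i)); rewrite ?row_col_mx_lift // => j;
  case: (unliftP ord0 j) => [j'|] ->; rewrite ?row_col_mx_lift ?row_col_mx0 //.
  by rewrite (inj_eq lift_inj); exact: rB.
by rewrite (inj_eq lift_inj); exact: rC.
Qed.

Lemma multilinear_col_mx k (f : 'M[R]_(k.+1, n) -> R) (b c : R)
    (u v : 'rV[R]_n) (A : 'M[R]_(k, n)) :
  multilinear f ->
  f (col_mx (b *: u + c *: v) A) = b * f (col_mx u A) + c * f (col_mx v A).
Proof.
move=> /multilinearP fL; apply: (fL _ _ _ ord0); rewrite ?row_col_mx0 // => j;
by case: (unliftP ord0 j) => [j'|] ->; rewrite ?row_col_mx_lift ?eqxx.
Qed.

Lemma multilinear_col_mx_sum k (f : 'M[R]_(k.+1, n) -> R) m (c : 'I_m -> R)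
    (v : 'I_m -> 'rV[R]_n) (A : 'M[R]_(k, n)) :
  multilinear f ->
  f (col_mx (\sum_j c j *: v j) A) = \sum_j c j * f (col_mx (v j) A).
Proof.
move=> fL; apply: (big_rec2 (fun (w : 'rV[R]_n) (y : R) => f (col_mx w A : 'M[R]_(1 + k, n)) = y)).
  by have := multilinear_col_mx 0 0 0 0 A fL; rewrite !scaler0 addr0 !mul0r addr0.
by move=> i w y _ <-; rewrite -[w]scale1r multilinear_col_mx // scale1r mul1r.
Qed.

Definition ffun_cons k m (j : 'I_m) (J : {ffun 'I_k -> 'I_m}) :
  {ffun 'I_k.+1 -> 'I_m} := [ffun i => oapp J j (unlift ord0 i)].

Lemma ffun_cons0 k m j (J : {ffun 'I_k -> 'I_m}) : ffun_cons j J ord0 = j.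
Proof. by rewrite ffunE unlift_none. Qed.

Lemma ffun_consS k m j (J : {ffun 'I_k -> 'I_m}) i :
  ffun_cons j J (lift ord0 i) = J i.
Proof. by rewrite ffunE liftK. Qed.

Lemma big_ffun_cons k m (F : {ffun 'I_k.+1 -> 'I_m} -> R) :
  \sum_J F J = \sum_j \sum_(J : {ffun 'I_k -> 'I_m}) F (ffun_cons j J).
Proof.
rewrite pair_big /=.
rewrite (reindex (fun x : 'I_m * {ffun 'I_k -> 'I_m} => ffun_cons x.1 x.2)) //.
exists (fun J : {ffun 'I_k.+1 -> 'I_m} => (J ord0, [ffun i => J (lift ord0 i)])).
  move=> [j J] _ /=; rewrite ffun_cons0; congr pair.
  by apply/ffunP => i; rewrite ffunE ffun_consS.
move=> J _; apply/ffunP => i; case: (unliftP ord0 i) => [i'|] ->.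
  by rewrite ffun_consS ffunE.
by rewrite ffun_cons0.
Qed.

(** Induction on [k]: the first row of [C *m B] is expanded by linearity, the other rows by the
    induction hypothesis for the form with a row of [B] inserted. *)
Lemma multilinear_mulmx k m (f : 'M[R]_(k, n) -> R) (C : 'M[R]_(k, m)) B :
  multilinear f ->
  f (C *m B) =
  \sum_(J : {ffun 'I_k -> 'I_m}) (\prod_i C i (J i)) * f (rowsub J B).
Proof.
elim: k f C => [|k IH] f C fL.
  have eJ (J : {ffun 'I_0 -> 'I_m}) : J = ffun0 (card_ord 0) by apply/ffunP => -[].
  rewrite (bigD1 (ffun0 (card_ord 0))) //= [X in _ + X]big1 => [|J]; last by rewrite (eJ J) eqxx.
  by rewrite big_ord0 mul1r addr0; congr f; apply/matrixP => -[].
rewrite big_ffun_cons [C *m B]col_mx_row row_mul mulmx_sum_row.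
rewrite multilinear_col_mx_sum //; apply: eq_bigr => j _.
have -> : row' ord0 (C *m B) = row' ord0 C *m B.
  by apply/row_matrixP => i; rewrite row_mul !row_rowsub row_mul.
have := IH (minsert (row j B) f) (row' ord0 C) (multilinear_insert _ fL).
rewrite /minsert => ->; rewrite big_distrr /=; apply: eq_bigr => J _.
rewrite big_ord_recl ffun_cons0 mulrA mxE; congr (_ * _ * f _).
  by apply: eq_bigr => i _; rewrite mxE ffun_consS.
apply: etrans (esym (col_mx_row _)); apply: f_equal2.
  by rewrite row_rowsub ffun_cons0.
by apply/row_matrixP => i; rewrite !row_rowsub ffun_consS.
Qed.

(** Polarisation: with the sum of rows [i] and [j] put in both places the form vanishes, and the two
    mixed terms of its expansion must cancel. *)
Lemma multialternating_xrow k (f : 'M[R]_(k, n) -> R) A i j :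
  multialternating f -> i != j -> f (xrow i j A) = - f A.
Proof.
move=> [/multilinearP fL fA] nij.
pose X u v : 'M[R]_(k, n) :=
  \matrix_l (if l == i then u else if l == j then v else row l A).
have Xi u v : row i (X u v) = u by rewrite rowK eqxx.
have Xj u v : row j (X u v) = v by rewrite rowK eq_sym (negbTE nij) eqxx.
have Xo u v l : l != i -> l != j -> row l (X u v) = row l A.
  by move=> li lj; rewrite rowK (negbTE li) (negbTE lj).
have XD1 u u' v : f (X (u + u') v) = f (X u v) + f (X u' v).
  rewrite -[f (X u v)]mul1r -[f (X u' v)]mul1r.
  apply: (fL _ _ _ i); rewrite ?Xi ?scale1r // => l li.
    by case: (eqVneq l j) => [->|lj]; rewrite ?Xj ?Xo.
  by case: (eqVneq l j) => [->|lj]; rewrite ?Xj ?Xo.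
have XD2 u v v' : f (X u (v + v')) = f (X u v) + f (X u v').
  rewrite -[f (X u v)]mul1r -[f (X u v')]mul1r.
  apply: (fL _ _ _ j); rewrite ?Xj ?scale1r // => l lj.
    by case: (eqVneq l i) => [->|li]; rewrite ?Xi ?Xo.
  by case: (eqVneq l i) => [->|li]; rewrite ?Xi ?Xo.
have X0 u : f (X u u) = 0 by apply: (fA _ i j) => //; rewrite Xi Xj.
have := X0 (row i A + row j A); rewrite XD1 !XD2 !X0 add0r addr0.
have -> : X (row i A) (row j A) = A.
  apply/row_matrixP => l; case: (eqVneq l i) => [->|li]; rewrite ?Xi //.
  by case: (eqVneq l j) => [->|lj]; rewrite ?Xj ?Xo.
have -> : X (row j A) (row i A) = xrow i j A.
  apply/row_matrixP => l.
  have -> : row l (xrow i j A) = row (tperm i j l) A by apply/rowP => c; rewrite !mxE.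
  case: (eqVneq l i) => [->|li]; rewrite ?Xi ?tpermL //.
  case: (eqVneq l j) => [->|lj]; first by rewrite Xj tpermR.
  by rewrite Xo // tpermD // eq_sym.
by move/eqP; rewrite addrC addr_eq0 => /eqP.
Qed.

Lemma multialternating_row_perm k (f : 'M[R]_(k, n) -> R) A (s : 'S_k) :
  multialternating f -> f (row_perm s A) = (-1) ^+ s * f A.
Proof.
move=> fA; case: (prod_tpermP s) => ts -> {s} /= tsP.
elim: ts tsP A => [|t ts IH] /= tsP A.
  by rewrite big_nil row_perm1 odd_perm1 mul1r.
case/andP: tsP => dt /IH {}IH.
rewrite big_cons row_permM odd_mul_tperm dt signr_addb expr1 mulN1r mulNr.
rewrite /dpair /= in dt.
by rewrite (multialternating_xrow (row_perm _ A) fA dt) IH.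
Qed.

(* The wedge product of the coordinate 1-forms listed by [I]. *)
Definition emon k (I : 'I_k -> 'I_n) (A : 'M[R]_(k, n)) : R :=
  \det (colsub I A).

Lemma emonE k (I : 'I_k -> 'I_n) A :
  emon I A = \sum_(s : 'S_k) (-1) ^+ s * \prod_i A (s i) (I i).
Proof.
rewrite /emon -det_tr; apply: eq_bigr => s _; congr (_ * _).
by apply: eq_bigr => i _; rewrite !mxE.
Qed.

Lemma emon_alternating k (I : 'I_k -> 'I_n) : multialternating (emon I).
Proof.
split.
  apply/multilinearP => A B C i b c rA rB rC.
  apply: (determinant_multilinear (i0 := i)).
  - apply/rowP => j; have := congr1 (fun v : 'rV_n => v 0 (I j)) rA.
    by rewrite !mxE.
  - apply/row'_eqP => j ji; apply/rowP => l.
    by have := congr1 (fun v : 'rV_n => v 0 (I l)) (rB _ ji); rewrite !mxE.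
  - apply/row'_eqP => j ji; apply/rowP => l.
    by have := congr1 (fun v : 'rV_n => v 0 (I l)) (rC _ ji); rewrite !mxE.
move=> A i j nij rij; apply: (determinant_alternate nij) => l.
by have := congr1 (fun v : 'rV_n => v 0 (I l)) rij; rewrite !mxE.
Qed.

(** Averaging: $k!\,f(A)$ is the signed sum of $f$ over the row permutations of $A$. Expanding each
    term multilinearly collects, for fixed [J], a determinant. The sum runs over all index maps, not
    just increasing ones, whence $1/k!$. *)
Lemma multialternating_expand k (f : 'M[R]_(k, n) -> R) A :
  multialternating f ->
  f A = (k`!%:R)^-1 *
    \sum_(J : {ffun 'I_k -> 'I_n}) f (rowsub J 1%:M) * emon J A.
Proof.
move=> fA; have k0 : (k`!%:R : R) != 0 by rewrite pnatr_eq0 -lt0n fact_gt0.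
apply: (mulfI k0); rewrite mulrA mulfV // mul1r.
transitivity (\sum_(s : 'S_k) (-1) ^+ s * f (row_perm s A)).
  under eq_bigr => s _ do rewrite multialternating_row_perm // mulrA -expr2 sqrr_sign mul1r.
  rewrite sumr_const mulr_natl; congr (_ *+ _).
  by rewrite -[LHS]card_Sn; apply: eq_card.
under eq_bigr => s _ do
  rewrite -[row_perm s A]mulmx1 (multilinear_mulmx _ _ fA.1) big_distrr /=.
rewrite exchange_big /=; apply: eq_bigr => J _.
rewrite emonE big_distrr /=; apply: eq_bigr => s _.
rewrite mulrA mulrC; congr (_ * (_ * _)).
by apply: eq_bigr => i _; rewrite mxE.
Qed.

End MultilinearAlgebra.

(** Each minor of the expansion is $\det(B)$ times the same minor of the identity, so $f$ is a
    constant multiple of the determinant. *)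
Lemma multialternating_top (R : realType) n (f : 'M[R]_n -> R) A :
  multialternating f -> f A = f 1%:M * \det A.
Proof.
move=> fA; pose c := (n`!%:R)^-1 *
  \sum_(J : {ffun 'I_n -> 'I_n}) f (rowsub J 1%:M) * \det (colsub J (1%:M : 'M[R]_n)).
have fE B : f B = c * \det B.
  rewrite (multialternating_expand B fA) /c -mulrA big_distrl /=; congr (_ * _).
  apply: eq_bigr => J _; rewrite -mulrA; congr (_ * _).
  by rewrite /emon -[colsub J B]/(mxsub id J B) mulrC -det_mulmx mulmx_colsub mulmx1.
by rewrite fE [f 1%:M]fE det1 mulr1.
Qed.

(** * Wedge products of forms and of coordinate monomials *)

Section Wedge.
Variables (R : realType) (n : nat).

Lemma mwedge_suml (K : fieldType) k l (T : Type) (r : seq T) (c : T -> K)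
    (f : T -> 'M[R]_(k, n) -> K) (h : 'M[R]_(l, n) -> K) A :
  mwedge (fun B => \sum_(t <- r) c t * f t B) h A =
  \sum_(t <- r) c t * mwedge (f t) h A.
Proof.
rewrite /mwedge; under eq_bigr => s _ do rewrite big_distrr /= big_distrl /=.
rewrite exchange_big /= big_distrr /=; apply: eq_bigr => t _.
rewrite mulrCA; congr (_ * _); rewrite big_distrr /=; apply: eq_bigr => s _.
by rewrite mulrCA -!mulrA.
Qed.

Lemma mwedge_sumr (K : fieldType) k l (T : Type) (r : seq T) (c : T -> K)
    (f : 'M[R]_(k, n) -> K) (h : T -> 'M[R]_(l, n) -> K) A :
  mwedge f (fun B => \sum_(t <- r) c t * h t B) A =
  \sum_(t <- r) c t * mwedge f (h t) A.
Proof.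
rewrite /mwedge; under eq_bigr => s _ do rewrite big_distrr /=.
rewrite exchange_big /= big_distrr /=; apply: eq_bigr => t _.
rewrite mulrCA; congr (_ * _); rewrite big_distrr /=; apply: eq_bigr => s _.
by rewrite mulrCA -!mulrA.
Qed.

Lemma mwedgeZl (K : fieldType) k l (c : K) (f : 'M[R]_(k, n) -> K)
    (h : 'M[R]_(l, n) -> K) A :
  mwedge (fun B => c * f B) h A = c * mwedge f h A.
Proof.
have := mwedge_suml [:: 0%N] (fun=> c) (fun=> f) h A; rewrite big_seq1 => <-.
by congr mwedge; apply/funext => B; rewrite big_seq1.
Qed.

Lemma mwedgeZr (K : fieldType) k l (c : K) (f : 'M[R]_(k, n) -> K)
    (h : 'M[R]_(l, n) -> K) A :
  mwedge f (fun B => c * h B) A = c * mwedge f h A.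
Proof.
have := mwedge_sumr [:: 0%N] (fun=> c) f (fun=> h) A; rewrite big_seq1 => <-.
by congr mwedge; apply/funext => B; rewrite big_seq1.
Qed.

Lemma mwedgeDl (K : fieldType) k l (f f' : 'M[R]_(k, n) -> K)
    (h : 'M[R]_(l, n) -> K) A :
  mwedge (fun B => f B + f' B) h A = mwedge f h A + mwedge f' h A.
Proof.
rewrite /mwedge -mulrDr -big_split /=; congr (_ * _).
by apply: eq_bigr => s _; rewrite mulrDr mulrDl.
Qed.

Lemma mwedgeDr (K : fieldType) k l (f : 'M[R]_(k, n) -> K)
    (h h' : 'M[R]_(l, n) -> K) A :
  mwedge f (fun B => h B + h' B) A = mwedge f h A + mwedge f h' A.
Proof.
rewrite /mwedge -mulrDr -big_split /=; congr (_ * _).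
by apply: eq_bigr => s _; rewrite mulrDr.
Qed.

Lemma mwedge_mulmx (K : fieldType) m k l (f : 'M[R]_(k, n) -> K)
    (h : 'M[R]_(l, n) -> K) (A : 'M[R]_(k + l, m)) (F : 'M[R]_(m, n)) :
  mwedge f h (A *m F) =
  mwedge (fun B => f (B *m F)) (fun B => h (B *m F)) A.
Proof.
rewrite /mwedge; congr (_ * _); apply: eq_bigr => s _.
have -> : row_perm s (A *m F) = row_perm s A *m F.
  by apply/row_matrixP => i; rewrite row_mul; apply/rowP => j; rewrite !mxE;
     apply: eq_bigr => c _; rewrite !mxE.
by rewrite -mul_usub_mx -mul_dsub_mx.
Qed.

Definition ord_cat k l (I : 'I_k -> 'I_n) (J : 'I_l -> 'I_n) (i : 'I_(k + l)) :=
  match fintype.split i with inl a => I a | inr b => J b end.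

Lemma ord_catl k l (I : 'I_k -> 'I_n) (J : 'I_l -> 'I_n) a :
  ord_cat I J (lshift l a) = I a.
Proof. by rewrite /ord_cat (unsplitK (inl a)). Qed.

Lemma ord_catr k l (I : 'I_k -> 'I_n) (J : 'I_l -> 'I_n) a :
  ord_cat I J (rshift k a) = J a.
Proof. by rewrite /ord_cat (unsplitK (inr a)). Qed.

End Wedge.

Section PermSum.
Variables (k l : nat) (s : 'S_k) (t : 'S_l).

Definition perm_sum_fun (i : 'I_(k + l)) : 'I_(k + l) :=
  match fintype.split i with inl a => lshift l (s a) | inr b => rshift k (t b) end.

Lemma perm_sum_inj : injective perm_sum_fun.
Proof.
move=> i j; rewrite /perm_sum_fun.
case: (split_ordP i) => [a ->|a ->]; case: (split_ordP j) => [b ->|b ->].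
- by move/lshift_inj/perm_inj->.
- by move/eqP; rewrite eq_lrshift.
- by move/eqP; rewrite eq_rlshift.
- by move/rshift_inj/perm_inj->.
Qed.

Definition perm_sum : 'S_(k + l) := perm perm_sum_inj.

Lemma perm_suml a : perm_sum (lshift l a) = lshift l (s a).
Proof. by rewrite permE /perm_sum_fun (unsplitK (inl a)). Qed.

Lemma perm_sumr a : perm_sum (rshift k a) = rshift k (t a).
Proof. by rewrite permE /perm_sum_fun (unsplitK (inr a)). Qed.

(** The permutation matrix of [perm_sum] is block diagonal, and signs are determinants of
    permutation matrices. *)
Lemma sign_perm_sum (R : comUnitRingType) :
  (-1) ^+ perm_sum = (-1) ^+ s * (-1) ^+ t :> R.
Proof.
rewrite -!det_perm -(det_ublock (perm_mx s) 0); congr (\det _).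
apply/matrixP => i j.
case: (split_ordP i) => [a ->|a ->]; case: (split_ordP j) => [b ->|b ->].
- by rewrite block_mxEul !mxE perm_suml (inj_eq (@lshift_inj _ _)).
- by rewrite block_mxEur !mxE perm_suml eq_lrshift.
- by rewrite block_mxEdl !mxE perm_sumr eq_rlshift.
- by rewrite block_mxEdr !mxE perm_sumr (inj_eq (@rshift_inj _ _)).
Qed.

End PermSum.

Section Laplace.
Variables (R : realType) (n : nat).

(** Laplace expansion: expanding both minors gives a sum over $(s,u,v)$. For fixed $u,v$,
    translating $s$ by the block permutation [perm_sum u v] turns the sum over $s$ into the full
    determinant, and the $k!\,l!$ equal copies cancel the normalisation of [mwedge]. *)
Lemma mwedge_emon k l (I : 'I_k -> 'I_n) (J : 'I_l -> 'I_n)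
    (A : 'M[R]_(k + l, n)) :
  mwedge (emon I) (emon J) A = emon (ord_cat I J) A.
Proof.
have kl0 : (k`!%:R * l`!%:R : R) != 0.
  by rewrite mulf_neq0 // pnatr_eq0 -lt0n fact_gt0.
apply: (mulfI kl0); rewrite /mwedge mulrA mulfV // mul1r.
pose T (s : 'S_(k + l)) := (-1) ^+ s * \prod_i A (s i) (ord_cat I J i).
transitivity (\sum_(s : 'S_(k + l)) \sum_(u : 'S_k) \sum_(v : 'S_l)
    T (perm_sum u v * s)%g).
  apply: eq_bigr => s _; rewrite !emonE -mulrA big_distrl big_distrr /=.
  apply: eq_bigr => u _; rewrite !big_distrr /=; apply: eq_bigr => v _.
  rewrite /T odd_permM signr_addb sign_perm_sum big_split_ord /=.
  under [X in _ = _ * (X * _)]eq_bigr => a _ do rewrite permM perm_suml ord_catl.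
  under [X in _ = _ * (_ * X)]eq_bigr => a _ do rewrite permM perm_sumr ord_catr.
  under [X in _ * (_ * X * _) = _]eq_bigr => a _ do rewrite !mxE.
  under [X in _ * (_ * (_ * X)) = _]eq_bigr => a _ do rewrite !mxE.
  move: ((-1) ^+ s) ((-1) ^+ u) ((-1) ^+ v) (\prod_(i < k) _) (\prod_(i < l) _).
  by move=> x1 x2 x3 x4 x5; ring.
have ET u v : \sum_(s : 'S_(k + l)) T (perm_sum u v * s)%g = emon (ord_cat I J) A.
  by rewrite emonE [RHS](reindex_inj (mulgI (perm_sum u v))).
rewrite exchange_big /=.
under eq_bigr => u _ do [rewrite exchange_big /=; under eq_bigr => v _ do rewrite ET].
rewrite !sumr_const /= -mulrnA -natrM mulr_natl mulnC; congr (_ *+ (_ * _)).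
  by rewrite -[RHS]card_Sn; apply: eq_card.
by rewrite -[RHS]card_Sn; apply: eq_card.
Qed.

End Laplace.

(** * Constant-coefficient forms as lists *)

(* [(c, [:: i; j; k])] stands for [c dx_i /\ dx_j /\ dx_k], and a list for the sum:
   identities between constant-coefficient forms become computations on lists. *)
Definition fpoly := seq (int * seq nat).

(* [None] signals a repeated index; the boolean is the parity of the exchanges. *)
Fixpoint sins (x : nat) (s : seq nat) : option (bool * seq nat) :=
  if s is y :: s' then
    if (x < y)%N then Some (false, x :: s)
    else if x == y then None
    else omap (fun r => (~~ r.1, y :: r.2)) (sins x s')
  else Some (false, [:: x]).

Fixpoint ssort (s : seq nat) : option (bool * seq nat) :=
  if s is x :: s' then
    obind (fun r => omap (fun q => (r.1 (+) q.1, q.2)) (sins x r.2)) (ssort s')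
  else Some (false, [::]).

Fixpoint facc (c : int) (l : seq nat) (s : fpoly) : fpoly :=
  if s is m :: s' then
    if m.2 == l then (m.1 + c, l) :: s' else m :: facc c l s'
  else [:: (c, l)].

Fixpoint fnorm (s : fpoly) : fpoly :=
  if s is m :: s' then
    if ssort m.2 is Some (b, l) then facc (if b then - m.1 else m.1) l (fnorm s')
    else fnorm s'
  else [::].

Definition fscal (c : int) (s : fpoly) : fpoly := [seq (c * m.1, m.2) | m <- s].

Definition fmul (s t : fpoly) : fpoly :=
  [seq (x.1 * y.1, x.2 ++ y.2) | x <- s, y <- t].

Definition fwf k (s : fpoly) := all (fun m => size m.2 == k) s.

(** Equality test by normalising the difference. Homogeneity is part of the test because [mon]
    interprets a list relative to a prescribed degree. *)
Definition feq k (s t : fpoly) :=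
  [&& fwf k s, fwf k t & all (fun m => m.1 == 0) (fnorm (s ++ fscal (-1) t))].

Section EmonPerm.
Variables (R : realType) (n : nat).

Lemma emon_tperm k (I : 'I_k -> 'I_n) (A : 'M[R]_(k, n)) a b :
  a != b -> emon (I \o tperm a b) A = - emon I A.
Proof.
move=> nab; rewrite /emon.
have -> : colsub (I \o tperm a b) A = col_perm (tperm a b) (colsub I A).
  by apply/matrixP => i j; rewrite !mxE.
by rewrite col_permE det_mulmx tpermV -/(tperm_mx a b) det_perm odd_tperm nab
  expr1 mulrN1.
Qed.

Lemma emon_eq k (I J : 'I_k -> 'I_n) (A : 'M[R]_(k, n)) :
  I =1 J -> emon I A = emon J A.
Proof. by move=> e; congr (\det _); apply/matrixP => i j; rewrite !mxE e. Qed.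

End EmonPerm.

Section Reflection.
Variables (R : realType) (n : nat).

(** Both [nth] and [inord] default to 0, so a list of the wrong length, or with indices beyond [n],
    still denotes some form, but not the intended one; the side conditions [fwf] and [fbound]
    exclude this. *)
Definition mon k (l : seq nat) : 'M[R]_(k, n.+1) -> R :=
  emon (fun j : 'I_k => inord (nth 0%N l j)).

Definition ev k (s : fpoly) (A : 'M[R]_(k, n.+1)) : R :=
  \sum_(m <- s) m.1%:~R * mon m.2 A.

Lemma mon_swap k p x y s (A : 'M[R]_(k, n.+1)) : size (p ++ x :: y :: s) = k ->
  mon (p ++ x :: y :: s) A = - mon (p ++ y :: x :: s) A.
Proof.
rewrite size_cat /= => sk.
have ltp : (size p < k)%N by lia.
have ltp1 : ((size p).+1 < k)%N by lia.
have nab : Ordinal ltp != Ordinal ltp1.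
  by apply/eqP => /(congr1 val) /= e; lia.
rewrite /mon -(emon_tperm _ _ nab); apply: emon_eq => i /=; congr inord.
case: tpermP => [->|->|ni ni1] /=.
- by rewrite !nth_cat ltnn ltnNge leqnSn subnn subSnn.
- by rewrite !nth_cat ltnn ltnNge leqnSn subnn subSnn.
have {}ni : (i : nat) <> size p by move=> e; apply: ni; apply: val_inj.
have {}ni1 : (i : nat) <> (size p).+1 by move=> e; apply: ni1; apply: val_inj.
rewrite !nth_cat; case: ltnP => // ip.
by have [j ->] : exists j, (i - size p)%N = j.+2 by exists (i - (size p).+2)%N; lia.
Qed.

Lemma mon_dup k p x s (A : 'M[R]_(k, n.+1)) : size (p ++ x :: x :: s) = k ->
  mon (p ++ x :: x :: s) A = 0.
Proof.
by move=> /(mon_swap A) /eqP; rewrite -addr_eq0 -mulr2n mulrn_eq0 => /eqP.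
Qed.

Lemma size_sins x s b t : sins x s = Some (b, t) -> size t = (size s).+1.
Proof.
elim: s b t => [|y s IH] b t /=; first by case=> _ <-.
case: ltnP => _; first by case=> _ <-.
case: eqP => // _; case e: (sins x s) => [[b' t']|] //= -[_ <-] /=.
by rewrite (IH _ _ e).
Qed.

Lemma size_ssort s b t : ssort s = Some (b, t) -> size t = size s.
Proof.
elim: s b t => [|x s IH] b t /=; first by case=> _ <-.
case e: (ssort s) => [[b' t']|] //=; case e': (sins x t') => [[b'' t'']|] //=.
by case=> _ <-; rewrite (size_sins e') (IH _ _ e).
Qed.

(** The prefix [p] makes the induction work: it collects the entries that [x] has already been
    exchanged with, each exchange costing a sign. *)
Lemma mon_sins k p x s (A : 'M[R]_(k, n.+1)) : size (p ++ x :: s) = k ->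
  mon (p ++ x :: s) A =
  if sins x s is Some (b, t) then (-1) ^+ b * mon (p ++ t) A else 0.
Proof.
elim: s p => [|y s IH] p sk /=; first by rewrite mul1r.
case: ltnP => _; first by rewrite mul1r.
case: eqP => [exy|_]; first by rewrite exy in sk *; rewrite mon_dup.
rewrite mon_swap // -cat_rcons IH; last by rewrite cat_rcons -sk !size_cat /=.
case: (sins x s) => [[b t]|] /=; last by rewrite oppr0.
by rewrite cat_rcons signrN mulNr.
Qed.

Lemma mon_ssort k p s (A : 'M[R]_(k, n.+1)) : size (p ++ s) = k ->
  mon (p ++ s) A =
  if ssort s is Some (b, t) then (-1) ^+ b * mon (p ++ t) A else 0.
Proof.
elim: s p => [|x s IH] p sk /=; first by rewrite mul1r.
rewrite -cat_rcons IH; last by rewrite cat_rcons.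
case e: (ssort s) => [[b t]|] //=.
rewrite cat_rcons mon_sins; last first.
  by rewrite -sk !size_cat /= (size_ssort e).
case: (sins x t) => [[b' t']|] /=; last by rewrite mulr0.
by rewrite mulrA -signr_addb.
Qed.

Lemma ev_cons k m s (A : 'M[R]_(k, n.+1)) :
  ev (m :: s) A = m.1%:~R * mon m.2 A + ev s A.
Proof. by rewrite /ev big_cons. Qed.

Lemma ev_cat k s t (A : 'M[R]_(k, n.+1)) : ev (s ++ t) A = ev s A + ev t A.
Proof. by rewrite /ev big_cat. Qed.

Lemma ev_scal k c s (A : 'M[R]_(k, n.+1)) : ev (fscal c s) A = c%:~R * ev s A.
Proof.
rewrite /ev big_map big_distrr /=; apply: eq_bigr => m _.
by rewrite intrM mulrA.
Qed.

Lemma ev_facc k c l s (A : 'M[R]_(k, n.+1)) :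
  ev (facc c l s) A = c%:~R * mon l A + ev s A.
Proof.
elim: s => [|m s IH] /=; first by rewrite /ev big_seq1 big_nil addr0.
case: eqP => [<-|_]; rewrite !ev_cons ?IH /=; last by rewrite addrCA.
by rewrite intrD mulrDl [X in X + _]addrC addrA.
Qed.

Lemma ev_fnorm k s (A : 'M[R]_(k, n.+1)) : fwf k s -> ev (fnorm s) A = ev s A.
Proof.
elim: s => [|m s IH] //= /andP[/eqP sm ws].
have := mon_ssort (p := [::]) A sm; rewrite /= ev_cons => ->.
case: (ssort m.2) => [[b l]|]; last by rewrite mulr0 add0r IH.
rewrite ev_facc IH // mulrA; congr (_ * _ + _).
by case: b; rewrite ?mulr1 // expr1 mulrN1 intrN.
Qed.

(** Normalisation preserves the value, and a normal form with zero coefficients evaluates to 0. The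
    test lives over the integers, so one closed computation serves every [R]. *)
Lemma feqP k s t (A : 'M[R]_(k, n.+1)) : feq k s t -> ev s A = ev t A.
Proof.
case/and3P=> ws wt /allP z; apply/eqP; rewrite -subr_eq0; apply/eqP.
have -> : ev s A - ev t A = ev (s ++ fscal (-1) t) A.
  by rewrite ev_cat ev_scal mulN1r.
rewrite -ev_fnorm; last first.
  rewrite /fwf all_cat; apply/andP; split => //.
  by rewrite all_map; apply: sub_all wt => m.
by rewrite /ev big_seq big1 // => m /z /eqP ->; rewrite mul0r.
Qed.

Lemma ev_alternating k s : multialternating (@ev k s).
Proof.
split.
  move=> A B C i b c rA rB rC; rewrite /ev !big_distrr /= -big_split /=.
  apply: eq_bigr => m _; have [L _] := @emon_alternating R n.+1 k
    (fun j => inord (nth 0%N m.2 j)).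
  by rewrite /mon (L _ _ _ _ _ _ rA rB rC); ring.
move=> A i j ij rij; rewrite /ev big1 // => m _.
have [_ L] := @emon_alternating R n.+1 k (fun j => inord (nth 0%N m.2 j)).
by rewrite /mon (L _ _ _ ij rij) mulr0.
Qed.

(** The length of the left list decides where the indices of the right factor start, hence the
    condition on [s]. *)
Lemma mwedge_mon k l s t (A : 'M[R]_(k + l, n.+1)) : size s = k ->
  mwedge (@mon k s) (@mon l t) A = mon (s ++ t) A.
Proof.
move=> sk; rewrite mwedge_emon; apply: emon_eq => i.
case: (split_ordP i) => [a ->|a ->]; rewrite ?ord_catl ?ord_catr nth_cat sk /=.
  by rewrite ltn_ord.
by rewrite ltnNge leq_addr addKn.
Qed.

Lemma mwedge_ev k l s t (A : 'M[R]_(k + l, n.+1)) : fwf k s ->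
  mwedge (@ev k s) (@ev l t) A = ev (fmul s t) A.
Proof.
move=> /allP ws; rewrite mwedge_suml /ev big_allpairs_dep /=.
rewrite big_seq [RHS]big_seq; apply: eq_bigr => m /ws /eqP sm.
rewrite mwedge_sumr big_distrr /=; apply: eq_bigr => m' _.
by rewrite mwedge_mon // intrM mulrA.
Qed.

End Reflection.

(** * Interior products with basis vectors *)

Definition fcontr (i : nat) (s : fpoly) : fpoly :=
  [seq (if odd j then - m.1 else m.1, take j m.2 ++ drop j.+1 m.2)
     | m <- s, j <- [seq j <- iota 0 (size m.2) | nth 0%N m.2 j == i]].

Definition fbound n (s : fpoly) := all (fun m => all (fun j => (j < n)%N) m.2) s.

Section Contraction.
Variables (R : realType) (n : nat).

(** Laplace expansion of the determinant along its first row, [u]. *)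
Lemma mon_col_mx k l (u : 'rV[R]_n.+1) (A : 'M[R]_(k, n.+1)) :
  size l = k.+1 ->
  @mon R n k.+1 l (col_mx u A) =
  \sum_(j < k.+1) (-1) ^+ j * u 0 (inord (nth 0%N l j)) *
    mon (take j l ++ drop j.+1 l) A.
Proof.
move=> sl; rewrite /mon {1}/emon (expand_det_row _ ord0); apply: eq_bigr => j _.
rewrite [X in X * _](_ : _ = u 0 (inord (nth 0%N l j))); last first.
  rewrite !mxE; case: splitP => [j' _|j' /=]; last by [].
  by rewrite ord1.
rewrite /cofactor add0n mulrCA mulrA; congr (_ * \det _).
apply/matrixP => a b; rewrite !mxE; case: splitP => [a'|a' /= e].
  by rewrite ord1.
have -> : a' = a by apply: val_inj; move: e; rewrite /bump /= !add1n => -[].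
congr (A a (inord _)); rewrite nth_cat size_takel; last by rewrite sl ltnW.
rewrite /= /bump; case: ltnP => bj.
  by rewrite add0n nth_take.
by rewrite nth_drop addSn subnKC // add1n.
Qed.

Lemma minsert_mon k i l (A : 'M[R]_(k, n.+1)) :
  size l = k.+1 -> all (fun j => (j < n.+1)%N) l -> (i < n.+1)%N ->
  minsert (delta_mx 0 (inord i)) (@mon R n k.+1 l) A =
  \sum_(j <- [seq j <- iota 0 k.+1 | nth 0%N l j == i])
     (-1) ^+ j * mon (take j l ++ drop j.+1 l) A.
Proof.
move=> sl /allP bl li; rewrite /minsert mon_col_mx //.
rewrite big_filter -[iota 0 k.+1]/(index_iota 0 k.+1) big_mkord [RHS]big_mkcond /=.
apply: eq_bigr => j _; rewrite mxE eqxx /= -(inj_eq val_inj) /= !inordK //; last first.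
  by apply: bl; rewrite mem_nth // sl.
by case: eqP => _; rewrite ?mulr1 // mulr0 mul0r.
Qed.

Lemma mon1E i (a : 'rV[R]_n.+1) : mon [:: i] a = a 0 (inord i).
Proof. by rewrite /mon /emon det_mx11 mxE. Qed.

Lemma mon2E i j (a b : 'rV[R]_n.+1) :
  @mon R n (1 + 1) [:: i; j] (col_mx a b) =
  a 0 (inord i) * b 0 (inord j) - a 0 (inord j) * b 0 (inord i).
Proof.
rewrite (mon_col_mx (k := 1)) // !big_ord_recl big_ord0 /= !mon1E.
by rewrite /bump /=; ring.
Qed.

Lemma mon3E i j k (a b c : 'rV[R]_n.+1) :
  @mon R n (1 + (1 + 1)) [:: i; j; k] (col_mx a (col_mx b c)) =
  a 0 (inord i) * (b 0 (inord j) * c 0 (inord k) - b 0 (inord k) * c 0 (inord j))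
  - a 0 (inord j) * (b 0 (inord i) * c 0 (inord k) - b 0 (inord k) * c 0 (inord i))
  + a 0 (inord k) * (b 0 (inord i) * c 0 (inord j) - b 0 (inord j) * c 0 (inord i)).
Proof.
rewrite (mon_col_mx (k := 2)) // !big_ord_recl big_ord0 /= !(@mon2E).
by rewrite /bump /=; ring.
Qed.

Lemma minsert_ev k i s (A : 'M[R]_(k, n.+1)) :
  fwf k.+1 s -> fbound n.+1 s -> (i < n.+1)%N ->
  minsert (delta_mx 0 (inord i)) (@ev R n k.+1 s) A = ev (fcontr i s) A.
Proof.
move=> /allP ws /allP bs li; rewrite /minsert /ev big_allpairs_dep /=.
rewrite big_seq [RHS]big_seq; apply: eq_bigr => m ms.
have /eqP sm := ws _ ms; have bm := bs _ ms.
have := minsert_mon A sm bm li; rewrite /minsert => ->.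
rewrite sm big_distrr /=; apply: eq_bigr => j _.
rewrite mulrA -signr_odd; congr (_ * _).
by case: (odd j); rewrite ?mulr1 // expr1 mulrN1 intrN.
Qed.

Lemma minsert_sum k (f : 'M[R]_(k.+1, n) -> R) (u : 'rV[R]_n) A :
  multilinear f ->
  minsert u f A = \sum_i u 0 i * minsert (delta_mx 0 i) f A.
Proof.
by move=> fL; rewrite /minsert {1}[u]row_sum_delta multilinear_col_mx_sum.
Qed.

End Contraction.

(** * The Hodge star in an orthonormal frame *)

Section Star.
Variables (R : realType) (n : nat).

(* [star] at a single point, with the inverse Gram matrix [h] as an argument. *)
Definition mstar k l (h : 'M[R]_n) (v : 'M[R]_(k + l, n) -> R)
    (f : 'M[R]_(k, n) -> R) (A : 'M[R]_(l, n)) : R :=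
  (k`!%:R)^-1 * \sum_(I : {ffun 'I_k -> 'I_n})
     f (rowsub I h) * v (col_mx (rowsub I 1%:M) A).

Lemma mstar_suml k l h v (T : Type) (r : seq T) (c : T -> R)
    (f : T -> 'M[R]_(k, n) -> R) (A : 'M[R]_(l, n)) :
  mstar h v (fun B => \sum_(t <- r) c t * f t B) A =
  \sum_(t <- r) c t * mstar h v (f t) A.
Proof.
rewrite /mstar; under eq_bigr => s _ do rewrite big_distrl /=.
rewrite exchange_big /= big_distrr /=; apply: eq_bigr => t _.
rewrite mulrCA; congr (_ * _); rewrite big_distrr /=; apply: eq_bigr => s _.
by rewrite mulrA.
Qed.

Lemma mstarZ k l h v (c : R) (f : 'M[R]_(k, n) -> R) (A : 'M[R]_(l, n)) :
  mstar h v (fun B => c * f B) A = c * mstar h v f A.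
Proof.
have := mstar_suml h v [:: 0%N] (fun=> c) (fun=> f) A; rewrite big_seq1 => <-.
by congr mstar; apply/funext => B; rewrite big_seq1.
Qed.

Lemma row_col_mx_lshift k l (B : 'M[R]_(k, n)) (A : 'M[R]_(l, n)) i :
  row (lshift l i) (col_mx B A) = row i B.
Proof. by apply/rowP => j; rewrite mxE col_mxEu mxE. Qed.

Lemma row_col_mx_rshift k l (B : 'M[R]_(k, n)) (A : 'M[R]_(l, n)) i :
  row (rshift k i) (col_mx B A) = row i A.
Proof. by apply/rowP => j; rewrite mxE col_mxEd mxE. Qed.

Lemma multialternating_col_mx k l (v : 'M[R]_(k + l, n) -> R) A :
  multialternating v ->
  multialternating (fun B : 'M[R]_(k, n) => v (col_mx B A)).
Proof.
case=> /multilinearP vL vA; split.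
  apply/multilinearP => B C D i b c rB rC rD.
  apply: (vL _ _ _ (lshift l i)); rewrite ?row_col_mx_lshift // => j;
    case: (split_ordP j) => [j' ->|j' ->];
    rewrite ?row_col_mx_lshift ?row_col_mx_rshift //;
    rewrite (inj_eq (@lshift_inj _ _)); [exact: rC | exact: rD].
move=> B i j ij rij; apply: (vA _ (lshift l i) (lshift l j)).
  by rewrite (inj_eq (@lshift_inj _ _)).
by rewrite !row_col_mx_lshift.
Qed.

(** The inverse Gram matrix is $F^TF$. One factor is absorbed by $f$ and the other by $v$, both by
    multilinearity, which leaves the star of an orthonormal basis. *)
Lemma mstar_frame k l (h F : 'M[R]_n) v (f : 'M[R]_(k, n) -> R)
    (A : 'M[R]_(l, n)) :
  multilinear f -> multialternating v -> h = F^T *m F ->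
  mstar h v f (A *m F) =
  mstar 1%:M (fun B => v (B *m F)) (fun B => f (B *m F)) A.
Proof.
move=> fL vA ->; rewrite /mstar; congr (_ * _).
under eq_bigr => I _.
  have -> : rowsub I (F^T *m F) = rowsub I F^T *m F.
    by apply/row_matrixP => i; rewrite row_rowsub !row_mul row_rowsub.
  rewrite (multilinear_mulmx _ _ fL) big_distrl /=; over.
rewrite exchange_big /=; apply: eq_bigr => J _.
have rJ : rowsub J 1%:M *m F = rowsub J F.
  by apply/row_matrixP => i; rewrite row_mul !row_rowsub -row_mul mul1mx.
rewrite rJ mul_col_mx rJ -[rowsub J F]mulmx1.
rewrite (multilinear_mulmx _ _ (multialternating_col_mx _ vA).1) big_distrr /=.
apply: eq_bigr => I _; rewrite mulmx1 -mulrA mulrCA; congr (_ * (_ * _)).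
by apply: eq_bigr => i _; rewrite !mxE.
Qed.

(** For the identity Gram matrix the defining sum is the expansion of $v$ in its first $k$
    arguments, evaluated at the basis vectors listed by [I]. *)
Lemma mstar_emon k l v (I : 'I_k -> 'I_n) (A : 'M[R]_(l, n)) :
  multialternating v ->
  mstar 1%:M v (emon I) A = v (col_mx (rowsub I 1%:M) A).
Proof.
move=> vA.
rewrite (multialternating_expand (rowsub I 1%:M) (multialternating_col_mx A vA)).
rewrite /mstar; congr (_ * _); apply: eq_bigr => J _; rewrite mulrC; congr (_ * _).
rewrite /emon -det_tr; congr (\det _).
by apply/matrixP => i j; rewrite !mxE eq_sym.
Qed.

End Star.

(** The star of a monomial is the increasing complement, signed so that the monomial followed by it
    is positively oriented. The value [(0, J)] for a failing sort is excluded by [fstar_ok]. *)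
Definition fstar n (s : fpoly) : fpoly :=
  [seq (let J := [seq j <- iota 0 n | j \notin m.2] in
        if ssort (m.2 ++ J) is Some (b, _) then (if b then - m.1 else m.1, J)
        else (0, J)) | m <- s].

Definition fstar_ok n k l (s : fpoly) := all (fun m =>
  let J := [seq j <- iota 0 n | j \notin m.2] in
  [&& size m.2 == k, size J == l, uniq (m.2 ++ J),
      all (fun j => (j < n)%N) (m.2 ++ J)
    & omap snd (ssort (m.2 ++ J)) == Some (iota 0 n)]) s.

Section StarEv.
Variables (R : realType) (n : nat).

Lemma mon_top (A : 'M[R]_n.+1) : mon (iota 0 n.+1) A = \det A.
Proof.
congr (\det _); apply/matrixP => i j; rewrite !mxE; congr (A _ _).
by rewrite nth_iota // add0n inord_val.
Qed.

(** Once the volume form is reordered as [I ++ J], inserting the basis vectors of [I] produces a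
    lower triangular block determinant with an identity corner; what remains is the minor of [J]. *)
Lemma mstar_mon k l I J b (A : 'M[R]_(l, n.+1)) :
  (k + l = n.+1)%N -> size I = k -> size J = l -> uniq (I ++ J) ->
  all (fun j => (j < n.+1)%N) (I ++ J) ->
  ssort (I ++ J) = Some (b, iota 0 n.+1) ->
  mstar 1%:M (@mon R n (k + l) (iota 0 n.+1)) (@mon R n k I) A =
  (-1) ^+ b * mon J A.
Proof.
move=> kl sI sJ uIJ bIJ sIJ.
have vA : multialternating (@mon R n (k + l) (iota 0 n.+1)).
  exact: emon_alternating.
rewrite mstar_emon //.
have := @mon_ssort R n (k + l) [::] (I ++ J) _ _; rewrite /= sIJ => s1.
have {}s1 B : mon (iota 0 n.+1) B = (-1) ^+ b * @mon R n (k + l) (I ++ J) B.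
  by rewrite s1 ?size_cat ?sI ?sJ // mulrA -expr2 sqrr_sign mul1r.
rewrite s1; congr (_ * _); rewrite /mon /emon.
set X := rowsub _ _.
have nI (a : 'I_k) : nth 0%N (I ++ J) a = nth 0%N I a by rewrite nth_cat sI ltn_ord.
have nJ (a : 'I_l) : nth 0%N (I ++ J) (k + a) = nth 0%N J a.
  by rewrite nth_cat sI ltnNge leq_addr addKn.
have bI (a : 'I_k) : (nth 0%N I a < n.+1)%N.
  by apply: (allP bIJ); rewrite mem_cat mem_nth // sI.
have bJ (a : 'I_l) : (nth 0%N J a < n.+1)%N.
  by apply: (allP bIJ); rewrite mem_cat mem_nth ?orbT // sJ.
have -> : colsub (fun j : 'I_(k + l) => inord (nth 0%N (I ++ J) j)) (col_mx X A) =
  block_mx 1%:M 0 (colsub (fun j : 'I_k => inord (nth 0%N I j)) A)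
    (colsub (fun j : 'I_l => inord (nth 0%N J j)) A).
  apply/matrixP => i j.
  case: (split_ordP i) => [a ->|a ->]; case: (split_ordP j) => [c ->|c ->].
  - rewrite block_mxEul mxE col_mxEu !mxE /= nI -(inj_eq val_inj) /= !inordK //.
    by rewrite nth_uniq ?sI //; move: uIJ; rewrite cat_uniq => /andP[].
  - rewrite block_mxEur mxE col_mxEu !mxE /= nJ -(inj_eq val_inj) /= !inordK //.
    have la := ltn_ord a; have lc := ltn_ord c.
    rewrite -(nI a) -(nJ c) nth_uniq // ?size_cat ?sI ?sJ; try lia.
    by case: eqP => // e; exfalso; lia.
  - by rewrite block_mxEdl mxE col_mxEd !mxE /= nI.
  - by rewrite block_mxEdr mxE col_mxEd !mxE /= nJ.
by rewrite det_lblock det1 mul1r.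
Qed.

Lemma mstar_ev k l s (A : 'M[R]_(l, n.+1)) :
  (k + l = n.+1)%N -> fstar_ok n.+1 k l s ->
  mstar 1%:M (@mon R n (k + l) (iota 0 n.+1)) (@ev R n k s) A =
  ev (fstar n.+1 s) A.
Proof.
move=> kl /allP sok; rewrite mstar_suml /ev big_map.
rewrite big_seq [RHS]big_seq; apply: eq_bigr => m ms.
have := sok _ ms; set J := [seq j <- _ | _] => /and5P[/eqP sI /eqP sJ u b].
case e: (ssort (m.2 ++ J)) => [[c t]|] //= /eqP[et]; rewrite {}et in e.
rewrite (mstar_mon A kl sI sJ u b e) mulrA -/J e; congr (_ * _).
by case: c {e}; rewrite ?mulr1 // expr1 mulrN1 intrN.
Qed.

End StarEv.

(** * The model G2 structure *)

Definition feta : fpoly := [:: (1 : int, [:: 0]%N)].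
Definition fom : fpoly := [:: (1 : int, [:: 1; 2]%N); (1, [:: 3; 4]%N); (1, [:: 5; 6]%N)].
(* Real and imaginary part of [dz1 /\ dz2 /\ dz3] for
   [z1 = x1 + i x2], [z2 = x3 + i x4], [z3 = x5 + i x6]. *)
Definition fre : fpoly :=
  [:: (1 : int, [:: 1; 3; 5]%N); (-1, [:: 1; 4; 6]%N);
      (-1, [:: 2; 3; 6]%N); (-1, [:: 2; 4; 5]%N)].
Definition fim : fpoly :=
  [:: (1 : int, [:: 1; 3; 6]%N); (1, [:: 1; 4; 5]%N);
      (1, [:: 2; 3; 5]%N); (-1, [:: 2; 4; 6]%N)].
Definition fphi : fpoly := fre ++ fmul feta fom.

Definition fom2 : fpoly :=
  [:: (2 : int, [:: 1; 2; 3; 4]%N); (2, [:: 1; 2; 5; 6]%N);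
      (2, [:: 3; 4; 5; 6]%N)].

(** In the model the standard basis is orthonormal and positively oriented; the 49 pairs of basis
    vectors are checked in a single computation. *)
Lemma g2_form_model i j : (i < 7)%N -> (j < 7)%N ->
  feq 7 (fmul (fmul (fcontr i fphi) (fcontr j fphi)) fphi)
    [:: ((if i == j then 6 else 0), iota 0 7)].
Proof.
have : all (fun i => all (fun j =>
    feq 7 (fmul (fmul (fcontr i fphi) (fcontr j fphi)) fphi)
    [:: ((if i == j then 6 else 0), iota 0 7)]) (iota 0 7)) (iota 0 7).
  by vm_compute.
move=> /allP/(_ i) H li lj; move: H; rewrite mem_iota => /(_ li) /allP /(_ j).
by rewrite mem_iota => /(_ lj).
Qed.

(** Doubled, because $\psi=\frac12\omega^2-\eta\wedge\mathrm{Im}\,\Upsilon$ while coefficients of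
    lists are integers. *)
Lemma star_fphi :
  feq 4 (fscal 2 (fstar 7 fphi)) (fom2 ++ fscal (-2) (fmul feta fim)).
Proof. by vm_compute. Qed.

Lemma fom_fom : feq 4 (fmul fom fom) fom2.
Proof. by vm_compute. Qed.

Lemma star_fom2 : feq 3 (fstar 7 fom2) (fscal 2 (fmul feta fom)).
Proof. by vm_compute. Qed.

(** $\mathrm{Re}\,\Upsilon\wedge\omega^2=0$ and $\eta\wedge\omega^3=6\,\mathrm{vol}$; this is the 6
    in $\tau_0$. *)
Lemma fphi_fom2 : feq 7 (fmul fphi fom2) [:: (6, iota 0 7)].
Proof. by vm_compute. Qed.

(** $\omega$ has type $(1,1)$ and $\Upsilon$ type $(3,0)$, and there are no $(4,1)$-forms in complex
    dimension 3. *)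
Lemma fom_fim : feq 5 (fmul fom fim) [::].
Proof. by vm_compute. Qed.

(** With [fim_fre] and [fom_fom_fom] this is the normalisation $|\Upsilon|=1$ of the model:
    $\frac18(4+4)=1=\frac{6}{3!}$. *)
Lemma fre_fim : feq 6 (fmul fre fim) [:: (4, iota 1 6)].
Proof. by vm_compute. Qed.

Lemma fim_fre : feq 6 (fmul fim fre) [:: (-4, iota 1 6)].
Proof. by vm_compute. Qed.

Lemma fre_fre : feq 6 (fmul fre fre) [::].
Proof. by vm_compute. Qed.

Lemma fim_fim : feq 6 (fmul fim fim) [::].
Proof. by vm_compute. Qed.

Lemma fom_fom_fom : feq 6 (fmul fom (fmul fom fom)) [:: (6, iota 1 6)].
Proof. by vm_compute. Qed.

(** * Components in a frame, and the metric determined by a G2 form *)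

Section Frames.
Variables (R : realType) (n : nat).

Lemma multialternating_mulmx k m (f : 'M[R]_(k, n) -> R) (F : 'M[R]_(m, n)) :
  multialternating f -> multialternating (fun B => f (B *m F)).
Proof.
case=> /multilinearP fL fA; split.
  apply/multilinearP => A B C i b c rA rB rC; apply: (fL _ _ _ i).
  - by rewrite !row_mul rA mulmxDl -!scalemxAl.
  - by move=> j ji; rewrite !row_mul rB.
  - by move=> j ji; rewrite !row_mul rC.
by move=> A i j ij rij; apply: (fA _ i j ij); rewrite !row_mul rij.
Qed.

Lemma eq_multialternating k (f h : 'M[R]_(k, n) -> R) :
  f =1 h -> multialternating f -> multialternating h.
Proof. by move=> fh; have -> : h = f by apply/funext => A; rewrite fh. Qed.

Lemma inv_gram (g F : 'M[R]_n) : F *m g *m F^T = 1%:M -> invmx g = F^T *m F.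
Proof.
move=> FgF; have /mulmx1C gF : F *m (g *m F^T) = 1%:M by rewrite mulmxA.
have : g *m (F^T *m F) = 1%:M by rewrite mulmxA.
move=> gFF; have [gu _] := mulmx1_unit gFF.
by rewrite -[RHS]mul1mx -(mulVmx gu) -mulmxA gFF mulmx1.
Qed.

End Frames.

Section InFrame.
Variables (R : realType) (n : nat).

(* In the coframe dual to the rows of [F], the form [f] has the components [s]. *)
Definition in_frame k (F : 'M[R]_n.+1) (f : 'M[R]_(k, n.+1) -> R) (s : fpoly) :=
  forall A, f (A *m F) = ev s A.

Lemma in_frame_eq k F (f h : 'M[R]_(k, n.+1) -> R) s :
  F \in unitmx -> in_frame F f s -> in_frame F h s -> f =1 h.
Proof. by move=> Fu fs hs A; rewrite -[A](mulmxKV Fu) fs hs. Qed.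

Lemma in_frame_alternating k F (f : 'M[R]_(k, n.+1) -> R) s :
  F \in unitmx -> in_frame F f s -> multialternating f.
Proof.
move=> Fu fs; apply: (eq_multialternating (f := fun A => ev s (A *m invmx F))).
  by move=> A; rewrite -fs mulmxKV.
exact: (multialternating_mulmx (invmx F) (@ev_alternating R n k s)).
Qed.

Lemma in_frame_wedge k l F (f : 'M[R]_(k, n.+1) -> R)
    (h : 'M[R]_(l, n.+1) -> R) s t : fwf k s ->
  in_frame F f s -> in_frame F h t -> in_frame F (mwedge f h) (fmul s t).
Proof.
move=> ws fs ht A; rewrite mwedge_mulmx -(mwedge_ev _ _ ws).
by congr mwedge; apply/funext => B; rewrite ?fs ?ht.
Qed.

Lemma in_frame_star k l g F vol (f : 'M[R]_(k, n.+1) -> R) s :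
  (k + l = n.+1)%N -> F \in unitmx -> F *m g *m F^T = 1%:M ->
  in_frame F vol [:: (1, iota 0 n.+1)] -> in_frame F f s -> fstar_ok n.+1 k l s ->
  in_frame F (@mstar R n.+1 k l (invmx g) vol f) (fstar n.+1 s).
Proof.
move=> kl Fu FgF vF fF sok A.
rewrite (mstar_frame _ _ _ (inv_gram FgF)).
- rewrite -(mstar_ev _ kl sok); congr mstar; apply/funext => B.
    by rewrite vF /ev big_seq1 mul1r.
  by rewrite fF.
- by have [] := in_frame_alternating Fu fF.
- exact: in_frame_alternating Fu vF.
Qed.

End InFrame.

Section G2Model.
Variable R : realType.
Implicit Types (F g : 'M[R]_7) (phi : 'M[R]_(3, 7) -> R).

(** Both insertions are expanded over the basis; by [g2_form_model] only the diagonal terms survive,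
    and they sum to the Euclidean product of [u] and [v]. *)
Lemma g2_form_in_frame F phi u v A : in_frame F phi fphi ->
  mwedge (mwedge (minsert (u *m F) phi) (minsert (v *m F) phi)) phi (A *m F) =
  6 * (u *m v^T) 0 0 * \det A.
Proof.
move=> phiF.
have iF w (B : 'M[R]_(2, 7)) : minsert (w *m F) phi (B *m F) =
    \sum_i w 0 i * @ev R 6 2 (fcontr i fphi) B.
  rewrite /minsert -mul_col_mx; apply: etrans (phiF (col_mx w B)) _.
  apply: etrans (minsert_sum w B (@ev_alternating R 6 3 fphi).1) _.
  apply: eq_bigr => i _; congr (_ * _).
  by have := @minsert_ev R 6 2 i fphi B; rewrite inord_val => ->.
rewrite mwedge_mulmx.
have -> : (fun B => mwedge (minsert (u *m F) phi) (minsert (v *m F) phi) (B *m F))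
  = (fun B : 'M[R]_(4, 7) => \sum_i u 0 i * (\sum_j v 0 j *
      @ev R 6 4 (fmul (fcontr i fphi) (fcontr j fphi)) B)).
  apply/funext => B; rewrite mwedge_mulmx.
  rewrite (funext (iF u)) (funext (iF v)).
  rewrite mwedge_suml; apply: eq_bigr => i _; congr (_ * _).
  rewrite mwedge_sumr; apply: eq_bigr => j _; congr (_ * _).
  by rewrite mwedge_ev //; case: i => -[|[|[|[|[|[|[|]]]]]]].
transitivity (\sum_i u 0 i * (v 0 i * (6 * \det A))); last first.
  rewrite mxE mulrAC [RHS]mulrC big_distrl; apply: eq_bigr => i _.
  by rewrite mxE mulrA.
rewrite (funext phiF) mwedge_suml /=.
apply: eq_bigr => i _; congr (_ * _); rewrite mwedge_suml.
rewrite (bigD1 i) //= big1 ?addr0 => [|j ji].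
  rewrite mwedge_ev; last by case: i => -[|[|[|[|[|[|[|]]]]]]].
  rewrite (feqP _ (g2_form_model (ltn_ord i) (ltn_ord i))) eqxx /ev big_seq1.
  by rewrite mon_top.
rewrite mwedge_ev; last first.
  by case: i {ji} => -[|[|[|[|[|[|[|]]]]]]] //; case: j => -[|[|[|[|[|[|[|]]]]]]].
rewrite (feqP _ (g2_form_model (ltn_ord i) (ltn_ord j))).
by rewrite (inj_eq val_inj) eq_sym (negbTE ji) /ev big_seq1 mul0r mulr0.
Qed.

Lemma delta_bilinE (G : 'M[R]_7) i j :
  (delta_mx 0 i *m G *m (delta_mx 0 j)^T) (0 : 'I_1) (0 : 'I_1) = G i j.
Proof. by rewrite -rowE trmx_delta -colE !mxE. Qed.

(** Let $G$ be the Gram matrix of the frame and $c$ its volume. The defining identity reads $cG=1$,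
    and $G_{00}>0$ gives $c>0$. Then $\sqrt c\,F$ is orthonormal, so its volume $c\,(\sqrt
    c)^7=(\sqrt c)^9$ has modulus 1, which forces $c=1$. *)
Lemma g2_metric_unique F g vol phi :
  F \in unitmx -> in_frame F phi fphi -> 0 < (F *m g *m F^T) 0 0 ->
  multialternating vol ->
  (forall E : 'M[R]_7, E *m g *m E^T = 1%:M -> `|vol E| = 1) ->
  (forall (u v : 'rV[R]_7) (A : 'M[R]_7),
     mwedge (mwedge (minsert u phi) (minsert v phi)) phi A =
     6 * (u *m g *m v^T) 0 0 * vol A) ->
  F *m g *m F^T = 1%:M /\ in_frame F vol [:: (1, iota 0 7)].
Proof.
move=> Fu phiF g00 vA vN gE; pose c := vol F.
have vE A : vol (A *m F) = c * \det A.
  by rewrite (multialternating_top A (multialternating_mulmx F vA)) mul1mx.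
have cG : c *: (F *m g *m F^T) = 1%:M.
  apply/matrixP => i j; rewrite mxE.
  have := gE (delta_mx 0 i *m F) (delta_mx 0 j *m F) (1%:M *m F).
  rewrite (g2_form_in_frame _ _ _ phiF) vE det1 !mulr1 -mulrA.
  have n6 : (6 : R) != 0 by rewrite pnatr_eq0.
  move/(mulfI n6).
  have -> : delta_mx 0 i *m F *m g *m (delta_mx 0 j *m F)^T =
      delta_mx 0 i *m (F *m g *m F^T) *m (delta_mx 0 j)^T :> 'M[R]_1.
    by rewrite trmx_mul !mulmxA.
  rewrite delta_bilinE mulrC => <-.
  by rewrite -[X in X *m _]mulmx1 delta_bilinE.
have c0 : 0 < c.
  have := congr1 (fun X : 'M[R]_7 => X 0 0) cG; rewrite /= [LHS]mxE [RHS]mxE eqxx mulr1n => e.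
  by rewrite -(pmulr_lgt0 _ g00) e ltr01.
have s0 : 0 < Num.sqrt c by rewrite sqrtr_gt0.
have c1 : c = 1.
  have E1 : (Num.sqrt c *: F) *m g *m (Num.sqrt c *: F)^T = 1%:M.
    rewrite linearZ -!scalemxAl -scalemxAr scalerA -expr2 sqr_sqrtr ?ltW //.
  have := vN _ E1; rewrite -[X in _ *: X]mul1mx scalemxAl vE detZ det1 mulr1.
  rewrite ger0_norm ?mulr_ge0 ?exprn_ge0 ?ltW // -{1}[c]sqr_sqrtr ?ltW // -exprD.
  move/eqP; rewrite pexpr_eq1 ?ltW //= => /eqP s1.
  by rewrite -[c]sqr_sqrtr ?ltW // s1 expr1n.
split; first by rewrite -cG c1 scale1r.
by move=> A; rewrite vE c1 mul1r /ev big_seq1 mul1r mon_top.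
Qed.

(** The metric is the one for which the rows of [F] are orthonormal, with the determinant in this
    frame as volume form. *)
Lemma g2_metric_exists F phi :
  F \in unitmx -> in_frame F phi fphi ->
  let g := invmx F *m (invmx F)^T in
  let vol := fun A => \det (A *m invmx F) in
  [/\ g^T = g /\ (forall u, u != 0 -> 0 < (u *m g *m u^T) (0 : 'I_1) (0 : 'I_1)),
      multialternating vol
      /\ (forall E : 'M[R]_7, E *m g *m E^T = 1%:M -> `|vol E| = 1)
    & forall (u v : 'rV[R]_7) (A : 'M[R]_7),
        mwedge (mwedge (minsert u phi) (minsert v phi)) phi A =
        6 * (u *m g *m v^T) 0 0 * vol A].
Proof.
move=> Fu phiF g vol.
have gE m k (B : 'M[R]_(m, 7)) (C : 'M[R]_(k, 7)) :
    B *m g *m C^T = (B *m invmx F) *m (C *m invmx F)^T.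
  by rewrite /g trmx_mul !mulmxA.
split.
- split; first by rewrite /g trmx_mul trmxK.
  move=> u u0; rewrite gE; set w := u *m invmx F.
  have w0 : w != 0.
    by apply: contraNneq u0 => w0; rewrite -[u](mulmxKV Fu) -/w w0 mul0mx.
  have [i wi] : exists i, w 0 i != 0.
    apply/existsP; apply: contraNT w0; rewrite negb_exists => /forallP w0.
    by apply/eqP/rowP => i; have := w0 i; rewrite negbK [RHS]mxE => /eqP.
  clearbody w; rewrite mxE (bigD1 i) //= mxE -expr2 ltr_wpDr ?exprn_even_gt0 //.
  by apply: sumr_ge0 => j _; rewrite mxE -expr2 sqr_ge0.
- split.
    apply: (@multialternating_mulmx R 7 7 7 determinant (invmx F)).
    apply: (eq_multialternating (f := @mon R 6 7 (iota 0 7))); first exact: mon_top.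
    exact: emon_alternating.
  move=> E; rewrite gE => /(congr1 determinant); rewrite det_mulmx det_tr det1.
  rewrite -/(vol E) -expr2 => e; apply/eqP; rewrite -sqrp_eq1 //.
  by rewrite -normrX e normr1.
- move=> u v A; have := g2_form_in_frame (u *m invmx F) (v *m invmx F) (A *m invmx F) phiF.
  by rewrite !mulmxKV // gE.
Qed.

Lemma mon_diag k l (d : 'rV[R]_7) (A : 'M[R]_(k, 7)) : size l = k ->
  mon l (A *m diag_mx d) = (\prod_(j <- l) d 0 (inord j)) * mon l A.
Proof.
move=> sl; rewrite /mon /emon.
have -> : colsub (fun j : 'I_k => inord (nth 0%N l j)) (A *m diag_mx d) =
   colsub (fun j : 'I_k => inord (nth 0%N l j)) A *m
   diag_mx (\row_(j < k) d 0 (inord (nth 0%N l j))).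
  by apply/matrixP => i j; rewrite mxE !mul_mx_diag !mxE.
rewrite det_mulmx det_diag mulrC; congr (_ * _).
rewrite (big_nth 0%N) sl big_mkord; apply: eq_bigr => j _.
by rewrite mxE.
Qed.

(* Turns a frame adapted to [(eta, omega, Upsilon)] into one in which
   [b^3 Re Upsilon + a b^2 eta /\ omega] is the standard G2 form. *)
Definition g2_scaling (a b : R) : 'M[R]_7 :=
  diag_mx (\row_j (if j == ord0 then a^-1 else b^-1)).

(** Here [m] is the number of factors $e^0$ in each monomial; these scale by $a^{-1}$, the other
    $k-m$ factors by $b^{-1}$. *)
Lemma ev_scaling k m s a b (A : 'M[R]_(k, 7)) :
  all (fun x => (size x.2 == k) && (all (fun j => j < 7)%N x.2) &&
                (count_mem 0%N x.2 == m)) s ->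
  ev s (A *m g2_scaling a b) = a^-1 ^+ m * b^-1 ^+ (k - m) * ev s A.
Proof.
move=> /allP sP; rewrite /ev big_distrr /= big_seq [RHS]big_seq.
apply: eq_bigr => x /sP /andP[/andP[/eqP sx bx] /eqP cx].
rewrite mon_diag // mulrCA; congr (_ * (_ * _)).
rewrite -{}sx -{}cx; elim: x.2 bx => [|j l IH] /=.
  by rewrite big_nil !expr0 mulr1.
case/andP=> lj /IH {}IH; rewrite big_cons IH mxE -(inj_eq val_inj) /= inordK //.
have lc : (count_mem 0 l <= size l)%N by exact: count_size.
case: eqP => _; first by rewrite add1n subSS exprS mulrA.
by rewrite add0n subSn // exprS mulrCA.
Qed.

End G2Model.

(** * The G2 form with parameters $a$, $b$ in a frame adapted to the SU(3)-structure *)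

Section SU3Frame.
Variables (R : realType) (e : 'M[R]_(1, 7) -> R) (w : 'M[R]_(2, 7) -> R).
Variables (r i : 'M[R]_(3, 7) -> R) (F : 'M[R]_7).

Record su3_frame : Prop := {
  su3_unit : F \in unitmx;
  su3_e : in_frame F e feta;
  su3_w : in_frame F w fom;
  su3_r : in_frame F r fre;
  su3_i : in_frame F i fim
}.

Hypothesis Ff : su3_frame.

Lemma su3_wedge_ww : in_frame F (mwedge w w) fom2.
Proof.
move=> A; rewrite (in_frame_wedge _ (su3_w Ff) (su3_w Ff)) //.
exact: feqP fom_fom.
Qed.

Lemma su3_wedge_ew : in_frame F (mwedge e w) (fmul feta fom).
Proof. exact: (in_frame_wedge _ (su3_e Ff) (su3_w Ff)). Qed.

Lemma su3_wedge_ei : in_frame F (mwedge e i) (fmul feta fim).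
Proof. exact: (in_frame_wedge _ (su3_e Ff) (su3_i Ff)). Qed.

Lemma su3_wedge_wi A : mwedge w i A = 0.
Proof.
rewrite -[A](mulmxKV (su3_unit Ff)).
rewrite (in_frame_wedge _ (su3_w Ff) (su3_i Ff)) // (feqP _ fom_fim).
by rewrite /ev big_nil.
Qed.

Variables (a b : R).
Hypothesis (a0 : 0 < a) (b0 : 0 < b).

Let F' := g2_scaling a b *m F.
Let phi A := b ^+ 3 * r A + a * b ^+ 2 * mwedge e w A.
Let psi A := b ^+ 4 / 2 * mwedge w w A - a * b ^+ 3 * mwedge e i A.

Let a_neq0 : a != 0. Proof. exact: lt0r_neq0. Qed.
Let b_neq0 : b != 0. Proof. exact: lt0r_neq0. Qed.

Lemma g2_frame_unit : F' \in unitmx.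
Proof.
rewrite unitmx_mul (su3_unit Ff) andbT unitmxE det_diag unitfE.
by apply/prodf_neq0 => j _; rewrite mxE; case: ifP; rewrite invr_eq0.
Qed.

Lemma g2_frame_phi : in_frame F' phi fphi.
Proof.
move=> A; rewrite /phi mulmxA (su3_r Ff) su3_wedge_ew.
rewrite (@ev_scaling _ 3 0) // (@ev_scaling _ 3 1) //.
rewrite [RHS](ev_cat fre (fmul feta fom)); move: (ev _ A) (ev _ A) => x y.
by field; rewrite a_neq0 b_neq0.
Qed.

Lemma g2_frame_psi A : 2 * psi (A *m F') = @ev R 6 4 (fscal 2 (fstar 7 fphi)) A.
Proof.
rewrite (feqP _ star_fphi) ev_cat ev_scal /psi mulmxA su3_wedge_ww su3_wedge_ei.
rewrite (@ev_scaling _ 4 0) // (@ev_scaling _ 4 1) //.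
have -> : (-2)%:~R = - 2 :> R by [].
by move: (ev _ A) (ev _ A) => x y; field; rewrite a_neq0 b_neq0.
Qed.

Lemma g2_frame_ww : in_frame F' (fun A => b ^+ 4 * mwedge w w A) fom2.
Proof.
move=> A; rewrite mulmxA su3_wedge_ww (@ev_scaling _ 4 0) //.
by move: (ev _ A) => x; field; rewrite b_neq0.
Qed.

Variables (g : 'M[R]_7) (vol : 'M[R]_7 -> R).
Hypotheses (Fg : F' *m g *m F'^T = 1%:M) (Fv : in_frame F' vol [:: (1, iota 0 7)]).

Lemma g2_psi_frame : in_frame F' psi (fstar 7 fphi).
Proof.
have n2 : (2 : R) != 0 by rewrite pnatr_eq0.
by move=> A; apply: (mulfI n2); rewrite g2_frame_psi ev_scal.
Qed.

Lemma g2_star_phi A : @mstar R 7 3 4 (invmx g) vol phi A = psi A.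
Proof.
apply: (in_frame_eq g2_frame_unit _ g2_psi_frame).
exact: (@in_frame_star R 6 3 4 g F' vol phi fphi erefl g2_frame_unit Fg Fv g2_frame_phi).
Qed.

Lemma g2_star_psi A : @mstar R 7 4 3 (invmx g) vol psi A = phi A.
Proof.
apply: (in_frame_eq g2_frame_unit _ g2_frame_phi) => {}A.
rewrite (@in_frame_star R 6 4 3 g F' vol psi _ erefl g2_frame_unit Fg Fv g2_psi_frame) //.
Qed.

(** In the scaled frame it is $b^4\omega^2$ that has integer components, so the factor is split as
    $ab^2=\frac{a}{b^2}\,b^4$. The star of $b^4\omega^2$ is $2ab^2\,\eta\wedge\omega$, which gives
    $2a^2$ in all. *)
Lemma g2_star_dphi A :
  @mstar R 7 4 3 (invmx g) vol (fun B => a * b ^+ 2 * mwedge w w B) A =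
  2 * a ^+ 2 * mwedge e w A.
Proof.
transitivity (a / b ^+ 2 *
    @mstar R 7 4 3 (invmx g) vol (fun B => b ^+ 4 * mwedge w w B) A).
  rewrite -mstarZ; congr mstar; apply/funext => B; move: (mwedge w w _) => x.
  by field; rewrite b_neq0.
rewrite -[A](mulmxKV g2_frame_unit); move: (A *m invmx F') => {}A.
rewrite (@in_frame_star R 6 4 3 g F' vol _ _ erefl g2_frame_unit Fg Fv g2_frame_ww) //.
rewrite (feqP _ star_fom2) ev_scal mulmxA su3_wedge_ew (@ev_scaling _ 3 1) //.
move: (ev _ A) => x; have -> : (2 : int)%:~R = 2 :> R by [].
by field; rewrite a_neq0 b_neq0.
Qed.

(** The same splitting $ab^2=\frac{a}{b^2}\,b^4$ reduces the claim to [fphi_fom2]. The argument [0]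
    is the empty list of vectors on which the resulting 0-form is evaluated. *)
Lemma g2_torsion :
  @mstar R 7 7 0 (invmx g) vol
    (mwedge phi (fun B => a * b ^+ 2 * mwedge w w B)) 0 = 6 * a / b ^+ 2.
Proof.
pose f := mwedge phi (fun B => b ^+ 4 * mwedge w w B).
have fF : in_frame F' f [:: (6, iota 0 7)].
  move=> A; apply: etrans (in_frame_wedge _ g2_frame_phi g2_frame_ww A) _ => //.
  exact: feqP fphi_fom2.
transitivity (a / b ^+ 2 * @mstar R 7 7 0 (invmx g) vol f 0).
  rewrite -mstarZ; congr mstar; apply/funext => B; rewrite -mwedgeZr.
  congr mwedge; apply/funext => {}B; move: (mwedge w w _) => x.
  by field; rewrite b_neq0.
rewrite -[X in mstar _ _ f X](mul0mx _ F').
rewrite (@in_frame_star R 6 7 0 g F' vol f _ erefl g2_frame_unit Fg Fv fF) //.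
rewrite /ev big_seq1 /mon /emon det_mx00 mulr1.
by rewrite [X in _ * X](_ : _ = 6) // mulrC mulrA.
Qed.

End SU3Frame.

(** * The exterior derivative of a wedge product *)

Section Cons.
Variables (R : realType) (n : nat).

Definition fcons k (m : 'I_n) (I : 'I_k -> 'I_n) (i : 'I_k.+1) :=
  oapp I m (unlift ord0 i).

Lemma fcons0 k m (I : 'I_k -> 'I_n) : fcons m I ord0 = m.
Proof. by rewrite /fcons unlift_none. Qed.

Lemma fconsS k m (I : 'I_k -> 'I_n) i : fcons m I (lift ord0 i) = I i.
Proof. by rewrite /fcons liftK. Qed.

Lemma fcons_eta k (I : 'I_k.+1 -> 'I_n) :
  I =1 fcons (I ord0) (fun i => I (lift ord0 i)).
Proof. by move=> i; case: (unliftP ord0 i) => [j|] ->; rewrite ?fconsS ?fcons0. Qed.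

Lemma fcons_cat k l m (I : 'I_k -> 'I_n) (J : 'I_l -> 'I_n) :
  @ord_cat n k.+1 l (fcons m I) J =1 fcons m (ord_cat I J).
Proof.
move=> i; case: (@split_ordP k.+1 l i) => [a ->|a ->]; rewrite ?ord_catl ?ord_catr.
  case: (unliftP ord0 a) => [b|] ->; rewrite ?fconsS ?fcons0.
    have -> : lshift l (lift ord0 b) = lift ord0 (lshift l b) by apply: val_inj.
    by rewrite fconsS ord_catl.
  have -> : lshift l (ord0 : 'I_k.+1) = (ord0 : 'I_(k + l).+1) by apply: val_inj.
  by rewrite fcons0.
have -> : rshift k.+1 a = lift ord0 (rshift k a) by apply: val_inj.
by rewrite fconsS ord_catr.
Qed.

Lemma emon_fcons k m (I : 'I_k -> 'I_n) (A : 'M[R]_(k.+1, n)) :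
  emon (fcons m I) A = \sum_(i < k.+1) (-1) ^+ i * A i m * emon I (row' i A).
Proof.
rewrite /emon (expand_det_col _ ord0); apply: eq_bigr => i _.
rewrite !mxE fcons0 mulrCA mulrA /cofactor addn0; congr (_ * _ * \det _).
by apply/matrixP => a b; rewrite !mxE fconsS.
Qed.

Lemma emon_swap k a b (I : 'I_k -> 'I_n) (A : 'M[R]_(k.+2, n)) :
  emon (fcons a (fcons b I)) A = - emon (fcons b (fcons a I)) A.
Proof.
rewrite -(@emon_tperm _ _ _ _ _ ord0 (lift ord0 ord0)) //; apply: emon_eq => i /=.
case: (unliftP ord0 i) => [j|] ->; last by rewrite tpermL fconsS !fcons0.
case: (unliftP ord0 j) => [j'|] ->; last by rewrite tpermR fconsS !fcons0.
by rewrite tpermD ?fconsS.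
Qed.

(** A relation $\sum c\,dx_m\wedge dx_J=0$ persists when $dx_I$ is put between the two factors: the
    first index of $I$ is moved to the front at the cost of a sign, and expanding along it leaves
    the relation for the shorter $I$. This disposes of the term $a\wedge db$ in the Leibniz rule. *)
Lemma emon_fcons_cat0 k l (T : Type) (r : seq T) (c : T -> R) (m : T -> 'I_n)
    (J : T -> 'I_l -> 'I_n) (I : 'I_k -> 'I_n) :
  (forall A, \sum_(t <- r) c t * emon (fcons (m t) (J t)) A = 0) ->
  forall A, \sum_(t <- r) c t * emon (fcons (m t) (ord_cat I (J t))) A = 0.
Proof.
move=> H; elim: k I => [|k IH] I A.
  rewrite -[RHS](H A); apply: eq_bigr => t _; congr (_ * _).
  apply: emon_eq => i; case: (unliftP ord0 i) => [j|] ->; rewrite ?fcons0 //.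
  rewrite !fconsS -[RHS](ord_catr I (J t)); congr ord_cat.
  by apply: val_inj.
transitivity (- \sum_(i < (k + l).+2) (-1) ^+ i * A i (I ord0) * \sum_(t <- r) c t *
    emon (fcons (m t) (ord_cat (fun i => I (lift ord0 i)) (J t))) (row' i A)).
  rewrite -sumrN.
  under [RHS]eq_bigr => i _ do rewrite big_distrr /= -sumrN.
  rewrite exchange_big /=; apply: eq_bigr => t _.
  have -> : emon (fcons (m t) (ord_cat I (J t))) A =
     emon (fcons (m t) (fcons (I ord0) (ord_cat (fun i => I (lift ord0 i)) (J t)))) A.
    apply: emon_eq => i; case: (unliftP ord0 i) => [j|] ->; rewrite ?fcons0 //.
    rewrite !fconsS -fcons_cat /ord_cat; case: fintype.split => // a.
    exact: fcons_eta.
  rewrite emon_swap emon_fcons mulrN big_distrr /= -sumrN; apply: eq_bigr => i _.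
  by rewrite mulrCA.
by rewrite big1 ?oppr0 // => i _; rewrite IH mulr0.
Qed.

End Cons.

Section FlatDerivative.
Variables (R : realType) (n : nat).
Implicit Types (x v : 'rV[R]_n).

Lemma is_derive_bigsum x v (T : Type) (r : seq T) (f : T -> 'rV[R]_n -> R)
    (df : T -> R) :
  (forall t, is_derive x v (f t) (df t)) ->
  is_derive x v (fun y => \sum_(t <- r) f t y) (\sum_(t <- r) df t).
Proof.
move=> fP; elim: r => [|t r IH].
  rewrite big_nil; under eq_fun => y do rewrite big_nil.
  exact: is_derive_cst.
rewrite big_cons; under eq_fun => y do rewrite big_cons.
exact: is_deriveD.
Qed.

Lemma derive_coord (f : 'rV[R]_n -> R) x v : differentiable f x ->
  is_derive x v f (\sum_m v 0 m * 'D_(delta_mx 0 m) f x).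
Proof.
move=> fx; apply: (DeriveDef (diff_derivable fx)).
rewrite deriveE // {1}[v]row_sum_delta raddf_sum; apply: eq_bigr => m _.
by rewrite deriveE //; exact: (linearZZ ('d f x)).
Qed.

(** The exterior derivative of a form given by its components in one fixed chart; [dext] at [p] is
    this for the chart at [p]. *)
Definition flatd k (a : 'rV[R]_n -> 'M[R]_(k, n) -> R) x (A : 'M[R]_(k.+1, n)) :=
  \sum_(i < k.+1) (-1) ^+ i * 'D_(row i A) (fun y => a y (row' i A)) x.

(** $d(h\,dx_J)=\sum_m\partial_mh\;dx_m\wedge dx_J$, the signs in [flatd] being those of a cofactor
    expansion along the column of $dx_m$. *)
Lemma flatd_sum k (T : Type) (r : seq T) (h : T -> 'rV[R]_n -> R)
    (J : T -> 'I_k -> 'I_n) (a : 'rV[R]_n -> 'M[R]_(k, n) -> R) x A :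
  (forall y B, a y B = \sum_(t <- r) h t y * emon (J t) B) ->
  (forall t, differentiable (h t) x) ->
  flatd a x A =
  \sum_(t <- r) \sum_m 'D_(delta_mx 0 m) (h t) x * emon (fcons m (J t)) A.
Proof.
move=> aE hx.
have E i : 'D_(row i A) (fun y => a y (row' i A)) x = \sum_(t <- r)
    \sum_m A i m * 'D_(delta_mx 0 m) (h t) x * emon (J t) (row' i A).
  under [X in 'D__ X _]eq_fun => y do rewrite aE.
  have H t : is_derive x (row i A) (fun y => h t y * emon (J t) (row' i A))
     (\sum_m A i m * 'D_(delta_mx 0 m) (h t) x * emon (J t) (row' i A)).
    have -> : (fun y => h t y * emon (J t) (row' i A)) =
        (emon (J t) (row' i A)) \*: (h t) by apply/funext => y /=; rewrite mulrC.
    apply: (is_derive_eq (is_deriveZ _ (derive_coord _ (hx t)))).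
    rewrite scaler_sumr; apply: eq_bigr => m _.
    by rewrite mxE [LHS]mulrC.
  by have [_ ->] := is_derive_bigsum r H.
rewrite /flatd; under eq_bigr => i _ do rewrite E big_distrr /=.
rewrite exchange_big /=; apply: eq_bigr => t _.
under eq_bigr => i _ do rewrite big_distrr /=.
rewrite exchange_big /=; apply: eq_bigr => m _.
rewrite emon_fcons big_distrr /=; apply: eq_bigr => i _.
by ring.
Qed.

(** Coefficient with respect to the redundant family of all index maps, which explains the factor
    $1/k!$. *)
Definition fcoef k (a : 'M[R]_(k, n) -> R) (I : {ffun 'I_k -> 'I_n}) : R :=
  (k`!%:R)^-1 * a (rowsub I 1%:M).

Lemma fcoefE k (a : 'M[R]_(k, n) -> R) A : multialternating a ->
  a A = \sum_I fcoef a I * emon I A.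
Proof.
move=> aA; rewrite (multialternating_expand _ aA) big_distrr /=.
by apply: eq_bigr => I _; rewrite mulrA.
Qed.

Lemma mwedge_fcoef k l (a : 'M[R]_(k, n) -> R) (b : 'M[R]_(l, n) -> R) A :
  multialternating a -> multialternating b ->
  mwedge a b A = \sum_p (fcoef a p.1 * fcoef b p.2) * emon (ord_cat p.1 p.2) A.
Proof.
move=> aA bA.
rewrite -(pair_bigA _ (fun I J => fcoef a I * fcoef b J * emon (ord_cat I J) A)) /=.
have eb : b = fun B => \sum_I fcoef b I * emon I B.
  by apply/funext => B; exact: fcoefE.
transitivity (mwedge (fun B => \sum_I fcoef a I * emon I B) b A).
  by congr mwedge; apply/funext => B; exact: fcoefE.
rewrite mwedge_suml; apply: eq_bigr => I _; rewrite {1}eb mwedge_sumr big_distrr /=.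
by apply: eq_bigr => J _; rewrite mwedge_emon mulrA.
Qed.

(** Both forms are expanded into monomials and the scalar product rule is applied to the
    coefficients. With $db=0$ only $da\wedge b$ is left, so no sign depending on [k] appears. *)
Lemma flatd_wedge k l (a : 'rV[R]_n -> 'M[R]_(k, n) -> R)
    (b : 'rV[R]_n -> 'M[R]_(l, n) -> R) x A :
  (forall y, multialternating (a y)) -> (forall y, multialternating (b y)) ->
  (forall B, differentiable (fun y => a y B) x) ->
  (forall B, differentiable (fun y => b y B) x) ->
  (forall B, flatd b x B = 0) ->
  @flatd (k + l) (fun y => mwedge (a y) (b y)) x A =
  @mwedge R n R k.+1 l (flatd a x) (b x) A.
Proof.
move=> aA bA ad bd db.
have fa I : differentiable (fun y => fcoef (a y) I) x.
  exact: differentiableZ (ad _).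
have fb I : differentiable (fun y => fcoef (b y) I) x.
  exact: differentiableZ (bd _).
have dE k' (c : 'rV[R]_n -> 'M[R]_(k', n) -> R) B :
    (forall y, multialternating (c y)) ->
    (forall I, differentiable (fun y => fcoef (c y) I) x) ->
    flatd c x B = \sum_(I : {ffun 'I_k' -> 'I_n}) \sum_m
      'D_(delta_mx 0 m) (fun y => fcoef (c y) I) x * emon (fcons m I) B.
  by move=> cA fc; apply: flatd_sum fc => y C; exact: fcoefE.
rewrite (flatd_sum (r := index_enum _)
  (h := fun (p : {ffun 'I_k -> 'I_n} * {ffun 'I_l -> 'I_n}) y =>
          fcoef (a y) p.1 * fcoef (b y) p.2)
  (J := fun p => ord_cat p.1 p.2)); first last.
- by move=> p; exact: differentiableM.
- by move=> y B; exact: mwedge_fcoef.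
rewrite -(pair_bigA _ (fun I J => \sum_m
  'D_(delta_mx 0 m) (fun y => fcoef (a y) I * fcoef (b y) J) x *
  emon (fcons m (ord_cat I J)) A)) /=.
transitivity (\sum_(I : {ffun 'I_k -> 'I_n}) \sum_m
   'D_(delta_mx 0 m) (fun y => fcoef (a y) I) x *
   mwedge (emon (fcons m I)) (b x) A).
  apply: eq_bigr => I _.
  transitivity (\sum_(J : {ffun 'I_l -> 'I_n}) \sum_m
      fcoef (b x) J * 'D_(delta_mx 0 m) (fun y => fcoef (a y) I) x *
        emon (fcons m (ord_cat I J)) A +
    fcoef (a x) I * \sum_(J : {ffun 'I_l -> 'I_n}) \sum_m
      'D_(delta_mx 0 m) (fun y => fcoef (b y) J) x *
        emon (fcons m (ord_cat I J)) A).
    rewrite big_distrr -big_split /=; apply: eq_bigr => J _.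
    rewrite big_distrr -big_split /=; apply: eq_bigr => m _.
    rewrite (deriveM (diff_derivable (fa I)) (diff_derivable (fb J))).
    by rewrite /GRing.scale /=; ring.
  (* The terms that differentiate [b] form $dx_I\wedge db$, up to the position of the new index, and
     vanish with $db$. *)
  rewrite [X in _ * X](_ : _ = 0) ?mulr0 ?addr0.
    rewrite exchange_big /=; apply: eq_bigr => m _.
    have eb : b x = fun B => \sum_J fcoef (b x) J * emon J B.
      by apply/funext => B; exact: fcoefE.
    rewrite {2}eb mwedge_sumr big_distrr /=; apply: eq_bigr => J _.
    rewrite (@mwedge_emon _ _ k.+1) (emon_eq _ (fcons_cat _ _ _)).
    by rewrite mulrCA mulrA.
  rewrite (pair_bigA _ (fun J m => 'D_(delta_mx 0 m) (fun y => fcoef (b y) J) x *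
        emon (fcons m (ord_cat I J)) A)) /=.
  apply: (emon_fcons_cat0 (J := fun p : {ffun 'I_l -> 'I_n} * 'I_n => p.1)) => B.
  rewrite -[RHS](db B) dE // pair_bigA /=.
  by [].
have -> : flatd a x = fun B => \sum_(p : {ffun 'I_k -> 'I_n} * 'I_n)
   'D_(delta_mx 0 p.2) (fun y => fcoef (a y) p.1) x * emon (fcons p.2 p.1) B.
  by apply/funext => B; rewrite dE // pair_bigA.
by rewrite mwedge_suml pair_bigA.
Qed.

End FlatDerivative.

(** * Smooth functions on open sets *)

Section NearDifferentiable.
Variables (R : realType) (V W : normedModType R).

(** The difference vanishes near [x], hence is differentiable there with differential 0, and is
    added to [f]. *)
Lemma near_eq_differentiable (f g : V -> W) x :
  (\near x, f x = g x) -> differentiable f x -> differentiable g x.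
Proof.
move=> fg df; pose h := g - f.
have h0 : \forall y \near x, h y = 0.
  by apply: filterS fg => y fgy; rewrite -[h y]/(g y - f y) fgy subrr.
have hE : h \o shift x = cst (h x) + (\0 : {linear V -> W}) +o_ 0 id.
  apply/eqaddoP => e e0; have : \forall y \near (0 : V), h (y + x) = 0.
    by move: h0; rewrite (near_shift 0) /=; apply: filterS => y /=; rewrite subr0.
  apply: filterS => y hy.
  rewrite /= !fctE /= hy (nbhs_singleton h0) addr0 subr0 normr0.
  by rewrite mulr_ge0 // ltW.
have c0 : continuous (\0 : {linear V -> W}) by apply: cst_continuous.
have dh : differentiable h x.
  by apply/diff_locallyP; rewrite (diff_unique c0 hE).
have -> : g = f + h by rewrite /h addrC subrK.
exact: differentiableD.
Qed.

End NearDifferentiable.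

Section SmoothFunctions.
Variables (R : realType) (V : normedModType R) (O : set V).
Hypothesis oO : open O.

Let nearO x : O x -> \forall y \near x, O y.
Proof. by move=> Ox; apply: open_nbhs_nbhs. Qed.

Lemma Ck_eq (W : normedModType R) k (f g : V -> W) :
  (forall x, O x -> f x = g x) -> Ck k O f -> Ck k O g.
Proof.
elim: k f g => [|k IH] f g fg.
  move=> cf x Ox.
  have fg' : \forall y \near x, f y = g y by apply: filterS (nearO Ox).
  apply: cvg_trans (near_eq_cvg fg') _.
  by rewrite -(fg x Ox); exact: cf.
case=> df Df; split=> [x Ox|v].
  by apply: near_eq_differentiable (df x Ox); apply: filterS (nearO Ox).
apply: IH (Df v) => x Ox; apply: near_eq_derive.
by apply: filterS (nearO Ox).
Qed.

Lemma CkW (W : normedModType R) k (f : V -> W) : Ck k.+1 O f -> Ck k O f.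
Proof.
elim: k f => [|k IH] f [df Df]; first by move=> x /df /differentiable_continuous.
by split=> // v; apply: IH.
Qed.

Lemma Ck_cst (W : normedModType R) k (c : W) : Ck k O (cst c).
Proof.
elim: k c => [|k IH] c; first by move=> x _; exact: cvg_cst.
split=> [x _|v]; first exact: differentiable_cst.
by apply: Ck_eq (IH 0) => x _; rewrite derive_cst.
Qed.

Lemma CkD (W : normedModType R) k (f g : V -> W) :
  Ck k O f -> Ck k O g -> Ck k O (fun x => f x + g x).
Proof.
elim: k f g => [|k IH] f g; first by move=> cf cg x Ox; apply: cvgD; [exact: cf|exact: cg].
case=> df Df [dg Dg]; split=> [x Ox|v].
  by apply: differentiableD; [exact: df|exact: dg].
apply: Ck_eq (IH _ _ (Df v) (Dg v)) => x Ox.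
by rewrite -deriveD //; apply: diff_derivable; [exact: df|exact: dg].
Qed.

Lemma CkM k (f g : V -> R) :
  Ck k O f -> Ck k O g -> Ck k O (fun x => f x * g x).
Proof.
elim: k f g => [|k IH] f g; first by move=> cf cg x Ox; apply: cvgM; [exact: cf|exact: cg].
move=> Cf Cg; have [df Df] := Cf; have [dg Dg] := Cg; split=> [x Ox|v].
  by apply: differentiableM; [exact: df|exact: dg].
apply: Ck_eq (CkD (IH _ _ (CkW Cf) (Dg v)) (IH _ _ (CkW Cg) (Df v))) => x Ox.
by rewrite -deriveM //; apply: diff_derivable; [exact: df|exact: dg].
Qed.

Lemma Ck_entry m n k (f : V -> 'M[R]_(m, n)) i j :
  Ck k O f -> Ck k O (fun x => f x i j).
Proof.
elim: k f => [|k IH] f.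
  move=> cf x Ox.
  apply: (@continuous_comp _ _ _ f (fun N : 'M[R]_(m, n) => N i j)).
    exact: cf.
  exact: coord_continuous.
case=> df Df; split=> [x Ox|v].
    apply: (@differentiable_comp _ _ _ _ f (fun N : 'M[R]_(m, n) => N i j)).
    exact: df.
  exact: differentiable_coord.
apply: Ck_eq (IH _ (Df v)) => x Ox.
by rewrite derive_mx ?mxE //; apply/diff_derivable/df.
Qed.

Lemma smooth_eq (W : normedModType R) (f g : V -> W) :
  (forall x, O x -> f x = g x) -> smooth_on O f -> smooth_on O g.
Proof. by move=> fg sf k; exact: Ck_eq fg (sf k). Qed.

Lemma smooth_cst (W : normedModType R) (c : W) : smooth_on O (fun=> c).
Proof. by move=> k; exact: Ck_cst. Qed.

Lemma smoothD (W : normedModType R) (f g : V -> W) :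
  smooth_on O f -> smooth_on O g -> smooth_on O (fun x => f x + g x).
Proof. by move=> sf sg k; exact: CkD. Qed.

Lemma smoothM (f g : V -> R) :
  smooth_on O f -> smooth_on O g -> smooth_on O (fun x => f x * g x).
Proof. by move=> sf sg k; exact: CkM. Qed.

Lemma smooth_sum (W : normedModType R) (T : Type) (r : seq T) (f : T -> V -> W) :
  (forall t, smooth_on O (f t)) -> smooth_on O (fun x => \sum_(t <- r) f t x).
Proof.
move=> sf; elim: r => [|t r IH].
  by under eq_fun => x do rewrite big_nil; exact: smooth_cst.
by under eq_fun => x do rewrite big_cons; exact: smoothD.
Qed.

Lemma smooth_entry m n (f : V -> 'M[R]_(m, n)) i j :
  smooth_on O f -> smooth_on O (fun x => f x i j).
Proof. by move=> sf k; exact: Ck_entry. Qed.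

Lemma smooth_differentiable (W : normedModType R) (f : V -> W) x :
  smooth_on O f -> O x -> differentiable f x.
Proof. by move=> sf; have [df _] := sf 1%N; exact: df. Qed.

Lemma smooth_mwedge n k l (a : V -> 'M[R]_(k, n) -> R) (b : V -> 'M[R]_(l, n) -> R) A :
  (forall B, smooth_on O (fun x => a x B)) ->
  (forall B, smooth_on O (fun x => b x B)) ->
  smooth_on O (fun x => mwedge (a x) (b x) A).
Proof.
move=> sa sb; apply: smoothM; first exact: smooth_cst.
apply: smooth_sum => s; apply: smoothM; last exact: sb.
by apply: smoothM; [exact: smooth_cst | exact: sa].
Qed.

End SmoothFunctions.

(** * Adapted frames at a point of a Sasakian manifold *)

Section BilinearForm.
Variables (R : realType) (n : nat) (g : 'M[R]_n).
Implicit Types u v w : 'rV[R]_n.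

Definition bform u v : R := (u *m g *m v^T) 0 0.

Lemma bformDl u v w : bform (u + v) w = bform u w + bform v w.
Proof. by rewrite /bform !mulmxDl mxE. Qed.

Lemma bformZl c u w : bform (c *: u) w = c * bform u w.
Proof. by rewrite /bform -!scalemxAl mxE. Qed.

Lemma bformNl u w : bform (- u) w = - bform u w.
Proof. by rewrite -scaleN1r bformZl mulN1r. Qed.

Lemma bformDr u v w : bform u (v + w) = bform u v + bform u w.
Proof. by rewrite /bform linearD mulmxDr mxE. Qed.

Lemma bformZr c u w : bform u (c *: w) = c * bform u w.
Proof. by rewrite /bform linearZ -scalemxAr mxE. Qed.

Lemma bformNr u w : bform u (- w) = - bform u w.
Proof. by rewrite -scaleN1r bformZr mulN1r. Qed.

Lemma bformC : g^T = g -> forall u v, bform u v = bform v u.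
Proof.
move=> gs u v; rewrite /bform.
have -> : u *m g *m v^T = (v *m g *m u^T)^T by rewrite !trmx_mul trmxK gs mulmxA.
by rewrite mxE.
Qed.

(** Orthogonality to the rows of [B] is [m] linear conditions in dimension $n>m$, so a nonzero
    solution exists; it is then rescaled to squared length [c]. *)
Lemma exists_orthogonal m (B : 'M[R]_(m, n)) (c : R) : (m < n)%N -> 0 < c ->
  (forall u, u != 0 -> 0 < bform u u) ->
  exists2 u, bform u u = c & forall i, bform u (row i B) = 0.
Proof.
move=> mn c0 gp; pose K := kermx (g *m B^T).
have K0 : K != 0.
  rewrite kermx_eq0 -row_leq_rank -ltnNge (leq_ltn_trans _ mn) //.
  exact: rank_leq_col.
have [i ri] : exists i, row i K != 0.
  apply/existsP; apply: contraNT K0; rewrite negb_exists => /forallP r0.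
  by apply/eqP/row_matrixP => i; have := r0 i; rewrite negbK row0 => /eqP.
pose v := row i K; have v0 := gp v ri.
exists (Num.sqrt (c / bform v v) *: v).
  rewrite bformZl bformZr mulrA -expr2.
  by rewrite sqr_sqrtr ?divfK ?lt0r_neq0 // ltW // divr_gt0.
move=> j; rewrite bformZl; apply/eqP; rewrite mulf_eq0; apply/orP; right.
have : v *m (g *m B^T) = 0 by rewrite -row_mul mulmx_ker row0.
rewrite mulmxA => /(congr1 (fun X : 'rV_m => X 0 j)); rewrite [RHS]mxE => <-.
by rewrite /bform -row_mul tr_row colE mulmxA -colE mxE.
Qed.

End BilinearForm.

Lemma multialternating_swap (R : realType) n (f : 'M[R]_(1 + 1, n) -> R)
    (u v : 'rV[R]_n) :
  multialternating f -> f (col_mx u v) = - f (col_mx v u).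
Proof.
move=> fA; rewrite -(@multialternating_xrow _ _ _ f (col_mx v u) ord0 ord_max fA) //.
congr f; apply/matrixP => i j.
have -> : xrow ord0 ord_max (col_mx v u) i j = col_mx v u (tperm ord0 ord_max i) j.
  by rewrite /xrow /row_perm !mxE.
have e0 : (ord0 : 'I_(1 + 1)) = lshift 1 ord0 by apply: val_inj.
have e1 : (ord_max : 'I_(1 + 1)) = rshift 1 ord0 by apply: val_inj.
by case: (split_ordP i) => a ->; rewrite (ord1 a);
  [rewrite -e0 tpermL e0 e1 | rewrite -e1 tpermR e0 e1]; rewrite col_mxEu col_mxEd.
Qed.

Lemma multialternating_insert (R : realType) n k (f : 'M[R]_(1 + k, n) -> R)
    (u : 'rV[R]_n) : multialternating f -> multialternating (minsert u f).
Proof.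
case=> fL fA; split; first exact: multilinear_insert.
move=> A i j ij rij; apply: (fA _ (lift ord0 i) (lift ord0 j)).
  by rewrite (inj_eq lift_inj).
by rewrite !row_col_mx_lift.
Qed.

Lemma multialternating_swap23 (R : realType) n (f : 'M[R]_(1 + (1 + 1), n) -> R)
    (u v w : 'rV[R]_n) : multialternating f ->
  f (col_mx u (col_mx v w)) = - f (col_mx u (col_mx w v)).
Proof.
move=> fA; exact: multialternating_swap (multialternating_insert u fA).
Qed.

Lemma multialternating_swap12 (R : realType) n (f : 'M[R]_(1 + (1 + 1), n) -> R)
    (u v w : 'rV[R]_n) : multialternating f ->
  f (col_mx u (col_mx v w)) = - f (col_mx v (col_mx u w)).
Proof.
move=> fA.
have f0 x : f (col_mx x (col_mx x w)) = 0.
  apply: (fA.2 _ ord0 (lift ord0 ord0)) => //.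
  by rewrite row_col_mx_lift !row_col_mx0.
have D1 x y z : f (col_mx (x + y) z) = f (col_mx x z) + f (col_mx y z).
  by rewrite -[x]scale1r -[y]scale1r (multilinear_col_mx _ _ _ _ _ fA.1) !mul1r !scale1r.
have D2 x y z : f (col_mx z (col_mx (x + y) w)) =
    f (col_mx z (col_mx x w)) + f (col_mx z (col_mx y w)).
  have := multilinear_col_mx 1 1 x y w (multilinear_insert z fA.1).
  by rewrite /minsert !scale1r !mul1r.
have := f0 (u + v); rewrite D1 !D2 !f0 add0r addr0 => /eqP.
by rewrite addr_eq0 => /eqP.
Qed.

Lemma multialternating3 (R : realType) n (f : 'M[R]_(1 + (1 + 1), n) -> R)
    (x y z : 'rV[R]_n) : multialternating f ->
  let T (u v w : 'rV[R]_n) := f (col_mx u (col_mx v w)) in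
  ((forall u v, T u u v = 0) * (forall u v, T u v u = 0) *
   (forall u v, T u v v = 0)) *
  ((T y z x = T x y z) * (T z x y = T x y z) * (T x z y = - T x y z) *
   (T y x z = - T x y z) * (T z y x = - T x y z)).
Proof.
move=> fA T.
have s12 u v w : T u v w = - T v u w by apply: multialternating_swap12.
have s23 u v w : T u v w = - T u w v by apply: multialternating_swap23.
have T0 u v : T u u v = 0.
  by apply/eqP; have /eqP := s12 u u v; rewrite -addr_eq0 -mulr2n mulrn_eq0.
have T0' u v : T u v u = 0 by rewrite s23 T0 oppr0.
split; split; do ?split => //.
- by move=> u v; rewrite s12 T0' oppr0.
- by rewrite s23 s12 opprK.
- by rewrite s12 s23 opprK.
- by rewrite s12 s23 s12 !opprK.
Qed.

(* [r + i s] is complex trilinear and alternating in the complex coordinates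
   [x1 + i y1], [x2 + i y2], [x3 + i y3], hence a multiple of their determinant
   [P + i Q]. *)
Lemma complex_volume (R : comRingType) (V : Type) (r s : V -> V -> V -> R)
    (x1 y1 x2 y2 x3 y3 : V -> R) (f1 f2 f3 : V) :
  (forall u v w, r u v w = - r v u w) -> (forall u v w, r u v w = - r u w v) ->
  (forall u v w, s u v w = - s v u w) -> (forall u v w, s u v w = - s u w v) ->
  (forall u v, r u u v = 0) -> (forall u v, s u u v = 0) ->
  (forall u v w, r u v w = (x1 u * r f1 v w - y1 u * s f1 v w) +
     (x2 u * r f2 v w - y2 u * s f2 v w) + (x3 u * r f3 v w - y3 u * s f3 v w)) ->
  (forall u v w, s u v w = (x1 u * s f1 v w + y1 u * r f1 v w) +
     (x2 u * s f2 v w + y2 u * r f2 v w) + (x3 u * s f3 v w + y3 u * r f3 v w)) ->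
  forall u v w,
  let P := x1 u * (x2 v * x3 w - y2 v * y3 w - x3 v * x2 w + y3 v * y2 w)
    - y1 u * (x2 v * y3 w + y2 v * x3 w - x3 v * y2 w - y3 v * x2 w)
    - x2 u * (x1 v * x3 w - y1 v * y3 w - x3 v * x1 w + y3 v * y1 w)
    + y2 u * (x1 v * y3 w + y1 v * x3 w - x3 v * y1 w - y3 v * x1 w)
    + x3 u * (x1 v * x2 w - y1 v * y2 w - x2 v * x1 w + y2 v * y1 w)
    - y3 u * (x1 v * y2 w + y1 v * x2 w - x2 v * y1 w - y2 v * x1 w) in
  let Q := y1 u * (x2 v * x3 w - y2 v * y3 w - x3 v * x2 w + y3 v * y2 w)
    + x1 u * (x2 v * y3 w + y2 v * x3 w - x3 v * y2 w - y3 v * x2 w)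
    - y2 u * (x1 v * x3 w - y1 v * y3 w - x3 v * x1 w + y3 v * y1 w)
    - x2 u * (x1 v * y3 w + y1 v * x3 w - x3 v * y1 w - y3 v * x1 w)
    + y3 u * (x1 v * x2 w - y1 v * y2 w - x2 v * x1 w + y2 v * y1 w)
    + x3 u * (x1 v * y2 w + y1 v * x2 w - x2 v * y1 w - y2 v * x1 w) in
  let c1 := r f1 f2 f3 in let c2 := s f1 f2 f3 in
  r u v w = c1 * P - c2 * Q /\ s u v w = c1 * Q + c2 * P.
Proof.
move=> r12 r23 s12 s23 r0 s0 rl sl u v w P Q c1 c2.
have r0' x y : r x y x = 0 by rewrite r23 r0 oppr0.
have s0' x y : s x y x = 0 by rewrite s23 s0 oppr0.
have r0'' x y : r y x x = 0 by rewrite r12 r0' oppr0.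
have s0'' x y : s y x x = 0 by rewrite s12 s0' oppr0.
have rc x y z : r x y z = r z x y by rewrite r23 r12 opprK.
have sc x y z : s x y z = s z x y by rewrite s23 s12 opprK.
have r312 : r f3 f1 f2 = c1 by rewrite -rc.
have s312 : s f3 f1 f2 = c2 by rewrite -sc.
have r231 : r f2 f3 f1 = c1 by rewrite rc.
have s231 : s f2 f3 f1 = c2 by rewrite sc.
(* The arguments are expanded one at a time: [w] against two basis vectors, then [v] against one,
   and finally [u]. *)
have rw12 : r f1 f2 w = x3 w * c1 - y3 w * c2.
  by rewrite rc rl r0 s0 r0' s0' r312 s312; ring.
have sw12 : s f1 f2 w = x3 w * c2 + y3 w * c1.
  by rewrite sc sl r0 s0 r0' s0' r312 s312; ring.
have rw23 : r f2 f3 w = x1 w * c1 - y1 w * c2.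
  by rewrite rc rl r0 s0 r0' s0' -/c1 -/c2; ring.
have sw23 : s f2 f3 w = x1 w * c2 + y1 w * c1.
  by rewrite sc sl r0 s0 r0' s0' -/c1 -/c2; ring.
have rw31 : r f3 f1 w = x2 w * c1 - y2 w * c2.
  by rewrite rc rl r0 s0 r0' s0' r231 s231; ring.
have sw31 : s f3 f1 w = x2 w * c2 + y2 w * c1.
  by rewrite sc sl r0 s0 r0' s0' r231 s231; ring.
have rv1 : r f1 v w = x2 v * r f1 f2 w - y2 v * s f1 f2 w
    - (x3 v * r f3 f1 w - y3 v * s f3 f1 w).
  rewrite -rc rl r0' s0' (r23 f3 w) (s23 f3 w) (rc f2 w) (sc f2 w).
  by ring.
have sv1 : s f1 v w = x2 v * s f1 f2 w + y2 v * r f1 f2 w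
    - (x3 v * s f3 f1 w + y3 v * r f3 f1 w).
  rewrite -sc sl r0' s0' (r23 f3 w) (s23 f3 w) (rc f2 w) (sc f2 w).
  by ring.
have rv2 : r f2 v w = x3 v * r f2 f3 w - y3 v * s f2 f3 w
    - (x1 v * r f1 f2 w - y1 v * s f1 f2 w).
  rewrite -rc rl r0' s0' (r23 f1 w) (s23 f1 w) (rc f3 w) (sc f3 w).
  by ring.
have sv2 : s f2 v w = x3 v * s f2 f3 w + y3 v * r f2 f3 w
    - (x1 v * s f1 f2 w + y1 v * r f1 f2 w).
  rewrite -sc sl r0' s0' (r23 f1 w) (s23 f1 w) (rc f3 w) (sc f3 w).
  by ring.
have rv3 : r f3 v w = x1 v * r f3 f1 w - y1 v * s f3 f1 w
    - (x2 v * r f2 f3 w - y2 v * s f2 f3 w).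
  rewrite -rc rl r0' s0' (r23 f2 w) (s23 f2 w) (rc f1 w) (sc f1 w).
  by ring.
have sv3 : s f3 v w = x1 v * s f3 f1 w + y1 v * r f3 f1 w
    - (x2 v * s f2 f3 w + y2 v * r f2 f3 w).
  rewrite -sc sl r0' s0' (r23 f2 w) (s23 f2 w) (rc f1 w) (sc f1 w).
  by ring.
rewrite (rl u) (sl u v) rv1 sv1 rv2 sv2 rv3 sv3 rw12 sw12 rw23 sw23 rw31 sw31 /P /Q.
by move: c1 c2 {r312 s312 r231 s231 rw12 sw12 rw23 sw23 rw31 sw31} => c1 c2; split; ring.
Qed.

Lemma sum7E (V : nmodType) (F : 'I_7 -> V) :
  \sum_i F i = F (inord 0) + F (inord 1) + F (inord 2) + F (inord 3) +
     F (inord 4) + F (inord 5) + F (inord 6).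
Proof.
rewrite !big_ord_recr big_ord0 /= add0r.
by do !congr (_ + _); congr F; apply: val_inj; rewrite /= inordK.
Qed.

Section SasakiPoint.
Variables (R : realType) (xi : 'rV[R]_7) (Phi g : 'M[R]_7).
Variables (e : 'M[R]_(1, 7) -> R) (w : 'M[R]_(2, 7) -> R).
Hypothesis eL : multilinear e.
Hypothesis wA : multialternating w.
Hypothesis gs : g^T = g.
Hypothesis exi : e xi = 1.
Hypothesis Phi2 : forall v, v *m Phi *m Phi = - v + e v *: xi.
Hypothesis compat : forall u v,
  bform g (u *m Phi) (v *m Phi) = bform g u v - e u * e v.
Hypothesis metric : forall u v,
  bform g u v = 2^-1 * w (col_mx u (v *m Phi)) + e u * e v.

Lemma e_lin (a b : R) (u v : 'rV[R]_7) : e (a *: u + b *: v) = a * e u + b * e v.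
Proof.
apply: (eL (i := ord0)); first by rewrite !row_id.
  by apply/row'_eqP => -[[]].
by apply/row'_eqP => -[[]].
Qed.

Lemma e_scale (a : R) (u : 'rV[R]_7) : e (a *: u) = a * e u.
Proof.
by have := e_lin a 0 u 0; rewrite scale0r addr0 mul0r addr0.
Qed.

Lemma e_zero : e 0 = 0.
Proof. by rewrite -(scale0r (0 : 'rV_7)) e_scale mul0r. Qed.

(** $\Phi^2\xi=0$, so $\Phi^2=-1+\eta\otimes\xi$ at $\Phi\xi$ gives $\Phi\xi=\lambda\xi$; then
    $\lambda^2\xi=\Phi^2\xi=0$. *)
Lemma xi_Phi : xi *m Phi = 0.
Proof.
have h : xi *m Phi = e (xi *m Phi) *: xi.
  have := Phi2 (xi *m Phi); rewrite (Phi2 xi) exi scale1r addNr mul0mx.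
  by move/esym/eqP; rewrite addrC subr_eq0 => /eqP/esym.
have := Phi2 xi; rewrite h -scalemxAl h scalerA exi scale1r addNr.
move=> /(congr1 e); rewrite e_scale e_zero exi mulr1.
by rewrite e_scale exi mulr1 => /eqP; rewrite mulf_eq0 orbb => /eqP ->; rewrite scale0r.
Qed.

(** $\Phi^3u$ computed in two ways differs by $\eta(\Phi u)\,\xi$. *)
Lemma e_Phi u : e (u *m Phi) = 0.
Proof.
have := Phi2 (u *m Phi); rewrite (Phi2 u) mulmxDl -scalemxAl xi_Phi scaler0 addr0 mulNmx.
rewrite -[LHS]addr0 => /addrI /esym /(congr1 e).
by rewrite e_scale exi mulr1 e_zero.
Qed.

Lemma bform_xi u : bform g u xi = e u.
Proof.
apply/eqP; rewrite -subr_eq0 -[X in _ - X]mulr1 -exi -compat xi_Phi.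
by rewrite /bform trmx0 mulmx0 mxE.
Qed.

Lemma bform_Phi u v : bform g (u *m Phi) v = - bform g u (v *m Phi).
Proof.
have := compat u (v *m Phi); rewrite e_Phi mulr0 subr0 => <-.
by rewrite Phi2 bformDr bformNr bformZr bform_xi e_Phi mulr0 addr0 opprK.
Qed.

(** The metric identity gives $w$ only on pairs $(x,\Phi y)$. The decomposition
    $v=-\Phi^2v+\eta(v)\xi$ reduces every pair to this case and to $w(\xi,\cdot)$, which vanishes by
    the same decomposition. *)
Lemma w_bform (u v : 'rV[R]_7) :
  w (col_mx u v : 'M[R]_(1 + 1, 7)) = 2 * bform g (u *m Phi) v.
Proof.
pose w' (x y : 'rV[R]_7) := w (col_mx x y : 'M[R]_(1 + 1, 7)).
have w'Phi x y : w' x (y *m Phi) = 2 * (bform g x y - e x * e y).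
  by rewrite metric /w'; field.
have w'C x y : w' x y = - w' y x := multialternating_swap x y wA.
have w'L a b x y z : w' z (a *: x + b *: y) = a * w' z x + b * w' z y.
  by rewrite w'C /w' (multilinear_col_mx _ _ _ _ _ wA.1) -!/(w' _ _) !(w'C z); ring.
have w'xx x : w' x x = 0.
  by apply/eqP; have /eqP := w'C x x; rewrite -addr_eq0 -mulr2n mulrn_eq0.
have dec y : y = (-1) *: (y *m Phi *m Phi) + e y *: xi.
  by rewrite Phi2 scaleN1r opprD opprK addrNK.
have w'xi x : w' xi x = 0.
  rewrite [x]dec w'L w'xx w'Phi e_Phi (bformC gs) bform_xi e_Phi.
  by rewrite !mulr0 subrr !mulr0 addr0.
rewrite -/(w' u v) {1}[v]dec w'L [w' u xi]w'C w'xi w'Phi e_Phi bform_Phi.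
by ring.
Qed.

(** Squared length $\frac12$, because $\omega(f,\Phi f)=2g(\Phi f,\Phi f)=2g(f,f)$ has to be 1. *)
Record unitary_triple (f1 f2 f3 : 'rV[R]_7) : Prop := {
  ut_e : [/\ e f1 = 0, e f2 = 0 & e f3 = 0];
  ut_norm : [/\ bform g f1 f1 = 2^-1, bform g f2 f2 = 2^-1 & bform g f3 f3 = 2^-1];
  ut_orth : [/\ bform g f2 f1 = 0, bform g f3 f1 = 0 & bform g f3 f2 = 0];
  ut_orthPhi : [/\ bform g f2 (f1 *m Phi) = 0, bform g f3 (f1 *m Phi) = 0
                 & bform g f3 (f2 *m Phi) = 0]
}.

(** Each vector is chosen orthogonal to $\xi$, to the earlier ones and to their images under $\Phi$:
    at most five conditions in dimension 7. Orthogonality to $\xi$ is $\eta(f)=0$. *)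
Lemma unitary_triple_exists :
  (forall u, u != 0 -> 0 < bform g u u) ->
  exists f1 f2 f3, unitary_triple f1 f2 f3.
Proof.
move=> gp; have h0 : (0 : R) < 2^-1 by rewrite invr_gt0 ltr0n.
have ext (l : seq 'rV[R]_7) : (size l < 7)%N ->
    exists2 u, bform g u u = 2^-1 & forall x, x \in l -> bform g u x = 0.
  move=> sl; pose B : 'M[R]_(size l, 7) := \matrix_(i < size l) l`_i.
  have [u uu uB] := exists_orthogonal B sl h0 gp; exists u => // x xl.
  have lx : (index x l < size l)%N by rewrite index_mem.
  by have := uB (Ordinal lx); rewrite rowK nth_index.
have [f1 n1 o1] := ext [:: xi] isT.
have [f2 n2 o2] := ext [:: xi; f1; f1 *m Phi] isT.
have [f3 n3 o3] := ext [:: xi; f1; f1 *m Phi; f2; f2 *m Phi] isT.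
exists f1, f2, f3; split; split=> //; rewrite -?bform_xi ?o1 ?o2 ?o3 //;
  by rewrite !inE eqxx ?orbT.
Qed.

Lemma bform_xiL u : bform g xi u = e u. Proof. by rewrite (bformC gs) bform_xi. Qed.

Lemma bform_self_Phi u : bform g u (u *m Phi) = 0.
Proof.
apply/eqP; have /eqP := bform_Phi u u; rewrite (bformC gs) -addr_eq0.
by rewrite -mulr2n mulrn_eq0.
Qed.

Section UnitaryFrame.
Variables (f1 f2 f3 : 'rV[R]_7).
Hypothesis U : unitary_triple f1 f2 f3.

Definition unitary_frame : 'M[R]_7 :=
  \matrix_(i < 7) [:: xi; f1; f1 *m Phi; f2; f2 *m Phi; f3; f3 *m Phi]`_i.

Lemma ut_simp : (((e f1 = 0) * (e f2 = 0) * (e f3 = 0) *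
  (bform g f1 f1 = 2^-1) * (bform g f2 f2 = 2^-1) * (bform g f3 f3 = 2^-1)) *
  ((bform g f2 f1 = 0) * (bform g f3 f1 = 0) * (bform g f3 f2 = 0)) *
  ((bform g f1 f2 = 0) * (bform g f1 f3 = 0) * (bform g f2 f3 = 0)) *
  ((bform g f2 (f1 *m Phi) = 0) * (bform g f3 (f1 *m Phi) = 0) *
   (bform g f3 (f2 *m Phi) = 0)) *
  ((bform g f1 (f2 *m Phi) = 0) * (bform g f1 (f3 *m Phi) = 0) *
   (bform g f2 (f3 *m Phi) = 0)))%type.
Proof.
case: U => -[e1 e2 e3] [n1 n2 n3] [q1 q2 q3] [p1 p2 p3].
by do !split=> //; rewrite (bformC gs) // bform_Phi ?p1 ?p2 ?p3 oppr0.
Qed.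

Let F := unitary_frame.

Let bFF i j : (F *m g *m F^T) i j = bform g (row i F) (row j F).
Proof. by rewrite /bform -delta_bilinE !rowE trmx_mul !mulmxA. Qed.

Let bsimp := (ut_simp, bform_xi, bform_xiL, compat, e_Phi, exi, bform_Phi, bform_self_Phi,
  xi_Phi, Phi2, bformDl, bformDr, bformNl, bformNr, bformZl, bformZr).

Lemma unitary_frame_gram :
  F *m g *m F^T = diag_mx (\row_j (if j == ord0 then 1 else 2^-1)).
Proof.
apply/matrixP => i j; rewrite bFF !rowK mxE mxE.
by case: i => -[|[|[|[|[|[|[|//]]]]]]] ?; case: j => -[|[|[|[|[|[|[|//]]]]]]] ? /=;
  rewrite !bsimp ?(mulr0, mul0r, subr0, oppr0).
Qed.

Lemma unitary_frame_unit : F \in unitmx.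
Proof.
have := congr1 determinant unitary_frame_gram.
rewrite !det_mulmx det_diag => dF; rewrite unitmxE unitfE.
apply/eqP => F0; move/eqP: dF; rewrite F0 !mul0r eq_sym; apply/negP.
by apply/prodf_neq0 => j _; rewrite mxE; case: ifP; rewrite ?oner_eq0 // invr_eq0 pnatr_eq0.
Qed.

Lemma unitary_frame_row (a : 'rV[R]_7) : a *m F =
  a 0 (inord 0) *: xi + a 0 (inord 1) *: f1 + a 0 (inord 2) *: (f1 *m Phi) +
  a 0 (inord 3) *: f2 + a 0 (inord 4) *: (f2 *m Phi) +
  a 0 (inord 5) *: f3 + a 0 (inord 6) *: (f3 *m Phi).
Proof. by rewrite mulmx_sum_row sum7E !rowK !inordK. Qed.

Lemma unitary_frame_e : in_frame F e feta.
Proof.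
move=> A; rewrite -bform_xi unitary_frame_row !(bformDl, bformZl) !bsimp /ev big_seq1 mon1E.
by ring.
Qed.

Lemma unitary_frame_w : in_frame F w fom.
Proof.
suff H (a b : 'rV[R]_7) : w ((col_mx a b : 'M[R]_(1 + 1, 7)) *m F) =
    @ev R 6 (1 + 1) fom (col_mx a b) by move=> A; rewrite [A]col_mx_row; exact: H.
rewrite mul_col_mx w_bform !unitary_frame_row /ev !big_cons big_nil !mon2E.
rewrite !mulmxDl -!scalemxAl !Phi2 xi_Phi !ut_simp !scale0r !addr0 scaler0 add0r.
rewrite !(bformDl, bformZl, bformNl) !(bformDr, bformZr) !bsimp /=.
by field.
Qed.

Lemma unitary_frame_col k (f : 'M[R]_(k.+1, 7) -> R) (a : 'rV[R]_7) A :
  multilinear f -> let T (u : 'rV[R]_7) := f (col_mx u A : 'M[R]_(1 + k, 7)) in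
  T (a *m F) = a 0 (inord 0) * T xi +
    (a 0 (inord 1) * T f1 + a 0 (inord 2) * T (f1 *m Phi)) +
    (a 0 (inord 3) * T f2 + a 0 (inord 4) * T (f2 *m Phi)) +
    (a 0 (inord 5) * T f3 + a 0 (inord 6) * T (f3 *m Phi)).
Proof.
move=> fL T; rewrite /T mulmx_sum_row multilinear_col_mx_sum // sum7E.
by rewrite !rowK !inordK //= !addrA.
Qed.

Section Volume.
Variables r i : 'M[R]_(1 + (1 + 1), 7) -> R.
Hypotheses (rA : multialternating r) (iA : multialternating i).
Hypotheses (rxi : forall A, r (col_mx xi A) = 0) (ixi : forall A, i (col_mx xi A) = 0).
Hypothesis rPhi : forall u A, e u = 0 -> r (col_mx (u *m Phi) A) = - i (col_mx u A).
Hypothesis iPhi : forall u A, e u = 0 -> i (col_mx (u *m Phi) A) = r (col_mx u A).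

Let c1 := r (col_mx f1 (col_mx f2 f3)).
Let c2 := i (col_mx f1 (col_mx f2 f3)).

(** The hypotheses say $\Upsilon(\xi,\cdot)=0$ and $\Upsilon(\Phi u,\cdot)=i\,\Upsilon(u,\cdot)$ on
    $\ker\eta$. Coordinates 1, 3, 5 thus act as real parts and 2, 4, 6 as imaginary parts,
    [complex_volume] applies, and $c_1+ic_2$ is the value of $\Upsilon$ on the triple. *)
Lemma unitary_frame_vol A :
  r (A *m F) = c1 * ev fre A - c2 * ev fim A /\
  i (A *m F) = c1 * ev fim A + c2 * ev fre A.
Proof.
suff H (a b c : 'rV[R]_7) : let X : 'M[R]_(1 + (1 + 1), 7) := col_mx a (col_mx b c) in
    r (X *m F) = c1 * ev fre X - c2 * ev fim X /\
    i (X *m F) = c1 * ev fim X + c2 * ev fre X.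
  rewrite [A]col_mx_row; have -> : row' ord0 A =
    (col_mx (row ord0 (row' ord0 A)) (row' ord0 (row' ord0 A)) : 'M[R]_(1 + 1, 7)).
    exact: (@col_mx_row _ _ 1).
  exact: H.
pose T (f : 'M[R]_(1 + (1 + 1), 7) -> R) (u v w' : 'rV[R]_7) :=
  f (col_mx (u *m F) (col_mx (v *m F) (w' *m F))).
pose X k (u : 'rV[R]_7) := u 0 (inord k).
pose d k : 'rV[R]_7 := delta_mx 0 (inord k).
have dF k : (k < 7)%N -> d k *m F =
    [:: xi; f1; f1 *m Phi; f2; f2 *m Phi; f3; f3 *m Phi]`_k.
  by move=> lk; rewrite -rowE rowK inordK.
have rl u v z : T r u v z =
    (X 1%N u * T r (d 1%N) v z - X 2%N u * T i (d 1%N) v z) +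
    (X 3%N u * T r (d 3%N) v z - X 4%N u * T i (d 3%N) v z) +
    (X 5%N u * T r (d 5%N) v z - X 6%N u * T i (d 5%N) v z).
  rewrite /T (unitary_frame_col _ _ rA.1) rxi !rPhi ?ut_simp //.
  by rewrite mulr0 add0r !mulrN !dF.
have il u v z : T i u v z =
    (X 1%N u * T i (d 1%N) v z + X 2%N u * T r (d 1%N) v z) +
    (X 3%N u * T i (d 3%N) v z + X 4%N u * T r (d 3%N) v z) +
    (X 5%N u * T i (d 5%N) v z + X 6%N u * T r (d 5%N) v z).
  rewrite /T (unitary_frame_col _ _ iA.1) ixi !iPhi ?ut_simp //.
  by rewrite mulr0 add0r !dF.
have r12 u v z : T r u v z = - T r v u z by apply: multialternating_swap12.
have r23 u v z : T r u v z = - T r u z v by apply: multialternating_swap23.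
have i12 u v z : T i u v z = - T i v u z by apply: multialternating_swap12.
have i23 u v z : T i u v z = - T i u z v by apply: multialternating_swap23.
have r0 u v : T r u u v = 0 by rewrite /T (multialternating3 _ _ _ rA).
have i0 u v : T i u u v = 0 by rewrite /T (multialternating3 _ _ _ iA).
have [H1 H2] := complex_volume r12 r23 i12 i23 r0 i0 rl il a b c.
rewrite /= !mul_col_mx -/(T r a b c) -/(T i a b c) H1 H2.
rewrite /T !dF //= -/c1 -/c2 /X /ev !big_cons big_nil !mon3E /=.
by split; rewrite -[(-1)%:~R]/(-1); ring.
Qed.

End Volume.

End UnitaryFrame.

Section Volume.
Variables r i : 'M[R]_(1 + (1 + 1), 7) -> R.
Hypotheses (rA : multialternating r) (iA : multialternating i).
Hypotheses (rxi : forall A, r (col_mx xi A) = 0) (ixi : forall A, i (col_mx xi A) = 0).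
Hypothesis rPhi : forall u A, e u = 0 -> r (col_mx (u *m Phi) A) = - i (col_mx u A).
Hypothesis iPhi : forall u A, e u = 0 -> i (col_mx (u *m Phi) A) = r (col_mx u A).
Hypothesis vol_norm : forall A : 'M[R]_(6, 7),
  6^-1 * @mwedge _ _ _ 2 4 w (@mwedge _ _ _ 2 2 w w) A =
  8^-1 * (@mwedge _ _ _ 3 3 r i A - @mwedge _ _ _ 3 3 i r A).

(** On the six transverse vectors of the frame $\omega^3/3!$ equals 1, while the other side of the
    norm identity is $\frac18(4+4)(c_1^2+c_2^2)$. *)
Lemma volume_unit f1 f2 f3 : unitary_triple f1 f2 f3 ->
  r (col_mx f1 (col_mx f2 f3)) ^+ 2 + i (col_mx f1 (col_mx f2 f3)) ^+ 2 = 1.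
Proof.
move=> U; pose F := unitary_frame f1 f2 f3.
set c1 := r _; set c2 := i _.
have rF : (fun B => r (B *m F)) = fun B => c1 * ev fre B + (- c2) * ev fim B.
  by apply/funext => B; rewrite (unitary_frame_vol U rA iA rxi ixi rPhi iPhi B).1 mulNr.
have iF : (fun B => i (B *m F)) = fun B => c1 * ev fim B + c2 * ev fre B.
  by apply/funext => B; rewrite (unitary_frame_vol U rA iA rxi ixi rPhi iPhi B).2.
have wF := unitary_frame_w U.
(* The shift [k.+1] leaves out $\xi$, the vector of index 0. *)
have := vol_norm (rowsub (fun k : 'I_6 => inord k.+1) 1%:M *m F).
set A := rowsub _ _.
rewrite (in_frame_wedge _ wF (in_frame_wedge _ wF wF)) // (feqP _ fom_fom_fom).
rewrite !mwedge_mulmx rF iF !mwedgeDl !mwedgeDr !mwedgeZl !mwedgeZr !mwedge_ev //.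
rewrite (feqP _ fre_fim) (feqP _ fim_fre) (feqP _ fre_fre) (feqP _ fim_fim).
rewrite /ev !big_seq1 !big_nil.
have -> : mon (iota 1 6) A = 1.
  rewrite /mon /emon -(det1 _ 6); congr (\det _); apply/matrixP => k l.
  rewrite !mxE nth_iota // -(inj_eq val_inj) /= !inordK ?ltnS //.
    exact: (ltn_ord l).
  exact: (ltn_ord k).
rewrite /= (_ : (4 : int)%:~R = 4) // (_ : (-4 : int)%:~R = - 4) // => H.
transitivity (6^-1 * (6%:~R * 1) : R); first by rewrite H; field.
by rewrite mulr1 mulVf // pnatr_eq0.
Qed.

(** $\Phi$ acts as $i$ on $\ker\eta$, so the first vector is multiplied by the unit complex number
    $c_1-ic_2$, which respects all Hermitian relations. *)
Lemma unitary_triple_rotate f1 f2 f3 c1 c2 :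
  unitary_triple f1 f2 f3 -> c1 ^+ 2 + c2 ^+ 2 = 1 ->
  unitary_triple (c1 *: f1 + (- c2) *: (f1 *m Phi)) f2 f3.
Proof.
move=> U c12; split; split; rewrite ?(ut_simp U) //.
- by rewrite -bform_xi bformDl !bformZl !bform_xi (ut_simp U) e_Phi !mulr0 addr0.
- rewrite !(bformDl, bformZl) !(bformDr, bformZr) bform_self_Phi compat bform_Phi.
  rewrite bform_self_Phi !(ut_simp U) -[RHS]mul1r -c12.
  by ring.
- by rewrite bformDr !bformZr !(ut_simp U); ring.
- by rewrite bformDr !bformZr !(ut_simp U); ring.
- rewrite mulmxDl -!scalemxAl Phi2 !(bformDr, bformZr, bformNr) !(ut_simp U).
  by rewrite bform_xi (ut_simp U); ring.
- rewrite mulmxDl -!scalemxAl Phi2 !(bformDr, bformZr, bformNr) !(ut_simp U).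
  by rewrite bform_xi (ut_simp U); ring.
Qed.

(* [Upsilon] takes on a unitary triple a value of modulus 1, which becomes 1 when
   the first vector is rotated by the opposite phase. *)
Lemma su3_frame_exists : (forall u, u != 0 -> 0 < bform g u u) ->
  exists F, su3_frame e w r i F.
Proof.
move=> gp; have [f1 [f2 [f3 U]]] := unitary_triple_exists gp.
have c12 := volume_unit U; set c1 := r _ in c12; set c2 := i _ in c12.
have U' := unitary_triple_rotate U c12.
have E (f : 'M[R]_(1 + (1 + 1), 7) -> R) : multialternating f ->
    f (col_mx (c1 *: f1 + (- c2) *: (f1 *m Phi)) (col_mx f2 f3)) =
    c1 * f (col_mx f1 (col_mx f2 f3)) - c2 * f (col_mx (f1 *m Phi) (col_mx f2 f3)).
  by move=> fA; rewrite (multilinear_col_mx _ _ _ _ _ fA.1) mulNr.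
exists (unitary_frame (c1 *: f1 + (- c2) *: (f1 *m Phi)) f2 f3); split.
- exact: unitary_frame_unit U'.
- exact: unitary_frame_e U'.
- exact: unitary_frame_w U'.
- move=> A; rewrite (unitary_frame_vol U' rA iA rxi ixi rPhi iPhi A).1 !E //.
  rewrite rPhi ?iPhi ?(ut_simp U) // -/c1 -/c2.
  have -> : c1 * c1 - c2 * - c2 = 1 by rewrite -c12; ring.
  have -> : c1 * c2 - c2 * c1 = 0 by ring.
  by rewrite mul1r mul0r subr0.
- move=> A; rewrite (unitary_frame_vol U' rA iA rxi ixi rPhi iPhi A).2 !E //.
  rewrite rPhi ?iPhi ?(ut_simp U) // -/c1 -/c2.
  have -> : c1 * c1 - c2 * - c2 = 1 by rewrite -c12; ring.
  have -> : c1 * c2 - c2 * c1 = 0 by ring.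
  by rewrite mul1r mul0r addr0.
Qed.

End Volume.

End SasakiPoint.

(** * Differential forms on a manifold and on its cone *)

Section Charts.
Variables (R : realType) (n : nat) (M : topologicalType) (S : atlas R n M).
Hypothesis sm : smooth_manifold S.

Definition chart_img p : set 'rV[R]_n := chart S p @` chart_dom S p.

Lemma open_chart_img p : open (chart_img p).
Proof. exact: sm_open_img. Qed.

Lemma near_chart_img p x : chart_img p x -> \forall y \near x, chart_img p y.
Proof. by move=> px; apply: open_nbhs_nbhs; split=> //; exact: open_chart_img. Qed.

Lemma chart_img_center p : chart_img p (chart S p p).
Proof. by exists p => //; exact: sm_center. Qed.

Lemma chart_imgP p x : chart_img p x ->
  chart_dom S p (chart_inv S p x) /\ chart S p (chart_inv S p x) = x.
Proof. by case=> q dq <-; rewrite sm_toK. Qed.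

Lemma chart_inv_center p : chart_inv S p (chart S p p) = p.
Proof. by rewrite sm_toK //; exact: sm_center. Qed.

Lemma differentiable_transition p q x : chart_img p x ->
  chart_dom S q (chart_inv S p x) ->
  differentiable (chart S q \o chart_inv S p) x.
Proof.
move=> px dq; have [dp cx] := chart_imgP px.
have := sm_transition sm p q => /(_ 1%N) [+ _]; apply.
by exists (chart_inv S p x).
Qed.

Lemma mul_jac_from p x v : chart_img p x ->
  v *m jac_from S p x = 'D_v (chart S (chart_inv S p x) \o chart_inv S p) x.
Proof.
move=> px; rewrite deriveEjacobian //; apply: differentiable_transition => //.
exact: sm_center.
Qed.

Lemma jac_from_center p : jac_from S p (chart S p p) = 1%:M.
Proof.
apply/row_matrixP => i; rewrite rowE mul_jac_from; last exact: chart_img_center.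
rewrite chart_inv_center rowE mulmx1.
rewrite (@near_eq_derive _ _ _ _ id); first by rewrite derive_id.
by apply: filterS (near_chart_img (chart_img_center p)) => y /chart_imgP [].
Qed.

(** Chain rule: the two transition maps compose to the identity near the centre of the preferred
    chart. *)
Lemma jac_to_from p x : chart_img p x ->
  jac_to S p x *m jac_from S p x = 1%:M.
Proof.
move=> px; have [dp cx] := chart_imgP px; set q := chart_inv S p x.
have qq : chart_img q (chart S q q) := chart_img_center q.
have d1 : differentiable (chart S p \o chart_inv S q) (chart S q q).
  by apply: differentiable_transition => //; rewrite chart_inv_center.
have x1 : (chart S p \o chart_inv S q) (chart S q q) = x.
  by rewrite /= chart_inv_center.
have d2 : differentiable (chart S q \o chart_inv S p) x.
  by apply: differentiable_transition => //; exact: sm_center.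
apply/row_matrixP => i; rewrite row_mul [row i (jac_to _ _ _)]rowE.
rewrite mul_jac_from // -/q /jac_to -/q -deriveEjacobian //.
rewrite !deriveE // -x1 -[LHS]/(('d _ _ \o 'd _ _) _).
rewrite -diff_comp //; last by rewrite x1.
rewrite -deriveE; last by apply: differentiable_comp; rewrite ?x1.
rewrite (@near_eq_derive _ _ _ _ id); first by rewrite derive_id rowE mulmx1.
have N1 := near_chart_img qq.
have N2 : \forall y \near chart S q q, chart_dom S p (chart_inv S q y).
  apply: (sm_inv_cont sm qq); rewrite chart_inv_center.
  by apply: open_nbhs_nbhs; split=> //; exact: sm_open_dom.
apply: filterS2 N1 N2 => y /chart_imgP[_ yq] yp /=.
by rewrite sm_toK.
Qed.

Lemma fcoord_alternating k (a : dform R n M R k) p x :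
  (forall q, multialternating (a q)) -> multialternating (fcoord S p a x).
Proof. by move=> aA; exact: (multialternating_mulmx _ (aA _)). Qed.

Lemma fcoord_center k (a : dform R n M R k) p : fcoord S p a (chart S p p) = a p.
Proof.
apply/funext => A; rewrite /fcoord jac_from_center mulmx1.
by rewrite chart_inv_center.
Qed.

Lemma fcoord_wedge k l (a : dform R n M R k) (b : dform R n M R l) p x :
  fcoord S p (wedge a b) x = mwedge (fcoord S p a x) (fcoord S p b x).
Proof. by apply/funext => A; rewrite /fcoord /wedge mwedge_mulmx. Qed.

Lemma dextE k (a : dform R n M R k) p :
  dext S a p = flatd (fcoord S p a) (chart S p p).
Proof. by []. Qed.

Lemma smooth_form_differentiable k (a : dform R n M R k) p A :
  smooth_form S a -> differentiable (fun x => fcoord S p a x A) (chart S p p).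
Proof.
by case=> _ sa; apply: (smooth_differentiable (sa p A)); exact: chart_img_center.
Qed.

Lemma dext_wedge k l (a : dform R n M R k) (b : dform R n M R l) p A :
  smooth_form S a -> smooth_form S b -> (forall B, dext S b p B = 0) ->
  @dext R n M S (k + l) (wedge a b) p A =
  @mwedge R n R k.+1 l (dext S a p) (b p) A.
Proof.
move=> sa sb db; rewrite !dextE -[b p]fcoord_center.
rewrite -flatd_wedge //.
- by rewrite (funext (fcoord_wedge a b p)).
- by move=> y; apply: fcoord_alternating; exact: sa.1.
- by move=> y; apply: fcoord_alternating; exact: sb.1.
- by move=> B; exact: smooth_form_differentiable.
- by move=> B; exact: smooth_form_differentiable.
Qed.

Lemma multialternating_wedge k l (a : 'M[R]_(k, n) -> R) (b : 'M[R]_(l, n) -> R) :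
  multialternating a -> multialternating b -> multialternating (mwedge a b).
Proof.
move=> aA bA.
have E := mwedge_fcoef _ aA bA.
split.
  move=> A B C i x y rA rB rC; rewrite !E !big_distrr -big_split /=.
  apply: eq_bigr => p _; have [L _] := @emon_alternating R n _ (ord_cat p.1 p.2).
  by rewrite (L _ _ _ _ _ _ rA rB rC); ring.
move=> A i j ij rij; rewrite E big1 // => p _.
have [_ L] := @emon_alternating R n _ (ord_cat p.1 p.2).
by rewrite (L _ _ _ ij rij) mulr0.
Qed.

Lemma smooth_form_wedge k l (a : dform R n M R k) (b : dform R n M R l) :
  smooth_form S a -> smooth_form S b -> smooth_form S (wedge a b).
Proof.
move=> sa sb; split.
  by move=> p; apply: multialternating_wedge; [exact: sa.1 | exact: sb.1].
move=> p A; apply: (@smooth_eq _ _ _ (@open_chart_img p) _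
  (fun x => mwedge (fcoord S p a x) (fcoord S p b x) A)).
  by move=> x _; rewrite -fcoord_wedge.
apply: smooth_mwedge; first exact: open_chart_img.
  exact: sa.2.
exact: sb.2.
Qed.

Lemma multialternating_lin k (c d : R) (a b : 'M[R]_(k, n) -> R) :
  multialternating a -> multialternating b ->
  multialternating (fun A => c * a A + d * b A).
Proof.
case=> aL aA [bL bA]; split.
  move=> A B C i x y rA rB rC.
  by rewrite (aL _ _ _ _ _ _ rA rB rC) (bL _ _ _ _ _ _ rA rB rC); ring.
by move=> A i j ij rij; rewrite (aA _ _ _ ij rij) (bA _ _ _ ij rij) !mulr0 addr0.
Qed.

Lemma smooth_form_lin k (c d : R) (a b : dform R n M R k) :
  smooth_form S a -> smooth_form S b ->
  smooth_form S (fadd (fscale (fun=> c) a) (fscale (fun=> d) b)).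
Proof.
case=> aA aS [bA bS]; split; first by move=> p; exact: multialternating_lin.
move=> p A; apply: smoothD; first exact: open_chart_img.
  by apply: smoothM; [exact: open_chart_img | apply: smooth_cst; exact: open_chart_img | exact: aS].
by apply: smoothM; [exact: open_chart_img | apply: smooth_cst; exact: open_chart_img | exact: bS].
Qed.

Lemma dext_lin k (c d : R) (a b : dform R n M R k) p A :
  smooth_form S a -> smooth_form S b ->
  dext S (fadd (fscale (fun=> c) a) (fscale (fun=> d) b)) p A =
  c * dext S a p A + d * dext S b p A.
Proof.
move=> sa sb; rewrite /dext !big_distrr -big_split /=; apply: eq_bigr => i _.
have da : derivable (fun x => fcoord S p a x (row' i A)) (chart S p p) (row i A).
  by apply: diff_derivable; exact: smooth_form_differentiable.
have db : derivable (fun x => fcoord S p b x (row' i A)) (chart S p p) (row i A).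
  by apply: diff_derivable; exact: smooth_form_differentiable.
rewrite (_ : (fun x => fcoord S p _ x _) =
   c \*: (fun x => fcoord S p a x (row' i A)) +
   d \*: (fun x => fcoord S p b x (row' i A))) //.
rewrite deriveD; [|exact: derivableZ|exact: derivableZ].
by rewrite !deriveZ // /GRing.scale /=; ring.
Qed.

Lemma dext_scale k (c : R) (a : dform R n M R k) p A :
  smooth_form S a -> dext S (fscale (fun=> c) a) p A = c * dext S a p A.
Proof.
move=> sa; have := dext_lin c 0 p A sa sa; rewrite mul0r addr0 => <-.
congr (dext S _ p A); apply/funext => q; apply/funext => B.
by rewrite /fadd /fscale mul0r addr0.
Qed.

Lemma dext0 k (a : dform R n M R k) p A :
  (forall q B, a q B = 0) -> dext S a p A = 0.
Proof.
move=> a0; rewrite /dext big1 // => i _.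
rewrite (_ : (fun x => fcoord S p a x _) = cst 0); last by apply/funext => x; exact: a0.
by rewrite derive_cst mulr0.
Qed.

Lemma dext_alternating k (a : dform R n M R k) p :
  smooth_form S a -> multialternating (dext S a p).
Proof.
move=> sa; pose h (I : {ffun 'I_k -> 'I_n}) x := fcoef (fcoord S p a x) I.
have E A : dext S a p A = \sum_I \sum_m
    'D_(delta_mx 0 m) (h I) (chart S p p) * emon (fcons m I) A.
  apply: flatd_sum => [y B|I].
    by apply: fcoefE; apply: fcoord_alternating; exact: sa.1.
  by apply: differentiableZ; exact: smooth_form_differentiable.
split.
  move=> A B C i x y rA rB rC; rewrite !E !big_distrr -big_split /=.
  apply: eq_bigr => I _; rewrite !big_distrr -big_split /=; apply: eq_bigr => m _.
  have [L _] := @emon_alternating R n _ (fcons m I).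
  by rewrite (L _ _ _ _ _ _ rA rB rC); ring.
move=> A i j ij rij; rewrite E big1 // => I _; rewrite big1 // => m _.
have [_ L] := @emon_alternating R n _ (fcons m I).
by rewrite (L _ _ _ ij rij) mulr0.
Qed.

End Charts.

Section Derivatives.
Variable R : realType.

Lemma differentiable_entries (V : normedModType R) n (f : V -> 'rV[R]_n) x :
  (forall j, differentiable (fun y => f y 0 j) x) -> differentiable f x.
Proof.
move=> fj; have -> : f = \sum_(j < n) (fun y => f y 0 j *: delta_mx 0 j).
  by apply/funext => y; rewrite fct_sumE -row_sum_delta.
by apply: differentiable_sum => j; exact: differentiableZl.
Qed.

(** The difference quotients agree term by term along the line. Only values of [f] on the image of
    [io] enter, as suits a form known on a slice alone. *)
Lemma derive_line (V W U : normedModType R) (f : W -> U) (h : V -> U)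
    (io : V -> W) x v v' :
  (forall t, io (t *: v + x) = t *: v' + io x) ->
  (\near x, f (io x) = h x) -> 'D_v' f (io x) = 'D_v h x.
Proof.
move=> ioE fh; rewrite -(@near_eq_derive _ _ _ (f \o io) h) // /derive.
have -> // : (fun t : R => t^-1 *: (((f \o io) \o shift x) (t *: v) - (f \o io) x)) =
  (fun t => t^-1 *: ((f \o shift (io x)) (t *: v') - f (io x))).
by apply/funext => t /=; rewrite ioE.
Qed.

End Derivatives.

Section ConeForms.
Variables (R : realType) (M : topologicalType) (S : atlas R 7 M).
Hypothesis sm : smooth_manifold S.

(** The slice $r=1$ of the cone, in coordinates. *)
Let io (y : 'rV[R]_7) : 'rV[R]_(1 + 7) := row_mx 1%:M y.

Let io_line t v y : io (t *: v + y) = t *: row_mx 0 v + io y.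
Proof. by rewrite /io scale_row_mx scaler0 add_row_mx add0r. Qed.

Lemma cone_chart_inv p (y : 'rV[R]_7) :
  chart_inv (cone_atlas S) (1, p) (io y) = (1, chart_inv S p y).
Proof. by rewrite /= row_mxKl row_mxKr mxE eqxx. Qed.

(** A transition map of the cone is the identity in $r$ times a transition map of $M$, so it
    preserves vectors tangent to the slice. *)
Lemma cone_jac_from p (y v : 'rV[R]_7) : chart_img S p y ->
  row_mx 0 v *m jac_from (cone_atlas S) (1, p) (io y) =
  row_mx 0 (v *m jac_from S p y).
Proof.
move=> py; set q := chart_inv S p y.
pose T := chart S q \o chart_inv S p.
have dT : differentiable T y.
  by apply: differentiable_transition => //; exact: sm_center.
rewrite (mul_jac_from sm) // -/q -/T /jac_from cone_chart_inv -/q.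
set F := _ \o _.
have FE x : F x = row_mx (lsubmx x 0 0)%:M (T (rsubmx x)) by [].
have dF : differentiable F (io y).
  apply: differentiable_entries => j; case: (split_ordP j) => i ->.
    rewrite (_ : (fun x => _) = fun N : 'rV[R]_(1 + 7) => N 0 (lshift 7 i)).
      exact: differentiable_coord.
    by apply/funext => x; rewrite FE row_mxEl !mxE !ord1 eqxx mulr1n.
  rewrite (_ : (fun x => _) = fun x => T (rsubmx x) 0 i); last first.
    by apply/funext => x; rewrite FE row_mxEr.
  apply: (@differentiable_comp _ _ _ _ (fun x => T (rsubmx x)) (fun N : 'rV_7 => N 0 i)).
    apply: differentiable_comp; first exact: differentiable_rsubmx.
    by rewrite row_mxKr.
  exact: differentiable_coord.
rewrite -deriveEjacobian //.
rewrite (@derive_line _ _ _ _ F (fun x => row_mx 1%:M (T x)) io y v); first last.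
- by apply: filterS (near_chart_img sm py) => x _; rewrite FE row_mxKl row_mxKr mxE eqxx.
- by move=> t; exact: io_line.
rewrite derive_mx; last first.
  apply/diff_derivable/differentiable_entries => j.
  case: (split_ordP j) => i ->.
    rewrite (_ : (fun x => _) = cst ((1%:M : 'M[R]_1) 0 i)).
      exact: differentiable_cst.
    by apply/funext => x; rewrite row_mxEl.
  rewrite (_ : (fun x => _) = fun x => T x 0 i); last first.
    by apply/funext => x; rewrite row_mxEr.
  apply: (@differentiable_comp _ _ _ _ T (fun N : 'rV_7 => N 0 i)) => //.
  exact: differentiable_coord.
apply/rowP => j; rewrite mxE; case: (split_ordP j) => i ->.
  rewrite row_mxEl mxE (_ : (fun x => _) = cst ((1%:M : 'M[R]_1) 0 i)).
    exact: derive_cst.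
  by apply/funext => x; rewrite row_mxEl.
rewrite row_mxEr (_ : (fun x => _) = fun x => T x 0 i); last first.
  by apply/funext => x; rewrite row_mxEr.
by rewrite derive_mx ?mxE //; exact: diff_derivable.
Qed.

(** Restriction to the slice commutes with $d$: every direction of differentiation and every
    argument is tangent to $r=1$. *)
Lemma dext_cone (b : dform R (1 + 7) (R * M) R 2) (w : dform R 7 M R 2) p B :
  (forall q C, b (1, q) (row_mx 0 C) = w q C) ->
  dext (cone_atlas S) b (1, p) (row_mx 0 B) = dext S w p B.
Proof.
move=> bw; rewrite /dext; apply: eq_bigr => i _; congr (_ * _).
rewrite row_row_mx row0.
have -> : chart (cone_atlas S) (1, p) (1, p) = io (chart S p p) by [].
apply: derive_line => [t|]; first exact: io_line.
apply: filterS (near_chart_img sm (chart_img_center sm p)) => y py.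
rewrite /fcoord cone_chart_inv -bw; congr b.
apply/row_matrixP => k; rewrite row_mul row_row_mx.
have -> : row k (row' i (row_mx (0 : 'M[R]_(3, 1)) B)) = row_mx 0 (row k (row' i B)).
  by apply/rowP => l; rewrite !mxE; case: splitP => m _; rewrite !mxE.
rewrite cone_jac_from // row0 row_mul.
by [].
Qed.

End ConeForms.

(** * Smoothness and closedness of $d\eta$ on a Sasakian manifold *)

Section SasakianForms.
Variables (R : realType) (M : topologicalType) (S : atlas R 7 M).
Variables (xi : vfield R 7 M) (eta : dform R 7 M R 1).
Variables (Phi : endo R 7 M) (g : metric R 7 M).
Hypothesis sm : smooth_manifold S.
Hypothesis sas : sasakian S xi eta Phi g.

Let om := dext S eta.

Let etaL p : multilinear (eta p). Proof. exact: ((sas_eta sas).1 p).1. Qed.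
Let omA p : multialternating (om p).
Proof. exact: dext_alternating (sas_eta sas). Qed.
Let gs p : (g p)^T = g p. Proof. by have [_ + _] := sas_g sas; apply. Qed.

Lemma sasakian_om p (u v : 'rV[R]_7) :
  om p (col_mx u v : 'M[R]_(1 + 1, 7)) = 2 * bform (g p) (u *m Phi p) v.
Proof.
exact: (w_bform (etaL p) (omA p) (gs p) (sas_reeb sas p) (sas_Phi2 sas p)
  (sas_compat sas p) (sas_metric sas p)).
Qed.

Lemma col_mx2 (C : 'M[R]_(2, 7)) :
  C = (col_mx (row ord0 C) (row ord_max C) : 'M[R]_(1 + 1, 7)).
Proof.
apply: etrans (col_mx_row C) _; apply: f_equal2 => //; apply/rowP => j; rewrite !mxE.
by congr (C _ _); apply: val_inj.
Qed.

Lemma cone_fundamental_form q (C : 'M[R]_(2, 7)) :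
  fundamental_form (cone_metric g) (cone_J xi eta Phi) (1, q) (row_mx 0 C) =
  2^-1 * om q C.
Proof.
rewrite [in RHS](col_mx2 C) sasakian_om mulrA mulVf ?pnatr_eq0 // mul1r.
rewrite /fundamental_form !row_row_mx !row0.
rewrite /cone_J /inner /cone_metric /= mul_row_block !mul0mx !add0r.
rewrite mul_row_block !mulmx0 mulmx1 addr0 add0r expr1n scale1r.
rewrite tr_row_mx mul_row_col trmx0 mulmx0 add0r.
by [].
Qed.

Lemma om_coord p x A : chart_img S p x ->
  fcoord S p om x A =
  2 * (row ord0 A *m ecoord S p Phi x *m gcoord S p g x *m (row ord_max A)^T) 0 0.
Proof.
move=> px; rewrite /fcoord [A *m _]col_mx2 sasakian_om !row_mul.
rewrite /bform /ecoord /gcoord trmx_mul !mulmxA.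
set q := chart_inv S p x; set J := jac_from S p x; set J' := jac_to S p x.
have JJ : J' *m J = 1%:M := jac_to_from sm px.
by move: J J' JJ => J J' JJ; rewrite -(mulmxA _ J' J) JJ mulmx1.
Qed.

(** Through $\omega=2g(\Phi\cdot,\cdot)$ its components are polynomials in those of $\Phi$ and $g$.
    Since [dext] uses a different chart at each point, arguing from $\eta$ would require the
    invariance of $d$ under changes of coordinates. *)
Lemma smooth_form_om : smooth_form S om.
Proof.
split; first exact: omA.
move=> p A; have oO := open_chart_img sm (p := p).
apply: (smooth_eq oO (f := fun x => 2 *
  \sum_k \sum_j row ord0 A 0 k * ecoord S p Phi x k j *
   \sum_l gcoord S p g x j l * row ord_max A 0 l)).
  move=> x px; rewrite om_coord //; congr (_ * _).
  rewrite -mulmxA mxE exchange_big /=; apply: eq_bigr => j _.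
  rewrite mxE -big_distrl /=; congr (_ * _).
  by rewrite mxE; apply: eq_bigr => l _; rewrite !mxE.
apply: (smoothM oO); first exact: smooth_cst.
apply: (smooth_sum oO) => k; apply: (smooth_sum oO) => j.
apply: (smoothM oO).
  apply: (smoothM oO); first exact: smooth_cst.
  apply: smooth_entry => //; have := sas_Phi sas p; rewrite setIT; exact.
apply: (smooth_sum oO) => l; apply: (smoothM oO); last exact: smooth_cst.
apply: smooth_entry => //; have [+ _ _] := sas_g sas => /(_ p); rewrite setIT; exact.
Qed.

(* The Kaehler form of the cone restricts to [om / 2] on the slice [r = 1]; this
   gives [d om = 0] without the symmetry of second derivatives. *)
Lemma sasakian_dom p B : dext S om p B = 0.
Proof.
have [_ _ _ _ K] := sas_cone sas.
have := K (1, p) (row_mx 0 (B : 'M[R]_(3, 7))) ltr01.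
rewrite (dext_cone (w := fscale (fun=> 2^-1) om) sm _ _ cone_fundamental_form).
rewrite dext_scale //; last exact: smooth_form_om.
by move/eqP; rewrite mulf_eq0 invr_eq0 pnatr_eq0 /= => /eqP.
Qed.

End SasakianForms.

(** * Real form of the condition on $|\Upsilon|$ *)

Section ComplexWedge.
Variables (R : realType) (n : nat).
Local Open Scope complex_scope.

Lemma mwedge_real_complex k l (f : 'M[R]_(k, n) -> R) (h : 'M[R]_(l, n) -> R) A :
  mwedge (fun B => (f B)%:C) (fun B => (h B)%:C) A = (mwedge f h A)%:C.
Proof.
rewrite /mwedge rmorphM rmorph_sum fmorphV rmorphM !rmorph_nat; congr (_ * _).
by apply: eq_bigr => s _; rewrite !rmorphM rmorph_sign.
Qed.

Lemma mwedge_conj k (F : 'M[R]_(k, n) -> R[i]) A :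
  let r B := complex.Re (F B) in let s B := complex.Im (F B) in
  mwedge F (fun B => (F B)^*) A =
  (mwedge r r A + mwedge s s A)%:C + 'i%C * (mwedge s r A - mwedge r s A)%:C.
Proof.
move=> r s.
have -> : (fun B => (F B)^*) = fun B => (r B)%:C + (- 'i%C) * (s B)%:C.
  apply/funext => B; rewrite /r /s; case: (F B) => a b.
  apply/eqP; rewrite eq_complex /=; apply/andP; split; apply/eqP; ring.
have -> : F = fun B => (r B)%:C + 'i%C * (s B)%:C.
  by apply/funext => B; exact: complexE.
rewrite mwedgeDl !mwedgeDr !mwedgeZl !mwedgeZr !mwedge_real_complex.
move: (mwedge r r A) (mwedge s s A) (mwedge r s A) (mwedge s r A) => a b c d.
by apply/eqP; rewrite eq_complex /=; apply/andP; split; apply/eqP; ring.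
Qed.

Lemma complex_volume_Re (w c d : R) :
  (3`!%:R)^-1 * w%:C = 'i%C / 8%:R * (c%:C + 'i%C * d%:C) ->
  6^-1 * w = - (8^-1 * d).
Proof.
have -> : (3`!%:R : R[i])^-1 = (6^-1)%:C by rewrite fmorphV rmorph_nat.
have -> : (8%:R : R[i])^-1 = (8^-1)%:C by rewrite fmorphV rmorph_nat.
move=> /(congr1 (@complex.Re R)) /=; rewrite !(mul0r, mulr0, subr0, mul1r, sub0r, add0r, addr0, oppr0).
by [].
Qed.

End ComplexWedge.

Section ContactCalabiYau.
Variables (R : realType) (M : topologicalType) (S : atlas R 7 M).
Variables (xi : vfield R 7 M) (eta : dform R 7 M R 1).
Variables (Phi : endo R 7 M) (g : metric R 7 M) (Ups : dform R 7 M R[i] 3).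
Hypothesis sm : smooth_manifold S.
Hypothesis ccy : contact_calabi_yau S xi eta Phi g Ups.
Hypothesis norm : is_Ups_norm S eta Ups (fun=> 1).
Local Open Scope complex_scope.

Let sas := ccy_sasakian ccy.
Let om := dext S eta.

Lemma ccy_volume p (A : 'M[R]_(6, 7)) :
  6^-1 * @mwedge _ _ _ 2 4 (om p) (@mwedge _ _ _ 2 2 (om p) (om p)) A =
  8^-1 * (@mwedge _ _ _ 3 3 (Re_form Ups p) (Im_form Ups p) A
          - @mwedge _ _ _ 3 3 (Im_form Ups p) (Re_form Ups p) A).
Proof.
have [_ /(_ A)] := norm p.
rewrite /wedge /conj_form mwedge_conj expr1n invr1 mulr1 /cplx_form.
rewrite -/om -/(Re_form Ups p) -/(Im_form Ups p).
move=> /complex_volume_Re ->; rewrite -mulrN opprB.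
by [].
Qed.

Lemma ccy_frame p : exists F,
  su3_frame (eta p) (om p) (Re_form Ups p) (Im_form Ups p) F.
Proof.
have [sR sI] := ccy_smooth ccy; have [bR bI] := ccy_basic ccy.
(* Type $(3,0)$ reads $\Upsilon(u)+i\,\Upsilon(\Phi u)=0$, that is $\Upsilon(\Phi
   u)=i\,\Upsilon(u)$. *)
have type u A : eta p u = 0 ->
    Re_form Ups p (col_mx (u *m Phi p) A) = - Im_form Ups p (col_mx u A) /\
    Im_form Ups p (col_mx (u *m Phi p) A) = Re_form Ups p (col_mx u A).
  move=> h; have := ccy_type ccy A h; rewrite /minsert /Re_form /Im_form.
  case: (Ups p _) => a b; case: (Ups p _) => c d /eqP.
  rewrite eq_complex /= !(mul0r, mul1r, sub0r, add0r) => /andP[/eqP ad /eqP bc].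
  by split; lra.
have [_ gs gp] := sas_g sas.
have omA : multialternating (om p) by exact: dext_alternating (sas_eta sas).
apply: (@su3_frame_exists R (xi p) (Phi p) (g p) (eta p) (om p)
  ((sas_eta sas).1 p).1 omA (gs p I)
  (sas_reeb sas p) (sas_Phi2 sas p) (sas_compat sas p) (sas_metric sas p)
  (Re_form Ups p) (Im_form Ups p) (sR.1 p) (sI.1 p)).
- by move=> A; exact: (bR p).1.
- by move=> A; exact: (bI p).1.
- by move=> u A h; exact: (type u A h).1.
- by move=> u A h; exact: (type u A h).2.
- exact: ccy_volume.
- by move=> u; exact: gp.
Qed.

End ContactCalabiYau.

(** * Derivatives relative to the time interval *)

Section RelativeDerivative.
Variables (R : realType) (I : set R).
Hypothesis tI : time_interval I.
Implicit Types (f h : R -> R) (s t l : R).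

Lemma is_derive_inP f t l : is_derive_in I f t l <->
  forall e, 0 < e -> exists2 d, 0 < d & forall s, I s -> s != t -> `|s - t| < d ->
    `|l - (f s - f t) / (s - t)| <= e.
Proof.
rewrite /is_derive_in; split.
  move=> /cvgrPdist_le H e e0; have := H e e0; rewrite /within /= /dnbhs /within /=.
  move=> /nbhs_ballP[d /= d0 dH]; exists d => // s Is st sd.
  by apply: dH => //; rewrite /ball /= distrC.
move=> H; apply/cvgrPdist_le => e e0; have [d d0 dH] := H e e0.
rewrite /within /= /dnbhs /within /=; apply/nbhs_ballP; exists d => //= s sd st Is.
by apply: dH => //; rewrite distrC.
Qed.

(** An interval with two points has no isolated point; this makes limits within [I], hence relative
    derivatives, unique. *)
Lemma time_interval_not_isolated t d : I t -> 0 < d ->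
  exists s, [/\ I s, s != t & `|s - t| < d].
Proof.
case: tI => iI I0 [u Iu u0] It d0.
have [v Iv vt] : exists2 v, I v & v != t.
  by have [<-|] := eqVneq 0 t; [exists u | exists 0].
have vt0 : 0 < `|v - t| by rewrite normr_gt0 subr_eq0.
(* The bound 1 keeps the new point between [t] and [v], the other bound keeps it within [d / 2] of
   [t]. *)
pose c := Num.min 1 (d / 2 / `|v - t|).
have c0 : 0 < c by rewrite lt_min ltr01 divr_gt0 // divr_gt0.
have c1 : c <= 1 by rewrite ge_min lexx.
exists (t + c * (v - t)); split.
- have [tv|vt'] := ltP t v.
    apply: (iI t v) => //; apply/andP; split.
      by rewrite lerDl mulr_ge0 ?ltW // subr_gt0.
    by rewrite -lerBrDl ler_piMl // subr_ge0 ltW.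
  apply: (iI v t) => //; apply/andP; split.
    rewrite -lerBlDl -[leLHS]opprB -[_ * _]opprK lerN2 -mulrN opprB.
    by rewrite ler_piMl // subr_ge0.
  by rewrite gerDl; apply: mulr_ge0_le0; [exact: ltW | rewrite subr_le0].
- rewrite -subr_eq0 addrAC subrr add0r mulf_neq0 //; first exact: lt0r_neq0.
  by rewrite subr_eq0.
- rewrite addrAC subrr add0r normrM gtr0_norm // (@le_lt_trans _ _ (d / 2)) //.
    by rewrite -ler_pdivlMr // ge_min lexx orbT.
  by rewrite ltr_pdivrMr // ltr_pMr // ltr1n.
Qed.

Lemma within_time_proper t : I t -> ProperFilter (within I t^').
Proof.
move=> It; split; last exact: within_filter.
rewrite /within /= /dnbhs /within /= => /nbhs_ballP[d /= d0 dH].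
have [s [Is st sd]] := time_interval_not_isolated It d0.
by apply: (dH s) => //; rewrite /ball /= distrC.
Qed.

Lemma is_derive_in_unique f t l l' : I t ->
  is_derive_in I f t l -> is_derive_in I f t l' -> l = l'.
Proof.
move=> It fl fl'; have F := within_time_proper It.
exact: (cvg_unique (@norm_hausdorff _ _) fl fl').
Qed.

Lemma is_derive_in_eq f h t l : I t -> (forall s, I s -> f s = h s) ->
  is_derive_in I f t l -> is_derive_in I h t l.
Proof.
move=> It fh /is_derive_inP H; apply/is_derive_inP => e /H[d d0 dH].
by exists d => // s Is st sd; rewrite -!fh //; exact: dH.
Qed.

Lemma is_derive_in_cst c t : is_derive_in I (fun=> c) t 0.
Proof.
apply/is_derive_inP => e e0; exists 1 => // s _ _ _.
by rewrite subrr mul0r subrr normr0 ltW.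
Qed.

Lemma is_derive_in_cont f t l : is_derive_in I f t l ->
  f s @[s --> within I t^'] --> f t.
Proof.
move=> fl.
have c : (s - t) @[s --> within I t^'] --> (0 : R).
  apply/cvgrPdist_lt => e e0; rewrite /within /= /dnbhs /within /=.
  apply/nbhs_ballP; exists e => //= s sd _ _.
  by rewrite sub0r opprB.
have H : (f t + (f s - f t) / (s - t) * (s - t)) @[s --> within I t^'] --> f t + l * 0.
  by apply: cvgD; [exact: cvg_cst | exact: cvgM].
rewrite mulr0 addr0 in H; apply: cvg_trans H; apply: near_eq_cvg.
have Fw : Filter (within I t^') by exact: within_filter.
suff : \forall s \near t, s != t -> I s ->
    f t + (f s - f t) / (s - t) * (s - t) = f s by [].
apply/nbhs_ballP; exists 1 => //= s _ st _; rewrite divfK ?subr_eq0 //.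
by rewrite addrC subrK.
Qed.

Lemma is_derive_inM f h t l m : is_derive_in I f t l -> is_derive_in I h t m ->
  is_derive_in I (fun s => f s * h s) t (l * h t + f t * m).
Proof.
move=> fl hm; have cf := is_derive_in_cont fl; rewrite /is_derive_in.
rewrite (_ : (fun s => _) = fun s => (f s - f t) / (s - t) * h t
    + f s * ((h s - h t) / (s - t))); last by apply/funext => s; ring.
by apply: cvgD; apply: cvgM => //; exact: cvg_cst.
Qed.

Lemma is_derive_in_lin f h a b t l m :
  is_derive_in I f t l -> is_derive_in I h t m ->
  is_derive_in I (fun s => a * f s + b * h s) t (a * l + b * m).
Proof.
move=> fl hm; rewrite /is_derive_in.
rewrite (_ : (fun s => _) = fun s => a * ((f s - f t) / (s - t))
    + b * ((h s - h t) / (s - t))); last by apply/funext => s; ring.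
by apply: cvgD; apply: cvgM => //; exact: cvg_cst.
Qed.

(** Mean value theorem: inside the segment the relative derivative is the two-sided one, and at the
    endpoints continuity is enough. *)
Lemma is_derive_in0_seg f a b : (forall t, I t -> is_derive_in I f t 0) ->
  I a -> I b -> a <= b -> f a = f b.
Proof.
move=> f0 Ia Ib ab; have [iI _ _] := tI.
have Iab x : a <= x <= b -> I x by exact: iI.
have [||c _ /eqP] := @MVT_segment R f (fun=> 0) a b ab.
- move=> x; rewrite in_itv /= => /andP[ax xb].
  have Ix : I x by apply: Iab; rewrite !ltW.
  have xd : 0 < Num.min (x - a) (b - x) by rewrite lt_min !subr_gt0 ax xb.
  have c0 : h^-1 *: (f (h *: 1 + x) - f x) @[h --> 0^'] --> (0 : R).
    apply/cvgrPdist_le => e e0; have /is_derive_inP/(_ _ e0)[d d0 dH] := f0 x Ix.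
    rewrite /dnbhs /within /=; apply/nbhs_ballP.
    exists (Num.min d (Num.min (x - a) (b - x))) => /=; first by rewrite lt_min d0.
    move=> h; rewrite /ball /= sub0r normrN lt_min => /andP[hd].
    rewrite lt_min => /andP[ha hb] h0.
    have hx : h *: 1 + x - x = h by rewrite addrK /GRing.scale /= mulr1.
    have := dH (h *: 1 + x); rewrite hx mulrC; apply.
    + apply: Iab; rewrite /GRing.scale /= mulr1; apply/andP.
      by move: ha hb; rewrite !ltr_norml => /andP[? ?] /andP[? ?]; split; lra.
    + by rewrite -subr_eq0 hx.
    + exact: hd.
  by apply: DeriveDef; [apply: cvgP c0 | exact: cvg_lim c0].
- apply/subspace_continuousP => x /=; rewrite in_itv /= => xab.
  have Ix := Iab x xab; have := is_derive_in_cont (f0 x Ix).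
  move=> /cvgrPdist_le H; apply/cvgrPdist_le => e e0.
  have /nbhs_ballP[d d0 dH] :
    \forall y \near x, y != x -> I y -> `|f x - f y| <= e := H e e0.
  suff : \forall y \near x, y \in `[a, b] -> `|f x - f y| <= e by [].
  apply/nbhs_ballP; exists d => // y yd yab.
  have [->|yx] := eqVneq y x; first by rewrite subrr normr0 ltW.
  by apply: (dH y) => //; apply: Iab; move: yab; rewrite in_itv.
by rewrite mul0r subr_eq0 => /eqP.
Qed.

Lemma is_derive_in0_cst f : (forall t, I t -> is_derive_in I f t 0) ->
  forall t, I t -> f t = f 0.
Proof.
move=> f0 t It; have [_ I0 _] := tI.
have [t0|/ltW t0] := leP t 0; first exact: is_derive_in0_seg.
exact/esym/is_derive_in0_seg.
Qed.

End RelativeDerivative.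

(** * The coflow *)

Section BasisEvaluation.
Variable R : realType.

Definition ebasis (i : nat) : 'rV[R]_7 := delta_mx 0 (inord i).

(** Inserting basis vectors one by one turns evaluation into list contractions, which compute. *)
Lemma ev3_basis s i j k : fwf 3 s -> fbound 7 s -> (i < 7)%N -> (j < 7)%N ->
  fwf 2 (fcontr i s) -> fbound 7 (fcontr i s) ->
  @ev R 6 3 s (col_mx (ebasis i) (col_mx (ebasis j) (ebasis k)) : 'M[R]_(1 + (1 + 1), 7)) =
  @ev R 6 1 (fcontr j (fcontr i s)) (ebasis k).
Proof.
move=> s1 s2 li lj w1 w2; apply: etrans (minsert_ev _ s1 s2 li) _.
exact: (minsert_ev _ w1 w2 lj).
Qed.

Lemma ev4_basis s i j k l : fwf 4 s -> fbound 7 s ->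
  (i < 7)%N -> (j < 7)%N -> (k < 7)%N ->
  fwf 3 (fcontr i s) -> fbound 7 (fcontr i s) ->
  fwf 2 (fcontr j (fcontr i s)) -> fbound 7 (fcontr j (fcontr i s)) ->
  @ev R 6 4 s (col_mx (ebasis i) (col_mx (ebasis j) (col_mx (ebasis k) (ebasis l)))
    : 'M[R]_(1 + (1 + (1 + 1)), 7)) =
  @ev R 6 1 (fcontr k (fcontr j (fcontr i s))) (ebasis l).
Proof.
move=> s1 s2 li lj lk w1 w2 w3 w4; apply: etrans (minsert_ev _ s1 s2 li) _.
exact: ev3_basis.
Qed.

Lemma ev1_basis c i : @ev R 6 1 [:: (c, [:: i])] (ebasis i) = c%:~R.
Proof. by rewrite /ev big_seq1 mon1E mxE !eqxx mulr1. Qed.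

End BasisEvaluation.

Lemma star0 (R : realType) n (M : Type) (g : metric R n M) k l
    (v : dform R n M R (k + l)) (c : dform R n M R k) p B :
  (forall C, c p C = 0) -> star g v c p B = 0.
Proof. by move=> c0; rewrite /star big1 ?mulr0 // => I _; rewrite c0 mul0r. Qed.

Section Flow.
Variables (R : realType) (M : topologicalType) (S : atlas R 7 M).
Variables (xi : vfield R 7 M) (eta : dform R 7 M R 1).
Variables (Phi : endo R 7 M) (g0 : metric R 7 M) (Ups : dform R 7 M R[i] 3).
Hypothesis sm : smooth_manifold S.
Hypothesis ccy : contact_calabi_yau S xi eta Phi g0 Ups.
Hypothesis norm : is_Ups_norm S eta Ups (fun=> 1).

Let sas := ccy_sasakian ccy.
Let om := dext S eta.
Let frame p := ccy_frame sm ccy norm p.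

Let smooth_om : smooth_form S om. Proof. exact: smooth_form_om sas. Qed.
Let smooth_eta : smooth_form S eta. Proof. exact: sas_eta sas. Qed.
Let smooth_Re : smooth_form S (Re_form Ups). Proof. exact: (ccy_smooth ccy).1. Qed.
Let smooth_Im : smooth_form S (Im_form Ups). Proof. exact: (ccy_smooth ccy).2. Qed.

Lemma dext_eta_om p B : @dext R 7 M S 3 (wedge eta om) p B = wedge om om p B.
Proof.
apply: (@dext_wedge R 7 M S sm 1 2 eta om p B smooth_eta smooth_om) => C.
exact: (sasakian_dom sm sas).
Qed.

Lemma dext_om_om p B : @dext R 7 M S 4 (wedge om om) p B = 0.
Proof.
have dom C : dext S om p C = 0 by exact: (sasakian_dom sm sas).
rewrite (@dext_wedge R 7 M S sm 2 2 om om p B smooth_om smooth_om dom).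
rewrite (_ : dext S om p = fun C => 0 * om p (row' ord0 C)).
  by rewrite (@mwedgeZl R 7 R 3 2) mul0r.
by apply/funext => C; rewrite mul0r.
Qed.

(** $\mathrm{Im}\,\Upsilon$ is closed, so the derivative is $\omega\wedge\mathrm{Im}\,\Upsilon$,
    zero by type. *)
Lemma dext_eta_Im p B : @dext R 7 M S 4 (wedge eta (Im_form Ups)) p B = 0.
Proof.
have [F Ff] := frame p.
apply: etrans (su3_wedge_wi Ff B).
apply: (@dext_wedge R 7 M S sm 1 3 eta _ p B smooth_eta smooth_Im) => C.
exact: (ccy_closed ccy p C).2.
Qed.

(** Test vectors that separate coefficients: $\omega^2$ contains $2e^{1234}$, and $\eta$ vanishes on
    $e_1,\dots,e_4$. The next three lemmas do the same with the terms $e^{0136}$ of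
    $\eta\wedge\mathrm{Im}\,\Upsilon$, $e^{135}$ of $\mathrm{Re}\,\Upsilon$ and $e^{012}$ of
    $\eta\wedge\omega$. *)
Lemma exists_om_om : forall p, exists B,
  wedge om om p B = 2 /\ wedge eta (Im_form Ups) p B = 0.
Proof.
move=> p; have [F Ff] := frame p.
exists ((col_mx (ebasis R 1) (col_mx (ebasis R 2) (col_mx (ebasis R 3) (ebasis R 4)))
    : 'M[R]_(1 + (1 + (1 + 1)), 7)) *m F).
split.
  apply: etrans (su3_wedge_ww Ff _) _; rewrite ev4_basis //.
  by rewrite (feqP (t := [:: (2, [:: 4%N])])) ?ev1_basis.
apply: etrans (su3_wedge_ei Ff _) _; rewrite ev4_basis //.
by rewrite (feqP (t := [::])) // /ev big_nil.
Qed.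

Lemma exists_eta_Im : forall p, exists B,
  wedge om om p B = 0 /\ wedge eta (Im_form Ups) p B = 1.
Proof.
move=> p; have [F Ff] := frame p.
exists ((col_mx (ebasis R 0) (col_mx (ebasis R 1) (col_mx (ebasis R 3) (ebasis R 6)))
    : 'M[R]_(1 + (1 + (1 + 1)), 7)) *m F).
split.
  apply: etrans (su3_wedge_ww Ff _) _; rewrite ev4_basis //.
  by rewrite (feqP (t := [::])) // /ev big_nil.
apply: etrans (su3_wedge_ei Ff _) _; rewrite ev4_basis //.
by rewrite (feqP (t := [:: (1, [:: 6%N])])) ?ev1_basis.
Qed.

Lemma exists_Re : forall p, exists B,
  Re_form Ups p B = 1 /\ wedge eta om p B = 0.
Proof.
move=> p; have [F Ff] := frame p.
exists ((col_mx (ebasis R 1) (col_mx (ebasis R 3) (ebasis R 5))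
    : 'M[R]_(1 + (1 + 1), 7)) *m F).
split.
  apply: etrans (su3_r Ff _) _; rewrite ev3_basis //.
  by rewrite (feqP (t := [:: (1, [:: 5%N])])) ?ev1_basis.
apply: etrans (su3_wedge_ew Ff _) _; rewrite ev3_basis //.
by rewrite (feqP (t := [::])) // /ev big_nil.
Qed.

Lemma exists_eta_om : forall p, exists B,
  Re_form Ups p B = 0 /\ wedge eta om p B = 1.
Proof.
move=> p; have [F Ff] := frame p.
exists ((col_mx (ebasis R 0) (col_mx (ebasis R 1) (ebasis R 2))
    : 'M[R]_(1 + (1 + 1), 7)) *m F).
split.
  apply: etrans (su3_r Ff _) _; rewrite ev3_basis //.
  by rewrite (feqP (t := [::])) // /ev big_nil.
apply: etrans (su3_wedge_ew Ff _) _; rewrite ev3_basis //.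
by rewrite (feqP (t := [:: (1, [:: 2%N])])) ?ev1_basis.
Qed.

Section FixedTime.
Variables a b : R.
Hypotheses (a0 : 0 < a) (b0 : 0 < b).

Let phi : dform R 7 M R 3 := fadd (fscale (fun=> b ^+ 3) (Re_form Ups))
  (fscale (fun=> a * b ^+ 2) (wedge eta om)).
Let psi : dform R 7 M R 4 := fadd (fscale (fun=> b ^+ 4 / 2) (wedge om om))
  (fscale (fun=> - (a * b ^+ 3)) (wedge eta (Im_form Ups))).

Lemma smooth_phi : smooth_form S phi.
Proof. by apply: smooth_form_lin => //; exact: (@smooth_form_wedge R 7 M S sm 1 2 eta om). Qed.

(** The adapted frames are chosen point by point; the metric and volume form they define satisfy the
    defining identity at each point. *)
Lemma g2_structure_exists : exists g vol, g2_structure S phi g vol.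
Proof.
have /choice[F Ff] p : exists F : 'M[R]_7, su3_frame (eta p) (om p) (Re_form Ups p)
  (Im_form Ups p) F by exact: frame.
pose F' p := g2_scaling a b *m F p.
exists (fun p => invmx (F' p) *m (invmx (F' p))^T), (fun p A => \det (A *m invmx (F' p))).
split; first exact: smooth_phi.
move=> p.
exact: (g2_metric_exists (g2_frame_unit (Ff p) a0 b0) (g2_frame_phi (Ff p) a0 b0)).
Qed.

Variables (g : metric R 7 M) (vol : dform R 7 M R 7).
Hypothesis G : g2_structure S phi g vol.

Lemma g2_structure_frame p : exists2 F, su3_frame (eta p) (om p) (Re_form Ups p) (Im_form Ups p) F &
  let F' := g2_scaling a b *m F in
  F' *m g p *m F'^T = 1%:M /\ in_frame F' (vol p) [:: (1, iota 0 7)].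
Proof.
have [F Ff] := frame p; exists F => // F'.
have [_ /(_ p) [[gs gp] [vA vN] gE]] := G.
have Fu : F' \in unitmx := g2_frame_unit Ff a0 b0.
apply: (g2_metric_unique Fu (g2_frame_phi Ff a0 b0) _ vA vN gE).
(* The first frame vector is nonzero, which supplies the positivity that fixes the sign of the
   volume. *)
have u0 : (delta_mx 0 0 : 'rV[R]_7) *m F' != 0.
  apply/eqP => e; have := mulmxK Fu (delta_mx 0 0 : 'rV[R]_7).
  rewrite e mul0mx => /(congr1 (fun X : 'rV[R]_7 => X 0 0)).
  by rewrite !mxE !eqxx => /eqP; rewrite eq_sym oner_eq0.
have := gp _ u0; rewrite /inner -delta_bilinE.
by rewrite trmx_mul !mulmxA.
Qed.

Let psi_eq p B : psi p B = b ^+ 4 / 2 * wedge om om p B - a * b ^+ 3 * wedge eta (Im_form Ups) p B.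
Proof. by rewrite /psi /fadd /fscale mulNr. Qed.

Lemma psi_of_phi : psi_of g vol phi = psi.
Proof.
apply/funext => p; apply/funext => B; rewrite psi_eq.
have [F Ff [Fg Fv]] := g2_structure_frame p.
exact: (g2_star_phi Ff a0 b0 Fg Fv B).
Qed.

Lemma star_psi p B : @star R 7 M 4 3 g vol psi p B = phi p B.
Proof.
have [F Ff [Fg Fv]] := g2_structure_frame p.
apply: etrans (g2_star_psi Ff a0 b0 Fg Fv B).
by congr (@mstar R 7 4 3 (invmx (g p)) (vol p) _ B); apply/funext => C; exact: psi_eq.
Qed.

Lemma dext_phi p B : dext S phi p B = a * b ^+ 2 * wedge om om p B.
Proof.
rewrite (dext_lin sm) //; last exact: (@smooth_form_wedge R 7 M S sm 1 2 eta om).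
by rewrite dext_eta_om (ccy_closed ccy p B).1 mulr0 add0r.
Qed.

(** As $\ast\psi=\varphi$, the codifferential of $\psi$ is $\ast d\varphi=\ast(ab^2\omega^2)$. *)
Lemma codiff_psi : codiff4 S g vol psi = fscale (fun=> 2 * a ^+ 2) (wedge eta om).
Proof.
apply/funext => p; apply/funext => B; rewrite /codiff4.
rewrite (_ : @star R 7 M 4 3 g vol psi = phi); last first.
  by apply/funext => q; apply/funext => C; exact: star_psi.
have [F Ff [Fg Fv]] := g2_structure_frame p.
apply: etrans (g2_star_dphi Ff a0 b0 Fg Fv B).
by congr (@mstar R 7 4 3 (invmx (g p)) (vol p) _ B); apply/funext => C; exact: dext_phi.
Qed.

Lemma dext_psi p B : dext S psi p B = 0.
Proof.
rewrite (dext_lin sm); first by rewrite dext_om_om dext_eta_Im !mulr0 addr0.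
  exact: (@smooth_form_wedge R 7 M S sm 2 2 om om).
exact: (@smooth_form_wedge R 7 M S sm 1 3 eta (Im_form Ups)).
Qed.

Lemma laplacian_psi p B : laplacian4 S g vol psi p B = 2 * a ^+ 2 * wedge om om p B.
Proof.
rewrite /laplacian4 /fadd codiff_psi (dext_scale sm); last first.
  exact: (@smooth_form_wedge R 7 M S sm 1 2 eta om).
rewrite dext_eta_om /codiff5 /fscale (@star0 _ _ _ _ 3 4) ?mulr0 ?addr0 // => C.
by apply: dext0 => q D; apply: (@star0 _ _ _ _ 5 2) => E; exact: dext_psi.
Qed.

Lemma tau0_phi p : tau0 S g vol phi p = 6 / 7 * a / b ^+ 2.
Proof.
have [F Ff [Fg Fv]] := g2_structure_frame p.
rewrite /tau0.
have -> : @star R 7 M 7 0 g vol (wedge phi (dext S phi)) p 0 = 6 * a / b ^+ 2.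
  apply: etrans (g2_torsion Ff a0 b0 Fg Fv).
  congr (@mstar R 7 7 0 (invmx (g p)) (vol p) _ 0).
  by rewrite /wedge (funext (dext_phi p)).
by field; rewrite lt0r_neq0.
Qed.

(** $\frac72\tau_0=3a/b^2$ and $d\varphi=ab^2\omega^2$, so the coefficient is
    $2a^2+(A-3a/b^2)\,ab^2=Aab^2-a^2$. *)
Lemma flow_velocity A p B :
  fadd (laplacian4 S g vol psi)
    (dext S (fscale (fun q => A - 7 / 2 * tau0 S g vol phi q) phi)) p B =
  (A * a * b ^+ 2 - a ^+ 2) * wedge om om p B.
Proof.
rewrite /fadd laplacian_psi.
rewrite (_ : fscale _ phi = fscale (fun=> A - 3 * a / b ^+ 2) phi); last first.
  apply/funext => q; apply/funext => C; rewrite /fscale tau0_phi.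
  by congr (_ * _); field; rewrite lt0r_neq0.
rewrite (dext_scale sm); last exact: smooth_phi.
rewrite dext_phi; move: (wedge _ _ _ _) => x; field.
by rewrite lt0r_neq0.
Qed.

End FixedTime.
End Flow.

Theorem theorem4p2 (R : realType) (M : topologicalType) (S : atlas R 7 M)
    (xi : vfield R 7 M) (eta : dform R 7 M R 1) (Phi : endo R 7 M)
    (g : metric R 7 M) (Ups : dform R 7 M R[i] 3)
    (eps A : R) (I : set R) (a b : R -> R) :
  smooth_manifold S -> inhabited M ->
  contact_calabi_yau S xi eta Phi g Ups ->
  transverse_ricci_flat S xi eta g ->
  is_Ups_norm S eta Ups (fun=> 1) ->
  0 < eps ->
  time_interval I ->
  smooth_in I a -> smooth_in I b ->
  (forall t, I t -> 0 < a t /\ 0 < b t) ->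
  let omega := dext S eta in
  let phi t := fadd (fscale (fun=> b t ^+ 3) (Re_form Ups))
                    (fscale (fun=> a t * b t ^+ 2) (wedge eta omega)) in
  (solves_modified_coflow S A I phi /\
   phi 0 = fadd (Re_form Ups) (fscale (fun=> eps) (wedge eta omega)))
  <->
  ((forall t, I t ->
      a t = eps * b t ^- 3 /\
      is_derive_in I b t (2^-1 * eps * b t ^- 9 * (A * b t ^+ 5 - eps))) /\
   a 0 = eps /\ b 0 = 1).
Proof.
move=> sm [p0] ccy _ norm eps0 tI smooth_a smooth_b ab omega phi.
have I0 : I 0 by case: tI.
have b_neq0 t : I t -> b t != 0 by move=> /ab [_ /lt0r_neq0].
have ex_d f : smooth_in I f -> exists df, forall t, I t -> is_derive_in I f t (df t).
  move=> [F [F0 FD]]; exists (F 1%N) => t It.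
  exact: (is_derive_in_eq It F0 (FD 0%N t It)).
have b4 t l : is_derive_in I b t l -> is_derive_in I (fun s => b s ^+ 4 / 2) t (2 * b t ^+ 3 * l).
  move=> bl; have b2 := is_derive_inM bl bl; have := is_derive_inM b2 b2.
  move=> /(is_derive_in_lin (a := 2^-1) (b := 0)) /(_ (is_derive_in_cst I 0 t)).
  rewrite (_ : (fun s => _) = fun s => b s ^+ 4 / 2); last by apply/funext => s; ring.
  by congr (is_derive_in _ _ _ _); field.
split.
- case=> -[gt [vt /= Hflow]] phi0.
  (* For whatever metric and volume form the flow supplies, [psi_of_phi] makes $\psi$ explicit, both
     at time [t] and at the other times of [I]. *)
  have vel t p B : I t -> is_derive_in I
     (fun s => b s ^+ 4 / 2 * wedge omega omega p B - a s * b s ^+ 3 * wedge eta (Im_form Ups) p B) t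
     ((A * a t * b t ^+ 2 - a t ^+ 2) * wedge omega omega p B).
    move=> It; have [Gt /(_ p B)] := Hflow t It; have [at0 bt0] := ab t It.
    rewrite (psi_of_phi sm ccy norm at0 bt0 Gt) (flow_velocity sm ccy norm at0 bt0 Gt).
    apply: is_derive_in_eq It _ => s Is; have [Gs _] := Hflow s Is; have [as0 bs0] := ab s Is.
    rewrite (psi_of_phi sm ccy norm as0 bs0 Gs) /fadd /fscale.
    by rewrite mulNr.
  have b00 : b 0 = 1.
    have [B [RB EB]] := exists_Re sm ccy norm p0.
    have := congr1 (fun f : dform R 7 M R 3 => f p0 B) phi0.
    rewrite /phi /fadd /fscale RB EB !mulr0 !addr0 mulr1 => /eqP.
    by rewrite pexpr_eq1 //; [move=> /eqP | have [_ /ltW] := ab 0 I0].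
  have a00 : a 0 = eps.
    have [B [RB EB]] := exists_eta_om sm ccy norm p0.
    have := congr1 (fun f : dform R 7 M R 3 => f p0 B) phi0.
    by rewrite /phi /fadd /fscale RB EB b00 !expr1n !mulr1 mulr0 !add0r.
  (* On vectors with $\omega^2=0$ and $\eta\wedge\mathrm{Im}\,\Upsilon=1$ the flow says $(ab^3)'=0$,
     and the initial value is $\epsilon$. *)
  have c3 t : I t -> a t * b t ^+ 3 = eps.
    have [B [E1 E2]] := exists_eta_Im sm ccy norm p0.
    move=> It; rewrite -[RHS]mulr1 -a00 -(expr1n _ 3) -[X in a 0 * X ^+ 3]b00.
    apply: (is_derive_in0_cst tI (f := fun s => a s * b s ^+ 3)) => // {}t {}It.
    have := is_derive_in_lin (a := -1) (b := 0) (vel t p0 B It) (is_derive_in_cst I 0 t).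
    rewrite E1 E2 (_ : (fun s => _) = fun s => a s * b s ^+ 3); last first.
      by apply/funext => s; ring.
    by congr (is_derive_in _ _ _ _); ring.
  have aE t : I t -> a t = eps * b t ^- 3.
    by move=> It; rewrite -(c3 t It) mulfK // expf_neq0 // b_neq0.
  split=> // t It; split; first exact: aE.
  (* Smoothness of [b] provides a derivative. The derivative of $b^4/2$ is then computed twice, by
     the product rule and by the flow, and $2b^3\neq0$ is cancelled. *)
  have [db /(_ t It) bd] := ex_d b smooth_b.
  have [B [E1 E2]] := exists_om_om sm ccy norm p0.
  (* The factor $\frac12$ compensates for the value 2 of $\omega^2$ on [B]. *)
  have v := is_derive_in_lin (a := 2^-1) (b := 0) (vel t p0 B It) (is_derive_in_cst I 0 t).
  rewrite E1 E2 (_ : (fun s => _) = fun s => b s ^+ 4 / 2) in v; last first.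
    by apply/funext => s; field.
  have e := is_derive_in_unique tI It (b4 t _ bd) v.
  rewrite (_ : _ * (_ - _) = db t) //.
  have b3 : 2 * b t ^+ 3 != 0 by rewrite mulf_neq0 ?pnatr_eq0 ?expf_neq0 // b_neq0.
  apply: (mulfI b3); rewrite e aE //; field.
  by rewrite b_neq0.
- case=> Hode [a00 b00]; split; last first.
    apply/funext => p; apply/funext => B.
    by rewrite /phi /fadd /fscale a00 b00 !expr1n mul1r mulr1.
  (* The choice ranges over all real [t], with dummy values outside [I]. *)
  have /choice[G HG] t : exists gv : metric R 7 M * dform R 7 M R 7,
      I t -> g2_structure S (phi t) gv.1 gv.2.
    have [It|nIt] := pselect (I t); last by exists (fun=> 0, fun _ _ => 0).
    have [at0 bt0] := ab t It.
    have [g' [v' H]] := g2_structure_exists sm ccy norm at0 bt0.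
    by exists (g', v').
  exists (fun t => (G t).1), (fun t => (G t).2) => /= t It.
  split; first exact: HG.
  move=> p B; have [at0 bt0] := ab t It; have [aE bd] := Hode t It.
  rewrite (psi_of_phi sm ccy norm at0 bt0 (HG t It)).
  rewrite (flow_velocity sm ccy norm at0 bt0 (HG t It)).
  (* Along the system $ab^3=\epsilon$, so the term in $\eta\wedge\mathrm{Im}\,\Upsilon$ is constant
     in time and enters as a multiple of the constant function 1. *)
  have := is_derive_in_lin (a := wedge omega omega p B)
     (b := - (eps * wedge eta (Im_form Ups) p B))
     (b4 t _ bd) (is_derive_in_cst I 1 t).
  rewrite mulr0 addr0.
  rewrite (_ : _ * (_ * (_ * (_ - _))) = (A * a t * b t ^+ 2 - a t ^+ 2) * wedge omega omega p B);
    last first.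
    by rewrite aE; field; rewrite b_neq0.
  apply: is_derive_in_eq It _ => s Is; have [as0 bs0] := ab s Is.
  rewrite (psi_of_phi sm ccy norm as0 bs0 (HG s Is)) /fadd /fscale.
  have [-> _] := Hode s Is.
  by move: (wedge _ _ _ _) (wedge _ _ _ _) => x y; field; rewrite b_neq0.
Qed.
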